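(* Let $X$ be a Polish space with Borel $\sigma$-field $\mathscr B$ and a Borel probability measure $m$. Let $P:L^1(m)\to L^1(m)$ be a Markov operator and let $P(x,A)$ be an associated transition probability. Assume that, for some $n_0\ge1$, $P^{n_0}(x,dy)=p(x,y)\,dm(y)$, and that one of the following holds: (1) there are $\gamma>0$ and $\alpha>0$ such that (a) $m(\operatorname{supp}p(x,\cdot))>\gamma$ for $m$-almost every $x\in X$, and (b) $\alpha\le p(x,y)$ for $m$-almost every $x\in X$ and $m$-almost every $y\in\operatorname{supp}p(x,\cdot)$; (2) there is $\beta>0$ such that $p(x,y)\le\beta$ for $m$-almost every $x\in X$ and $m$-almost every $y\in\operatorname{supp}p(x,\cdot)$. Then $P$ satisfies (UC). In particular, if $P=\mathcal L_f$ is the annealed Perron--Frobenius operator of a random map $f$, then $f$ satisfies (FPM).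
   Context: A Markov operator on $L^1(m)$ is a linear positive operator $P$ with $\int P\varphi\,dm=\int\varphi\,dm$ for all $\varphi$. A transition probability $P(x,A)$ is associated with (induces) $P$ if it is $m$-nonsingular ($m(A)=0$ implies $P(x,A)=0$ for $m$-a.e. $x$) and $\int_AP\varphi\,dm=\int\varphi(x)P(x,A)\,dm(x)$ for all $\varphi\in L^1(m)$, $A\in\mathscr B$. The iterates are $P^n(x,A)=\int P^{n-1}(y,A)P(x,dy)$. $\operatorname{supp}p(x,\cdot)=\{y:p(x,y)\ne0\}$. (UC) (uniformly constrictive): there is a compact set $F\subset L^1(m)$ with $\lim_{n\to\infty}\sup_{h\in D(m)}\inf_{\psi\in F}\|P^nh-\psi\|=0$, where $D(m)=\{h\in L^1(m):h\ge0,\ \|h\|=1\}$. Random map: $(T,\mathscr A,p)$ is a probability space (this measure $p$ is unrelated to the density $p(x,y)$), $f:T\times X\to X$ is measurable, $f_t=f(t,\cdot)$, $(\Omega,\mathbb P)=(T^{\mathbb N},p^{\mathbb N})$, $f^0_\omega=\mathrm{id}$ and $f^n_\omega=f_{\omega_n}\circ\dots\circ f_{\omega_1}$. Its annealed Perron--Frobenius operator $\mathcal L_f$ is the Markov operator induced by the transition probability $p(\{t:f_t(x)\in A\})$ (assumed $m$-nonsingular). When every $f_t$ is nonsingular, $\mathcal L_f\varphi=\int\mathcal L_t\varphi\,dp(t)$ with $\mathcal L_t$ the Perron--Frobenius operator of $f_t$. A probability measure $\mu$ is stationary for $f$ if $\mu(A)=\int\mu(f_t^{-1}A)\,dp(t)$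 for all $A\in\mathscr B$. It is ergodic if $\mathbb P\times\mu$ is ergodic for $F(\omega,x)=(\sigma\omega,f_{\omega_1}(x))$, with $\sigma$ the left shift. (FPM): there exist finitely many ergodic stationary probability measures $\mu_1,\dots,\mu_r$ of $f$ such that 1) they are absolutely continuous with respect to $m$; 2) their supports $\{d\mu_i/dm\ne0\}$ are pairwise disjoint up to an $m$-null set; 3) for any bounded $\mathscr B$-measurable real-valued $\psi$, $m(B_\omega(\mu_1,\psi)\cup\dots\cup B_\omega(\mu_r,\psi))=1$ for $\mathbb P$-a.e. $\omega$, where $B_\omega(\mu_i,\psi)=\{x:\lim_{n\to\infty}\frac1n\sum_{j=0}^{n-1}\psi(f^j_\omega(x))=\int\psi\,d\mu_i\}$. *)

(* Defs.v *)
From HB Require Import structures.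
From mathcomp Require Import all_boot all_order all_algebra.
From mathcomp Require Import generic_quotient ring_quotient.
From mathcomp Require Import all_classical all_reals all_analysis.
From mathcomp Require Import measurable_realfun.

Set Implicit Arguments.
Unset Strict Implicit.
Unset Printing Implicit Defensive.

Import Order.TTheory GRing.Theory Num.Theory.
Import numFieldNormedType.Exports.

Local Open Scope classical_set_scope.
Local Open Scope ring_scope.

(* [LfunType m 1] is the vector space of measurable functions with finite
   L^1 norm; the library puts neither a linear structure nor a norm on its
   quotient by a.e. equality, so the normed space L^1(m) is built here. *)
Section L1.
Context d (T : measurableType d) (R : realType).
Variable m : {measure set T -> \bar R}.

Local Notation L := (LfunType m (lexx 1%E)).

Definition null_fun : {pred L} := [pred f : L | `[< f = cst 0 %[ae m] >]].

Fact null_fun_zmod_closed : zmod_closed null_fun.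
Proof.
split=> [|f g /asboolP f0 /asboolP g0]; apply/asboolP.
  by apply: filterS (ae_eq_refl m setT (cst 0 : T -> R)).
apply: filterS2 f0 g0 => x /= fx gx _.
by rewrite /= -[LHS]/(f x - g x) fx// gx//= subr0.
Qed.

HB.instance Definition _ :=
  GRing.isZmodClosed.Build L null_fun null_fun_zmod_closed.

Definition L1 : Type := Quotient.quot null_fun.
HB.instance Definition _ := Choice.on L1.
HB.instance Definition _ := GRing.Zmodule.on L1.

Definition L1_class (f : L) : L1 := (\pi_(Quotient.quot null_fun) f)%qT.

Definition L1_repr (phi : L1) : L := repr phi.

Definition L1_fun (phi : L1) : T -> R := L1_repr phi.

Lemma L1_reprK : cancel L1_repr L1_class.
Proof. by move=> phi; exact: reprK. Qed.

Lemma L1_class_eq (f g : L) : L1_class f = L1_class g <-> f = g %[ae m].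
Proof.
rewrite /L1_class; split.
  move=> /eqP; rewrite -Quotient.idealrBE => /asboolP.
  by apply: filterS => x fg _; exact: (subr0_eq (fg I)).
move=> fg; apply/eqP; rewrite -Quotient.idealrBE; apply/asboolP.
apply: filterS fg => x /= fg _.
by rewrite -[LHS]/(f x - g x) fg// subrr.
Qed.

Lemma L1_classK (f : L) : L1_repr (L1_class f) = f %[ae m].
Proof. by apply/L1_class_eq; rewrite L1_reprK. Qed.

Lemma L1P (phi psi : L1) : phi = psi <-> L1_fun phi = L1_fun psi %[ae m].
Proof.
rewrite -[in X in X <-> _](L1_reprK phi) -[in X in X <-> _](L1_reprK psi).
exact: L1_class_eq.
Qed.

Lemma L1_classD (f g : L) : L1_class (f + g) = L1_class f + L1_class g.
Proof. exact: (Quotient.pi_add null_fun f g). Qed.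

Lemma L1_class0 : L1_class 0 = 0.
Proof. by apply: (addrI (L1_class 0)); rewrite -L1_classD !addr0. Qed.

Definition L1_scale (a : R) (phi : L1) : L1 := L1_class (a *: L1_repr phi).

Lemma L1_scale_class a (f : L) : L1_scale a (L1_class f) = L1_class (a *: f).
Proof.
apply/L1_class_eq; apply: filterS (L1_classK f) => x /= fx _.
rewrite -[LHS]/(a * L1_repr (L1_class f) x) -[RHS]/(a * f x).
by rewrite fx.
Qed.

Fact L1_scalerA a b phi : L1_scale a (L1_scale b phi) = L1_scale (a * b) phi.
Proof. by rewrite -(L1_reprK phi) !L1_scale_class scalerA. Qed.

Fact L1_scale1r : left_id 1 L1_scale.
Proof. by move=> phi; rewrite -(L1_reprK phi) L1_scale_class scale1r. Qed.

Fact L1_scalerDr : right_distributive L1_scale +%R.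
Proof.
move=> a phi psi; rewrite -(L1_reprK phi) -(L1_reprK psi) -L1_classD.
by rewrite !L1_scale_class scalerDr L1_classD.
Qed.

Fact L1_scalerDl phi : {morph L1_scale^~ phi : a b / a + b}.
Proof.
move=> a b; rewrite -(L1_reprK phi) !L1_scale_class.
by rewrite scalerDl L1_classD.
Qed.

HB.instance Definition _ := GRing.Zmodule_isLmodule.Build R L1
  L1_scalerA L1_scale1r L1_scalerDr L1_scalerDl.

Definition L1_norm (phi : L1) : R := fine (\int[m]_x `|L1_fun phi x|%:E)%E.

Fact L1_measurable_norm (f : L) :
  measurable_fun [set: T] (fun x => `|f x|%:E).
Proof. by apply/measurable_EFinP; apply: measurableT_comp. Qed.

Lemma L1_norm_class (f : L) :
  (L1_norm (L1_class f))%:E = (\int[m]_x `|f x|%:E)%E.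
Proof.
have fN (g : L) : (\int[m]_x `|g x|%:E)%E = ('N[m]_1[EFin \o g])%E.
  by rewrite Lnorm1.
rewrite /L1_norm /L1_fun.
rewrite (_ : (fine _)%:E = (\int[m]_x `|L1_repr (L1_class f) x|%:E)%E).
  apply: ae_eq_integral => //.
  - exact: L1_measurable_norm.
  - exact: L1_measurable_norm.
  - by apply: filterS (L1_classK f) => x /= fx _; rewrite fx.
by rewrite fN; exact: (finite_norm_fine (L1_repr (L1_class f))).
Qed.

Fact L1_ler_normD phi psi : L1_norm (phi + psi) <= L1_norm phi + L1_norm psi.
Proof.
rewrite -(L1_reprK phi) -(L1_reprK psi) -L1_classD -lee_fin EFinD.
rewrite !L1_norm_class -ge0_integralD//=.
- apply: ge0_le_integral => //=.
  + exact: (L1_measurable_norm (L1_repr phi + L1_repr psi)).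
  + by apply: emeasurable_funD; exact: L1_measurable_norm.
  + by move=> x _; rewrite -EFinD lee_fin; exact: ler_normD.
- exact: L1_measurable_norm.
- exact: L1_measurable_norm.
Qed.

Fact L1_normrZ a phi : L1_norm (a *: phi) = `|a| * L1_norm phi.
Proof.
apply: EFin_inj; rewrite EFinM -(L1_reprK phi) -[a *: _]/(L1_scale a _).
rewrite L1_scale_class !L1_norm_class -ge0_integralZl//=.
- by apply: eq_integral => x _; rewrite -EFinM -normrM.
- exact: L1_measurable_norm.
Qed.

Fact L1_normr0_eq0 phi : L1_norm phi = 0 -> phi = 0.
Proof.
move=> n0; rewrite -(L1_reprK phi) -L1_class0; apply/L1_class_eq.
have mf : measurable_fun [set: T] (EFin \o L1_repr phi)
  by apply/measurable_EFinP.
have : (\int[m]_x `|(EFin \o L1_repr phi) x|)%E = 0%E.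
  by rewrite -[LHS](L1_norm_class (L1_repr phi)) L1_reprK n0.
move=> /(ae_eq_integral_abs m measurableT mf).
by apply: filterS => x /(_ I) [].
Qed.

HB.instance Definition _ := Lmodule_isNormed.Build R L1
  L1_ler_normD L1_normrZ L1_normr0_eq0.

Lemma L1_normE (phi : L1) : `|phi| = L1_norm phi.
Proof. by []. Qed.

End L1.

Coercion L1_fun : L1 >-> Funclass.

Definition is_polish (R : realType) (X : topologicalType) : Prop :=
  (exists2 D : set X, countable D & dense D) /\
  exists dist : X -> X -> R,
    [/\ forall x y, dist x y = 0 <-> x = y,
        forall x y, dist x y = dist y x,
        forall x y z, dist x z <= dist x y + dist y z,
        forall x, nbhs x =
          [set A | exists2 e : R, 0 < e & [set y | dist x y < e] `<=` A]
      & forall u : nat -> X,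
          (forall e : R, 0 < e -> exists N, forall i j,
             (N <= i)%N -> (N <= j)%N -> dist (u i) (u j) < e) ->
          exists l : X, u @ \oo --> l].

Notation Borel X := (g_sigma_algebraType (@open X%type)).

Section markov.
Context d (X : measurableType d) (R : realType).
Variable m : {measure set X -> \bar R}.

Definition markov_operator (P : L1 m -> L1 m) : Prop :=
  [/\ linear P,
      forall phi : L1 m,
        {ae m, forall x, 0 <= phi x} -> {ae m, forall x, 0 <= P phi x}
    & forall phi : L1 m, \int[m]_x P phi x = \int[m]_x phi x].

(* The transition probability is passed as a bare function, so that the same
   predicate applies to kernels and to [annealed_transition] below. *)
Definition nonsingular (k : X -> set X -> \bar R) : Prop :=
  forall A, measurable A -> m A = 0%E -> {ae m, forall x, k x A = 0%E}.

Definition induces (k : X -> set X -> \bar R) (P : L1 m -> L1 m) : Prop :=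
  nonsingular k /\
  forall (phi : L1 m) A, measurable A ->
    (\int[m]_(x in A) (P phi x)%:E = \int[m]_x ((phi x)%:E * k x A))%E.

(* [kernel_iter k 0 x] is the Dirac mass at x. *)
Fixpoint kernel_iter (k : R.-pker X ~> X) (n : nat) (x : X) (A : set X)
    : \bar R :=
  if n is n'.+1 then (\int[k x]_y kernel_iter k n' y A)%E else (\d_x A)%E.

Definition supp (g : X -> R) : set X := [set y | g y != 0].

Definition lower_bound_condition (p : X -> X -> R) : Prop :=
  exists gamma alpha : R,
    [/\ 0 < gamma, 0 < alpha,
        {ae m, forall x, (gamma%:E < m (supp (p x)))%E}
      & {ae m, forall x, {ae m, forall y, supp (p x) y -> alpha <= p x y}}].

Definition upper_bound_condition (p : X -> X -> R) : Prop :=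
  exists2 beta : R, 0 < beta &
    {ae m, forall x, {ae m, forall y, supp (p x) y -> p x y <= beta}}.

Definition densities : set (L1 m) :=
  [set h : L1 m | {ae m, forall x, 0 <= h x} /\ `|h| = 1].

(* The infimum and supremum are taken in \bar R: the infimum over an empty
   set is then +oo, whereas in R it would be 0. *)
Definition uniformly_constrictive (P : L1 m -> L1 m) : Prop :=
  exists2 F : set (L1 m), compact F &
    (fun n => ereal_sup [set ereal_inf [set `|iter n P h - psi|%:E | psi in F]
                        | h in densities]) @ \oo --> (0 : \bar R).

End markov.

(* T^N with the product sigma-algebra; the paper's w_1, w_2, ... are
   w 0, w 1, ... *)
Definition cylinders d (T : measurableType d) : set (set (nat -> T)) :=
  [set C | exists i A, measurable A /\ C = [set w | A (w i)]].

Notation sequence_space T := (g_sigma_algebraType (@cylinders _ T)).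

(* Characterizes q^N, the unique probability with these values. *)
Definition is_product_probability d (T : measurableType d) (R : realType)
    (q : probability T R) (Q : probability (sequence_space T) R) : Prop :=
  forall n (A : nat -> set T), (forall i, measurable (A i)) ->
    Q [set w | forall i, (i < n)%N -> A i (w i)] = (\prod_(i < n) q (A i))%E.

Definition ergodic d (S : measurableType d) (R : realType)
    (Q : set S -> \bar R) (F : S -> S) : Prop :=
  [/\ measurable_fun [set: S] F,
      forall A, measurable A -> Q (F @^-1` A) = Q A
    & forall A, measurable A -> F @^-1` A = A -> Q A = 0%E \/ Q A = 1%E].

Section random_map.
Context dT (T : measurableType dT) dX (X : measurableType dX) (R : realType).
Variables (q : probability T R) (Q : probability (sequence_space T) R).
Variables (m : probability X R) (f : T * X -> X).

Definition annealed_transition (x : X) (A : set X) : \bar R :=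
  q [set t | A (f (t, x))].

Fixpoint random_iter (n : nat) (w : nat -> T) (x : X) : X :=
  if n is n'.+1 then f (w n', random_iter n' w x) else x.

Definition stationary (mu : probability X R) : Prop :=
  forall A, measurable A ->
    mu A = (\int[q]_t mu [set x | A (f (t, x))])%E.

Definition skew_product (z : sequence_space T * X) : sequence_space T * X :=
  (fun n => z.1 n.+1, f (z.1 0%N, z.2)).

Definition ergodic_stationary (mu : probability X R) : Prop :=
  stationary mu /\ ergodic (Q \x mu)%E skew_product.

Definition density_supp (mu : probability X R) : set X :=
  [set x | Radon_Nikodym (charge_of_finite_measure mu) m x != 0%E].

Definition basin (w : nat -> T) (mu : probability X R) (psi : X -> R)
    : set X :=
  [set x | (fun n => n%:R^-1 * \sum_(j < n) psi (random_iter j w x)) @ \oo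
             --> \int[mu]_y psi y].

Definition FPM : Prop :=
  exists r (mu : 'I_r -> probability X R),
    [/\ forall i, ergodic_stationary (mu i),
        forall i, mu i `<< m,
        forall i j, i != j ->
          m (density_supp (mu i) `&` density_supp (mu j)) = 0%E
      & forall psi : X -> R, measurable_fun [set: X] psi ->
          (exists M : R, forall x, `|psi x| <= M) ->
          {ae Q, forall w,
             m (\bigcup_(i in [set: 'I_r]) basin w (mu i) psi) = 1%E}].

End random_map.

(* Main.v *)
(* Put [kappa = P^n0(x, dy)].  Either hypothesis gives a Doeblin condition
   [kappa(x, A) <= rho + c m(A)] with [rho < 1].  Cutting [P^n0 h] at height
   [c] leaves an excess of mass at most [rho]; iterating, [P^(n n0) h] lies
   within [rho^n] of images of densities bounded by [c].  These images are
   totally bounded: the Borel sets of a Polish space being countably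
   generated, the densities [p(x, .)] are approximated by conditional
   expectations on finite partitions, in the mean over [x], hence so are the
   images, uniformly.  This gives (UC).

   The Doeblin bound passes to stationary measures [nu << m], in the form
   [nu(A) <= rho + c m(A)], so at most finitely many of them can be carried by
   disjoint sets.  Take a maximal such family.  If [A] is invariant under the
   skew product, [u(x) = Q{w | (w, x) in A}] is harmonic, and superlevel sets
   of harmonic functions carry stationary measures; maximality thus makes [u]
   constant for each member of the family.  Then [A] is independent of all
   cylinders, so of itself, and the members are ergodic.  By Birkhoff's theorem
   the set of [(w, x)] with [x] in some basin has [u = 1] on each member;
   were [u < 1] with positive [m]-measure, a limit of Cesaro means given by
   (UC) would carry one more stationary measure. *)
Require Import Defs.
From HB Require Import structures.
From mathcomp Require Import all_boot all_order all_algebra.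
From mathcomp Require Import all_classical all_reals all_analysis.
From mathcomp Require Import measurable_realfun ring lra.

Set Implicit Arguments.
Unset Strict Implicit.
Unset Printing Implicit Defensive.

Import Order.TTheory GRing.Theory Num.Theory.
Import numFieldNormedType.Exports.

Local Open Scope classical_set_scope.
Local Open Scope ring_scope.

(** * The space L^1(m) *)

(** The kernel [k] behind the density bounds and the transition probability of a random map both
    induce [P], but they need not coincide. The Doeblin bound therefore travels through [P] alone: a
    stationary measure [nu << m] has a density fixed by [P], hence by [P^n0], and the bound on
    [P^n0] is integrated against that density.

    The density [p] is measurable in its second variable only, so Tonelli is applied not to [p] but
    to its averages over finite partitions, which are determined by the kernel.

    Harmonic functions are harmonic at every point, not almost everywhere, because the same [u] is
    read under [m], under each member of the maximal family and under restrictions of stationary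
    measures. Accordingly all invariant sets are exactly invariant, the union of the basins
    included. Superlevel sets of such a [u] can be cut out of a stationary measure because [u] is
    constant along almost every transition: its second moment does not change in one step. *)

Section L1_theory.
Context d (T : measurableType d) (R : realType).
Variable m : {measure set T -> \bar R}.
Implicit Types phi psi : L1 m.

Lemma L1_measurable phi : measurable_fun [set: T] phi.
Proof. exact: (measurable_funPT (L1_repr phi)). Qed.

Lemma L1_normEFin phi : (`|phi|%:E = \int[m]_x `|phi x|%:E)%E.
Proof. by rewrite -{1}(L1_reprK phi) L1_norm_class. Qed.

Lemma L1_integrable phi : m.-integrable [set: T] (EFin \o phi).
Proof.
apply/integrableP; split; first exact/measurable_EFinP/L1_measurable.
by rewrite [X in (X < _)%E](_ : _ = `|phi|%:E) ?ltry// L1_normEFin.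
Qed.

Definition mkL1 (f : T -> R) (fi : m.-integrable [set: T] (EFin \o f)) : L1 m :=
  L1_class (Lfun_Sub (lexx 1%E) ((Lfun1_integrable m f).2 fi)).

Lemma mkL1E f fi : {ae m, forall x, @mkL1 f fi x = f x}.
Proof.
by apply: filterS (L1_classK (Lfun_Sub (lexx 1%E) ((Lfun1_integrable m f).2 fi)))
  => x /(_ I).
Qed.

Lemma L1_ext phi psi : {ae m, forall x, phi x = psi x} -> phi = psi.
Proof. by move=> e; apply/L1P; apply: filterS e. Qed.

Lemma L1_classE (f : LfunType m (lexx 1%E)) : {ae m, forall x, L1_class f x = f x}.
Proof. by apply: filterS (L1_classK f) => x /(_ I). Qed.

Lemma L1_addE phi psi : {ae m, forall x, L1_fun (phi + psi) x = phi x + psi x}.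
Proof.
apply: filterS (L1_classE (L1_repr phi + L1_repr psi)) => x.
by rewrite L1_classD !L1_reprK.
Qed.

Lemma L1_scaleE a phi : {ae m, forall x, L1_fun (a *: phi) x = a * phi x}.
Proof. exact: L1_classE. Qed.

Lemma L1_oppE phi : {ae m, forall x, L1_fun (- phi) x = - phi x}.
Proof.
by apply: filterS (L1_scaleE (-1) phi) => x; rewrite scaleN1r mulN1r.
Qed.

Lemma L1_subE phi psi : {ae m, forall x, L1_fun (phi - psi) x = phi x - psi x}.
Proof. by apply: filterS2 (L1_addE phi (- psi)) (L1_oppE psi) => x -> ->. Qed.

Lemma L1_0E : {ae m, forall x, L1_fun (0 : L1 m) x = 0}.
Proof. by apply: filterS (L1_scaleE 0 0) => x; rewrite scale0r mul0r. Qed.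

Lemma L1_norm_dist phi psi :
  (`|phi - psi|%:E = \int[m]_x `|phi x - psi x|%:E)%E.
Proof.
rewrite L1_normEFin; apply: ae_eq_integral => //.
- by apply/measurable_EFinP; apply: measurableT_comp => //; exact: L1_measurable.
- apply/measurable_EFinP; apply: measurableT_comp => //.
  by apply: measurable_funB; exact: L1_measurable.
- by apply: filterS (L1_subE phi psi) => x ->.
Qed.

Lemma L1_eqP phi psi :
  (forall A, measurable A ->
     (\int[m]_(x in A) (phi x)%:E = \int[m]_(x in A) (psi x)%:E)%E) ->
  phi = psi.
Proof.
move=> e; apply/L1P.
have : ae_eq m setT (EFin \o phi) (EFin \o psi).
  apply: integral_ae_eq => //; first exact: L1_integrable.
    exact/measurable_EFinP/L1_measurable.
  by move=> A _ mA; exact: e.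
by apply: filterS => x /(_ I) [].
Qed.

Definition L1_nneg phi := {ae m, forall x, 0 <= phi x}.

Lemma L1_nnegE phi : L1_nneg phi -> (`|phi|%:E = \int[m]_x (phi x)%:E)%E.
Proof.
move=> p0; rewrite L1_normEFin; apply: ae_eq_integral => //.
- by apply/measurable_EFinP; apply: measurableT_comp => //; exact: L1_measurable.
- exact/measurable_EFinP/L1_measurable.
- by apply: filterS p0 => x p0 _; rewrite ger0_norm.
Qed.

(** Nonnegativity of a class holds only almost everywhere, whereas the disintegration formula below
    asks for densities that are nonnegative at every point. *)
Lemma L1_nneg_repr phi : L1_nneg phi ->
  exists f : T -> R, [/\ forall x, 0 <= f x, measurable_fun setT f
    & {ae m, forall x, phi x = f x}].
Proof.
move=> p0; exists (fun x => Num.max 0 (phi x)); split.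
- by move=> x; rewrite le_max lexx.
- by apply: measurable_maxr => //; exact: L1_measurable.
- by apply: filterS p0 => x p0; rewrite max_r.
Qed.

End L1_theory.

(** * Duality for Markov operators and kernels *)

Section ge0_induction.
Local Open Scope ereal_scope.
Context d (T : measurableType d) (R : realType) (C : (T -> \bar R) -> Prop).
Hypothesis C_indic : forall A, measurable A -> C (fun x => (\1_A x)%:E).
Hypothesis C_add : forall f g,
  (forall x, 0 <= f x) -> measurable_fun [set: T] f ->
  (forall x, 0 <= g x) -> measurable_fun [set: T] g ->
  C f -> C g -> C (fun x => f x + g x).
Hypothesis C_scale : forall (k : R) f, (0 <= k)%R ->
  (forall x, 0 <= f x) -> measurable_fun [set: T] f ->
  C f -> C (fun x => k%:E * f x).
Hypothesis C_lim : forall f : (T -> \bar R)^nat,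
  (forall n x, 0 <= f n x) -> (forall n, measurable_fun [set: T] (f n)) ->
  (forall x, nondecreasing_seq (f ^~ x)) ->
  (forall n, C (f n)) -> C (fun x => limn (f ^~ x)).

Import HBNNSimple.

Let C_nnsfun (h : {nnsfun T >-> R}) : C (EFin \o h).
Proof.
(* A negative [r] is not a value of [h]; truncating it at 0 keeps every term of the sum nonnegative,
   as the clauses for sums and scalings require. *)
pose F (r : R) (x : T) : \bar R :=
  (Num.max r 0)%:E * (\1_(h @^-1` [set r]) x)%:E.
have F0 r x : 0 <= F r x.
  by rewrite mule_ge0// lee_fin// le_max lexx orbT.
have mF r : measurable_fun [set: T] (F r).
  by apply: measurable_funeM; exact/measurable_EFinP.
have [rs ->] : exists rs : seq R, EFin \o h = (fun x => \sum_(r <- rs) F r x).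
  exists (finmap.enum_fset (fset_set (range h))); apply/funext => x /=.
  rewrite fimfunE fsbig_finite//= -sumEFin.
  apply: eq_big_seq => r; rewrite in_fset_set// inE => -[y _ <-].
  by rewrite /F max_l.
elim: rs => [|r s IH].
  rewrite (_ : (fun _ => _) = (fun x => (\1_(@set0 T) x)%:E)); last first.
    by apply/funext => x; rewrite big_nil indicE in_set0.
  exact: C_indic.
rewrite (_ : (fun _ => _) = (fun x => F r x + \sum_(i <- s) F i x)); last first.
  by apply/funext => x; rewrite big_cons.
apply: C_add => //.
- by move=> x; apply: sume_ge0.
- exact: emeasurable_sum.
- apply: C_scale => //; first by rewrite le_max lexx orbT.
  + exact/measurable_EFinP.
  + exact: C_indic.
Qed.

(** The standard machine: simple functions are finite sums of scaled indicators, and every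
    nonnegative measurable function is an increasing limit of simple ones. *)
Lemma ge0_measurable_ind f : (forall x, 0 <= f x) ->
  measurable_fun [set: T] f -> C f.
Proof.
move=> f0 mf; pose f_ := nnsfun_approx measurableT mf.
have -> : f = fun x => limn (fun n => (f_ n x)%:E).
  by apply/funext => x; apply/esym/cvg_lim => //; exact: cvg_nnsfun_approx.
apply: (@C_lim (fun n => EFin \o f_ n)).
- by move=> n x /=; rewrite lee_fin.
- by move=> n; exact/measurable_EFinP.
- by move=> x a b ab /=; rewrite lee_fin; exact/lefP/nd_nnsfun_approx.
- by move=> n; exact: C_nnsfun.
Qed.

End ge0_induction.

(** The hypothesis is the conclusion for indicators, and induction on [g] does the rest. It is used
    with the transition kernel of [P], with [a = b = 1] for stationary measures, and with Dirac
    masses for measures given by a density. *)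
Lemma integral_disintegration d (X : measurableType d) d' (Y : measurableType d')
    (R : realType) (m1 : {measure set X -> \bar R}) (m2 : {measure set Y -> \bar R})
    (kappa : X -> {measure set Y -> \bar R}) (a : X -> R) (b : Y -> R) :
  (forall A, measurable A -> measurable_fun [set: X] (kappa ^~ A)) ->
  (forall x, 0 <= a x) -> measurable_fun [set: X] a ->
  (forall y, 0 <= b y) -> measurable_fun [set: Y] b ->
  (forall A, measurable A ->
    \int[m2]_(y in A) (b y)%:E = \int[m1]_x ((a x)%:E * kappa x A))%E ->
  forall g : Y -> \bar R, (forall y, 0 <= g y)%E -> measurable_fun [set: Y] g ->
  (\int[m2]_y ((b y)%:E * g y) =
   \int[m1]_x ((a x)%:E * \int[kappa x]_y g y))%E.
Proof.
move=> mk a0 ma b0 mb H.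
have mag f : (forall x, (0 <= f x)%E) -> measurable_fun [set: Y] f ->
    measurable_fun [set: X] (fun x => (a x)%:E * \int[kappa x]_y f y)%E.
  move=> f0 mf; apply: emeasurable_funM; first exact/measurable_EFinP.
  exact: measurable_fun_integral_kernel.
have mbg f : measurable_fun [set: Y] f ->
    measurable_fun [set: Y] (fun x => (b x)%:E * f x)%E.
  by move=> mf; apply: emeasurable_funM => //; exact/measurable_EFinP.
apply: ge0_measurable_ind => [A mA|f g f0 mf g0 mg ef eg|c f c0 f0 mf ef|f f0 mf ndf ef].
- under [RHS]eq_integral do rewrite integral_indic// setIT.
  rewrite -H// [RHS]integral_mkcond; apply: eq_integral => y _.
  rewrite /patch indicE; case: ifPn; first by rewrite mule1.
  by rewrite mule0.
- under eq_integral do rewrite ge0_muleDr//.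
  transitivity (\int[m2]_y ((b y)%:E * f y) + \int[m2]_y ((b y)%:E * g y))%E.
    apply: ge0_integralD => //; [|exact: mbg| |exact: mbg].
      by move=> x _; rewrite mule_ge0// lee_fin.
    by move=> x _; rewrite mule_ge0// lee_fin.
  rewrite ef eg; transitivity (\int[m1]_x
      ((a x)%:E * \int[kappa x]_y f y + (a x)%:E * \int[kappa x]_y g y))%E.
    apply/esym; apply: ge0_integralD => //; [|exact: mag| |exact: mag].
      by move=> x _; rewrite mule_ge0// ?lee_fin// integral_ge0.
    by move=> x _; rewrite mule_ge0// ?lee_fin// integral_ge0.
  apply: eq_integral => x _.
  have -> : (\int[kappa x]_y (f y + g y) =
      \int[kappa x]_y f y + \int[kappa x]_y g y)%E by exact: ge0_integralD.
  by apply/esym; apply: ge0_muleDr; apply: integral_ge0 => y _.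
- under eq_integral do rewrite muleCA.
  rewrite ge0_integralZl//; last 2 first.
  + exact: mbg.
  + by move=> x _; rewrite mule_ge0// lee_fin.
  rewrite ef -ge0_integralZl//; last 2 first.
  + exact: mag.
  + by move=> x _; rewrite mule_ge0// ?lee_fin// integral_ge0.
  by apply: eq_integral => x _; rewrite ge0_integralZl// muleCA.
- have cvf x : cvgn (f ^~ x) by exact: ereal_nondecreasing_is_cvgn.
  under eq_integral do rewrite -limeMl//.
  rewrite monotone_convergence//; last 3 first.
  + by move=> n; exact: mbg.
  + by move=> n x _; rewrite mule_ge0// lee_fin.
  + by move=> x _ p q pq; rewrite lee_wpmul2l ?lee_fin//; exact: ndf.
  under eq_fun do rewrite ef.
  have ndI x : nondecreasing_seq (fun n => \int[kappa x]_y f n y)%E.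
    by move=> p q pq; apply: ge0_le_integral => // y _; exact: ndf.
  rewrite -monotone_convergence//; last 3 first.
  + by move=> n; exact: mag.
  + by move=> n x _; rewrite mule_ge0// ?lee_fin// integral_ge0.
  + by move=> x _ p q pq; rewrite lee_wpmul2l ?lee_fin//; exact: ndI.
  apply: eq_integral => x _; rewrite limeMl//; last first.
    exact: ereal_nondecreasing_is_cvgn.
  by rewrite -monotone_convergence// => y _; exact: ndf.
Qed.

Section markov_theory.
Context d (X : measurableType d) (R : realType) (m : {measure set X -> \bar R}).
Implicit Types (P : L1 m -> L1 m) (h : L1 m).

Lemma L1_Rintegral_norm h : L1_nneg h -> `|h| = \int[m]_x h x.
Proof. by move=> h0; apply: EFin_inj; rewrite L1_nnegE// fineK// integrable_fin_num// L1_integrable. Qed.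

Lemma markov_norm_nneg P h : markov_operator P -> L1_nneg h -> `|P h| = `|h|.
Proof.
by move=> [_ P0 Pi] h0; rewrite !L1_Rintegral_norm//; exact: P0.
Qed.

Lemma markovD P h1 h2 : markov_operator P -> P (h1 + h2) = P h1 + P h2.
Proof. by move=> [lP _ _]; have := lP 1 h1 h2; rewrite !scale1r. Qed.

Lemma markov0 P : markov_operator P -> P 0 = 0.
Proof.
by move=> mP; apply: (addrI (P 0)); rewrite -(markovD _ _ mP) !addr0.
Qed.

Lemma markovZ P c h : markov_operator P -> P (c *: h) = c *: P h.
Proof.
by move=> mP; have [lP _ _] := mP; have := lP c h 0; rewrite (markov0 mP) !addr0.
Qed.

Lemma markovN P h : markov_operator P -> P (- h) = - P h.
Proof. by move=> mP; rewrite -scaleN1r (markovZ _ _ mP) scaleN1r. Qed.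

Lemma markovB P h1 h2 : markov_operator P -> P (h1 - h2) = P h1 - P h2.
Proof. by move=> mP; rewrite (markovD _ _ mP) (markovN _ mP). Qed.

Lemma L1_norm_add_nneg (h1 h2 : L1 m) : L1_nneg h1 -> L1_nneg h2 ->
  `|h1 + h2| = `|h1| + `|h2|.
Proof.
move=> n1 n2; rewrite !L1_Rintegral_norm//; last first.
  by apply: filterS3 (L1_addE h1 h2) n1 n2 => x -> ? ?; rewrite addr_ge0.
rewrite -RintegralD//; [|exact: L1_integrable..].
apply: EFin_inj; rewrite !fineK; last 2 first.
- apply: integrable_fin_num => //.
  exact: (integrableD measurableT (L1_integrable h1) (L1_integrable h2)).
- by apply: integrable_fin_num => //; exact: L1_integrable.
apply: ae_eq_integral => //.
- exact/measurable_EFinP/L1_measurable.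
- by apply/measurable_EFinP; apply: measurable_funD; exact: L1_measurable.
- by apply: filterS (L1_addE h1 h2) => x ->.
Qed.

Lemma L1_pos_neg h : exists h1 h2 : L1 m,
  [/\ L1_nneg h1, L1_nneg h2, h = h1 - h2 & `|h| = `|h1| + `|h2|].
Proof.
have i1 : m.-integrable [set: X] (EFin \o (fun x => Num.max (h x) 0)).
  have := integrable_funrpos measurableT (L1_integrable h).
  by apply: eq_integrable.
have i2 : m.-integrable [set: X] (EFin \o (fun x => Num.max (- h x) 0)).
  have := integrable_funrneg measurableT (L1_integrable h).
  by apply: eq_integrable.
have n1 : L1_nneg (mkL1 i1).
  by apply: filterS (mkL1E i1) => x ->; rewrite le_max lexx orbT.
have n2 : L1_nneg (mkL1 i2).
  by apply: filterS (mkL1E i2) => x ->; rewrite le_max lexx orbT.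
exists (mkL1 i1), (mkL1 i2); split => //.
  apply: L1_ext; apply: filterS3 (L1_subE (mkL1 i1) (mkL1 i2)) (mkL1E i1) (mkL1E i2).
  move=> x -> -> ->; have [h0|h0] := leP 0 (h x).
    by rewrite max_r ?oppr_le0// subr0.
  by rewrite max_l ?oppr_ge0 ?(ltW h0)// opprK add0r.
rewrite -L1_norm_add_nneg//; apply: EFin_inj; rewrite !L1_normEFin.
apply: ae_eq_integral => //.
- by apply/measurable_EFinP; apply: measurableT_comp => //; exact: L1_measurable.
- by apply/measurable_EFinP; apply: measurableT_comp => //; exact: L1_measurable.
- apply: filterS3 (L1_addE (mkL1 i1) (mkL1 i2)) (mkL1E i1) (mkL1E i2).
  move=> x -> -> -> _; have [h0|h0] := leP 0 (h x).
    by rewrite max_r ?oppr_le0// addr0.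
  by rewrite max_l ?oppr_ge0 ?(ltW h0)// add0r normrN.
Qed.

(** On the positive and negative parts of [h] the norm is an integral, which [P] preserves. *)
Lemma markov_contract P h : markov_operator P -> `|P h| <= `|h|.
Proof.
move=> mP; have [h1 [h2 [n1 n2 -> ->]]] := L1_pos_neg h.
rewrite (markovB _ _ mP) (le_trans (ler_normB _ _))//.
by rewrite !(markov_norm_nneg mP).
Qed.

Lemma markov_iter P n : markov_operator P -> markov_operator (iter n P).
Proof.
move=> mP; elim: n => [|n [l0 p0 i0]].
  by split => //.
have [lP pP iP] := mP; split => [a x y|h h0|h].
- by rewrite !iterS l0 lP.
- by rewrite iterS; apply: pP; exact: p0.
- by rewrite iterS iP i0.
Qed.

End markov_theory.

Section kernel_iterates.
Context d (X : measurableType d) (R : realType).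
Variables (k : R.-pker X ~> X) (m : {measure set X -> \bar R}).

Lemma kernel_iter_ge0 n x A : (0 <= kernel_iter k n x A)%E.
Proof.
by elim: n x => [|n IH] x //=; apply: integral_ge0.
Qed.

Lemma measurable_kernel_iter n A : measurable A ->
  measurable_fun [set: X] (fun x => kernel_iter k n x A).
Proof.
move=> mA; elim: n => [|n IH] /=.
  by apply/measurable_EFinP => /=; exact: measurable_indic.
apply: measurable_fun_integral_kernel => //.
- by move=> U mU; exact: measurable_kernel.
- by move=> z; exact: kernel_iter_ge0.
Qed.

Lemma kernel_iterT n x : kernel_iter k n x [set: X] = 1%E.
Proof.
elim: n x => [|n IH] x /=; first by rewrite diracT.
under eq_integral do rewrite IH.
by rewrite integral_cst//= mul1e prob_kernel.
Qed.

(** Of [n + 1] steps, the last [n] act on [P h] and are handled by induction; the disintegration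
    formula then moves the first one from [P] to the kernel. *)
Lemma induces_iter (P : L1 m -> L1 m) (mP : markov_operator P)
    (kP : induces (fun x A => k x A) P) n (h : L1 m) A :
  L1_nneg h -> measurable A ->
  (\int[m]_(x in A) (iter n P h x)%:E =
   \int[m]_x ((h x)%:E * kernel_iter k n x A))%E.
Proof.
move=> h0 mA; elim: n h h0 => [|n IH] h h0.
  rewrite /= integral_mkcond; apply: eq_integral => x _.
  rewrite /patch/= diracE; case: ifPn; first by rewrite mule1.
  by rewrite mule0.
rewrite iterSr IH; last by have [_ P0 _] := mP; exact: P0.
have [a [a0 ma ha]] := L1_nneg_repr h0.
have [b [b0 mb hb]] : exists f : X -> R, [/\ forall x, 0 <= f x,
    measurable_fun setT f & {ae m, forall x, P h x = f x}].
  by apply: L1_nneg_repr; have [_ P0 _] := mP; exact: P0.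
have mK := measurable_kernel_iter n mA.
transitivity (\int[m]_x ((b x)%:E * kernel_iter k n x A))%E.
  apply: ae_eq_integral => //.
  - by apply: emeasurable_funM => //; exact/measurable_EFinP/L1_measurable.
  - by apply: emeasurable_funM => //; exact/measurable_EFinP.
  - by apply: filterS hb => x ->.
have mkI B : measurable B -> measurable_fun [set: X] (k ^~ B).
  by move=> mB; exact: measurable_kernel.
rewrite (integral_disintegration (m1 := m) mkI a0 ma b0 mb _ _ mK); last 2 first.
- move=> B mB; transitivity (\int[m]_(x in B) (P h x)%:E)%E.
    apply: ae_eq_integral => //.
    + exact/measurable_funTS/measurable_EFinP.
    + exact/measurable_funTS/measurable_EFinP/L1_measurable.
    + by apply: filterS hb => x ->.
  rewrite (kP.2 _ _ mB); apply: ae_eq_integral => //.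
  + by apply: emeasurable_funM; [exact/measurable_EFinP/L1_measurable|exact: mkI].
  + by apply: emeasurable_funM; [exact/measurable_EFinP|exact: mkI].
  + by apply: filterS ha => x ->.
- by move=> z; exact: kernel_iter_ge0.
apply: ae_eq_integral => //.
- apply: emeasurable_funM; first exact/measurable_EFinP.
  apply: measurable_fun_integral_kernel => // z; exact: kernel_iter_ge0.
- apply: emeasurable_funM; first exact/measurable_EFinP/L1_measurable.
  apply: measurable_fun_integral_kernel => // z; exact: kernel_iter_ge0.
- by apply: filterS ha => x ->.
Qed.

End kernel_iterates.

(** * Approximation by finite partitions *)

Lemma cvge0_lt (R : realType) (u : nat -> \bar R) (e : R) :
  u @ \oo --> 0%E -> 0 < e ->
  exists N, forall n, (N <= n)%N -> (u n < e%:E)%E.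
Proof.
move=> /fine_cvgP[[N1 _ fu] /cvgrPdist_lt cu] e0.
have [N2 _ lu] := cu _ e0; exists (maxn N1 N2) => n.
rewrite geq_max => /andP[n1 n2].
rewrite -(fineK (fu n n1)) lte_fin.
have := lu n n2; rewrite /= sub0r normrN; apply: le_lt_trans.
exact: ler_norm.
Qed.

Section L1_distance.
Local Open Scope ereal_scope.
Context d (X : measurableType d) (R : realType) (m : {measure set X -> \bar R}).
Implicit Types f g h : X -> R.

(** Defined on functions, not classes, with values in [\bar R], so that the triangle inequality asks
    only for measurability; it is applied to sections [p x] and to step functions. *)
Definition L1dist f g := \int[m]_x `|f x - g x|%:E.

Lemma measurable_dist f g : measurable_fun [set: X] f -> measurable_fun [set: X] g ->
  measurable_fun [set: X] (fun x => `|f x - g x|%:E).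
Proof.
move=> mf mg; apply/measurable_EFinP; apply: measurableT_comp => //.
exact: measurable_funB.
Qed.

Lemma L1dist_ge0 f g : 0 <= L1dist f g.
Proof. by apply: integral_ge0 => x _; rewrite lee_fin. Qed.

Lemma L1dist_refl f : L1dist f f = 0.
Proof.
by rewrite /L1dist integral0_eq// => x _; rewrite subrr normr0.
Qed.

Lemma L1dist_sym f g : L1dist f g = L1dist g f.
Proof. by apply: eq_integral => x _; rewrite distrC. Qed.

Lemma L1dist_le2 f1 g1 f2 g2 f3 g3 :
  measurable_fun [set: X] f1 -> measurable_fun [set: X] g1 ->
  measurable_fun [set: X] f2 -> measurable_fun [set: X] g2 ->
  measurable_fun [set: X] f3 -> measurable_fun [set: X] g3 ->
  (forall x, `|f1 x - g1 x| <= `|f2 x - g2 x| + `|f3 x - g3 x|)%R ->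
  L1dist f1 g1 <= L1dist f2 g2 + L1dist f3 g3.
Proof.
move=> mf1 mg1 mf2 mg2 mf3 mg3 le.
rewrite /L1dist; have -> : \int[m]_x `|f2 x - g2 x|%:E + \int[m]_x `|f3 x - g3 x|%:E
    = \int[m]_x (`|f2 x - g2 x|%:E + `|f3 x - g3 x|%:E).
  apply/esym; apply: ge0_integralD => //.
    exact: measurable_dist.
  exact: measurable_dist.
apply: ge0_le_integral => //.
- exact: measurable_dist.
- by apply: emeasurable_funD; exact: measurable_dist.
- by move=> x _; rewrite -EFinD lee_fin.
Qed.

Lemma L1dist_triangle g f h :
  measurable_fun [set: X] f -> measurable_fun [set: X] g ->
  measurable_fun [set: X] h -> L1dist f h <= L1dist f g + L1dist g h.
Proof.
by move=> mf mg mh; apply: L1dist_le2 => // x; exact: ler_distD.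
Qed.

End L1_distance.

Section cylinder_approximation.
Local Open Scope ereal_scope.
Context d (X : measurableType d) (R : realType) (m : probability X R).
Variable U : nat -> set X.
Hypothesis mU : forall i, measurable (U i).
Hypothesis gU : (d.-measurable : set (set X)) `<=` <<s range U>>.

(** All bit vectors index the partition generated by the first [n] sets, so some atoms may be empty.
    A function of [code n] is a step function of that partition. *)
Definition code n (x : X) : {ffun 'I_n -> bool} := [ffun i : 'I_n => `[< U i x >]].

Definition atom n (s : {ffun 'I_n -> bool}) : set X := [set x | code n x = s].

Lemma measurable_atom n s : measurable (@atom n s).
Proof.
have -> : atom s = \bigcap_(i : 'I_n) (if s i then U i else ~` U i).
  apply/seteqP; split => x.
    move=> <- i _; rewrite ffunE; case: ifPn; first by move/asboolP.
    by move=> /asboolP.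
  move=> xs; apply/ffunP => i; rewrite ffunE; have := xs i I.
  by case: ifPn => _ ux; [apply/asboolP|apply/asboolPn].
apply: fin_bigcap_measurable => // i _.
by case: ifP => // _; exact: measurableC.
Qed.

Lemma measurable_code n (g : {ffun 'I_n -> bool} -> R) :
  measurable_fun [set: X] (fun x => g (code n x)).
Proof.
rewrite (_ : (fun x => _) =
  (fun x => \sum_(s : {ffun 'I_n -> bool}) g s * \1_(atom s) x)%R).
  apply: measurable_sum => s; apply: measurable_funM => //.
  exact/measurable_indic/measurable_atom.
apply/funext => x; rewrite (bigD1 (code n x))//= indicE mem_set// mulr1.
rewrite big1 ?addr0// => s sx; rewrite indicE memNset ?mulr0//.
by move=> /= e; move: sx; rewrite e eqxx.
Qed.

Lemma code_restr n p (np : (n <= p)%N) (g : {ffun 'I_n -> bool} -> R) :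
  exists g' : {ffun 'I_p -> bool} -> R, forall x, g (code n x) = g' (code p x).
Proof.
exists (fun s => g [ffun i : 'I_n => s (widen_ord np i)]) => x.
by congr g; apply/ffunP => i; rewrite !ffunE.
Qed.

Definition approximable (f : X -> R) := forall e : R, (0 < e)%R ->
  exists n (g : {ffun 'I_n -> bool} -> R), L1dist m f (fun x => g (code n x)) < e%:E.

Lemma approximable_step n (g : {ffun 'I_n -> bool} -> R) :
  approximable (fun x => g (code n x)).
Proof. by move=> e e0; exists n, g; rewrite L1dist_refl lte_fin. Qed.

Lemma approximable_close f : measurable_fun [set: X] f ->
  (forall e : R, (0 < e)%R -> exists f', [/\ measurable_fun [set: X] f',
     approximable f' & L1dist m f f' < e%:E]) -> approximable f.
Proof.
move=> mf H e e0; have e20 : (0 < e / 2)%R by rewrite divr_gt0.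
have [f' [mf' af' ff']] := H _ e20.
have [n [g gf']] := af' _ e20; exists n, g.
apply: le_lt_trans (L1dist_triangle m mf mf' (measurable_code g)) _.
by rewrite [e]splitr EFinD lteD.
Qed.

(** A single Lipschitz estimate serves maxima (unions), differences (complements) and sums. The two
    step functions are first rewritten on a common partition. *)
Lemma approximable_op2 (op : R -> R -> R) f g :
  (forall a b a' b', `|op a b - op a' b'| <= `|a - a'| + `|b - b'|)%R ->
  measurable_fun [set: X] f -> measurable_fun [set: X] g ->
  measurable_fun [set: X] (fun x => op (f x) (g x)) ->
  approximable f -> approximable g -> approximable (fun x => op (f x) (g x)).
Proof.
move=> lip mf mg mo af ag e e0; have e20 : (0 < e / 2)%R by rewrite divr_gt0.
have [n1 [g1 h1]] := af _ e20; have [n2 [g2 h2]] := ag _ e20.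
have [g1' e1] := code_restr (leq_maxl n1 n2) g1.
have [g2' e2] := code_restr (leq_maxr n1 n2) g2.
exists (maxn n1 n2), (fun s => op (g1' s) (g2' s)).
rewrite [e]splitr EFinD; apply: le_lt_trans (lteD h1 h2).
apply: L1dist_le2 => //; try exact: measurable_code.
  exact: (measurable_code (fun s => op (g1' s) (g2' s))).
by move=> x; rewrite e1 e2.
Qed.

Lemma approximable_scale c f : measurable_fun [set: X] f ->
  approximable f -> approximable (fun x => c * f x)%R.
Proof.
move=> mf af e e0; have c0 : (0 < `|c| + 1)%R by rewrite ltr_wpDl.
have [n [g h]] := af _ (divr_gt0 e0 c0).
exists n, (fun s => c * g s)%R.
rewrite /L1dist; under eq_integral do rewrite -mulrBr normrM EFinM.
rewrite ge0_integralZl//; last exact: (measurable_dist mf (measurable_code g)).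
apply: (@le_lt_trans _ _ ((`|c| + 1)%:E * L1dist m f (fun x => g (code n x)))).
  by apply: lee_wpmul2r; [exact: L1dist_ge0|rewrite lee_fin lerDl].
rewrite muleC -lte_pdivlMr//.
Qed.

Lemma approximable_setU A B : measurable A -> measurable B ->
  approximable \1_A -> approximable \1_B -> approximable \1_(A `|` B).
Proof.
move=> mA mB aA aB.
have -> : \1_(A `|` B) = (fun x => Num.max (\1_A x) (\1_B x : R)).
  apply/funext => x; rewrite !indicE in_setU.
  by case: (x \in A); case: (x \in B); 
    rewrite /Order.max /= ?ltxx ?ltr01 ?ltr10.
apply: (approximable_op2 (op := fun a b : R => Num.max a b)
  (f := \1_A) (g := \1_B)) => //.
- have half (a b a' b' : R) :
      (Num.max a b - Num.max a' b' <= `|a - a'| + `|b - b'|)%R.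
    rewrite lerBlDr ge_max; apply/andP; split.
    + rewrite -[leLHS](subrK a') lerD// ?le_max ?lexx//.
      by rewrite (le_trans (ler_norm _))// lerDl.
    + rewrite -[leLHS](subrK b') lerD// ?le_max ?lexx ?orbT//.
      by rewrite (le_trans (ler_norm _))// lerDr.
  move=> a b a' b'; rewrite ler_norml half andbT lerNl opprB.
  by rewrite [`|a - _|%R]distrC [`|b - _|%R]distrC.
- by apply: measurable_maxr; exact: measurable_indic.
Qed.

(** The sets with approximable indicator form a sigma-algebra containing each [U i]. For a countable
    union, what the finite unions miss decreases to the empty set. *)
Lemma approximable_indic A : measurable A -> approximable \1_A.
Proof.
pose D := [set A | measurable A /\ approximable \1_A].
suff sD : sigma_algebra [set: X] D.
  move=> /gU mA; suff [] : D A by [].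
  move: A mA; apply: (smallest_sub sD) => _ [i _ <-]; split => //.
  have -> : \1_(U i) = (fun x => (code i.+1 x ord_max)%:R : R).
    by apply/funext => x; rewrite ffunE indicE.
  exact: (approximable_step (fun s : {ffun 'I_i.+1 -> bool} => (s ord_max)%:R)).
split => /=.
- split => //; have -> : \1_set0 = (fun x => (fun _ => 0%R) (code 0 x)) :> (X -> R).
    by apply/funext => x; rewrite indicE in_set0.
  exact: (approximable_step (fun s : {ffun 'I_0 -> bool} => 0%R)).
- move=> B [mB aB]; rewrite setTD; split; first exact: measurableC.
  have -> : \1_(~` B) = (fun x => (fun a b => b - a)%R (\1_B x) (1%R : R)).
    by apply/funext => x; rewrite !indicE in_setC; case: (x \in B); rewrite ?subrr ?subr0.
  apply: (approximable_op2 (op := (fun a b : R => b - a)%R)) => //.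
  + move=> a b a' b'; rewrite [leRHS]addrC.
    have -> : (b - a - (b' - a') = (b - b') - (a - a'))%R by ring.
    exact: ler_normB.
  + by apply: measurable_funB => //; exact: measurable_indic.
  + exact: (approximable_step (fun s : {ffun 'I_0 -> bool} => 1%R)).
- move=> F FD; have mF i : measurable (F i) by have [] := FD i.
  have mUF : measurable (\bigcup_n F n) by exact: bigcup_measurable.
  split => //; apply: approximable_close => [|e e0]; first exact: measurable_indic.
  pose G n := \big[setU/set0]_(i < n.+1) F i.
  have mG n : measurable (G n) by exact: bigsetU_measurable.
  have aG n : approximable \1_(G n).
    rewrite /G; elim: n => [|n IH].
      by rewrite big_ord1; have [] := FD 0%N.
    rewrite big_ord_recr/=; apply: approximable_setU => //; first exact: mG.
    by have [] := FD n.+1.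
  have UG : \bigcup_n G n = \bigcup_n F n by rewrite /G bigcup_bigsetU_bigcup.
  have cG : (m \o (fun n => \bigcup_n F n `\` G n)) @ \oo --> 0.
    rewrite -(measure0 m).
    have -> : set0 = \bigcap_n (\bigcup_n F n `\` G n).
      apply/esym/seteqP; split => // x xG.
      have [+ _] := xG 0%N I; rewrite -UG => -[n _ Gnx].
      by have [_ /(_ Gnx)] := xG n I.
    apply: nonincreasing_cvg_mu.
    - by rewrite (le_lt_trans (probability_le1 _ _)) ?ltry//; exact: measurableD.
    - by move=> n; exact: measurableD.
    - by apply: bigcap_measurable => // n _; exact: measurableD.
    - move=> a b ab; apply/subsetPset; apply: setDS.
      exact: subset_bigsetU.
  have [N /(_ N (leqnn N)) GN] := cvge0_lt cG e0.
  exists \1_(G N); split => //.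
  apply: le_lt_trans GN; rewrite /L1dist /=.
  rewrite (eq_integral (fun x => (\1_(\bigcup_n F n `\` G N) x)%:E)).
    by rewrite integral_indic ?setIT//; exact: measurableD.
  move=> x _; congr EFin; rewrite !indicE in_setD.
  have [xG|xG] := boolP (x \in G N); last by rewrite subr0 andbT normr_nat.
  rewrite mem_set/= ?subrr ?normr0//.
  by rewrite -UG; exists N => //; exact: set_mem.
Qed.

Import HBSimple.

(** Simple functions are dense in [L^1], and each is a finite combination of indicators. *)
Lemma approximable_integrable (f : X -> R) :
  m.-integrable [set: X] (EFin \o f) -> approximable f.
Proof.
move=> intf; have mf : measurable_fun [set: X] f.
  by apply/measurable_EFinP; exact: measurable_int intf.
apply: approximable_close => // e e0.
have [g [_ _ gf]] := approximation_sfun_integrable measurableT intf.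
have [N /(_ N (leqnn N)) GN] := cvge0_lt gf e0.
exists (g N); split => //.
have [rs ->] : exists rs : seq R,
    (g N : X -> R) = (fun x => \sum_(r <- rs) r * \1_(g N @^-1` [set r]) x)%R.
  exists (finmap.enum_fset (fset_set (range (g N)))); apply/funext => x /=.
  by rewrite fimfunE fsbig_finite.
elim: rs => [|r rs IH].
  under eq_fun do rewrite big_nil.
  exact: (approximable_step (fun s : {ffun 'I_0 -> bool} => 0%R)).
under eq_fun do rewrite big_cons.
have mr r' : measurable_fun [set: X] (\1_(g N @^-1` [set r']) : X -> R).
  exact/measurable_indic/measurable_sfunP.
apply: (approximable_op2 (op := fun a b : R => (a + b)%R)) => //.
- by move=> a b a' b'; rewrite opprD addrACA ler_normD.
- by apply: measurable_funM => //; exact: mr.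
- by apply: measurable_sum => r'; apply: measurable_funM => //; exact: mr.
- apply: measurable_funD; first by apply: measurable_funM => //; exact: mr.
  by apply: measurable_sum => r'; apply: measurable_funM => //; exact: mr.
- apply: approximable_scale; first exact: mr.
  exact/approximable_indic/measurable_sfunP.
Qed.

End cylinder_approximation.

Lemma bounded_integrable d (X : measurableType d) (R : realType)
    (m : {finite_measure set X -> \bar R}) (f : X -> R) (M : R) :
  measurable_fun [set: X] f -> (forall x, `|f x| <= M) ->
  m.-integrable [set: X] (EFin \o f).
Proof.
move=> mf fM; apply: (le_integrable measurableT (g := cst M%:E)).
- exact/measurable_EFinP.
- by move=> x _; rewrite lee_fin (le_trans (fM x))// ler_norm.
- exact: finite_measure_integrable_cst.
Qed.

(** * Conditional expectations on finite partitions *)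

Section conditional_expectation.
Local Open Scope ereal_scope.
Context d (X : measurableType d) (R : realType) (m : probability X R).
Variable U : nat -> set X.
Hypothesis mU : forall i, measurable (U i).

Local Notation code := (code U).
Local Notation atom := (atom U).

Lemma integral_atoms n (F : X -> \bar R) : (forall x, 0 <= F x) ->
  measurable_fun [set: X] F ->
  \int[m]_x F x = \sum_(s : {ffun 'I_n -> bool}) \int[m]_(x in atom s) F x.
Proof.
move=> F0 mF.
have UT : \big[setU/set0]_(s : {ffun 'I_n -> bool}) atom s = [set: X].
  by apply/seteqP; split => // x _; rewrite -bigcup_seq; exists (code n x) => //=; rewrite mem_index_enum.
rewrite -[in LHS]UT ge0_integral_bigsetU//.
- by move=> s; exact: measurable_atom.
- exact: index_enum_uniq.
- apply/trivIsetP => s t _ _ st; rewrite -subset0 => x [/= es et].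
  by move: st; rewrite -es -et eqxx.
- by rewrite UT.
Qed.

(** [nu] is left general: the set function [f dm] gives conditional expectations of [f], and
    [kappa x] gives the averages of its density. *)
Definition weight (nu : set X -> \bar R) n (s : {ffun 'I_n -> bool}) : R :=
  (fine (nu (atom s)) / fine (m (atom s)))%R.

(* The value on an atom of measure 0 is 0, by the convention x / 0 = 0. *)
Definition cexp n (f : X -> R) (x : X) : R :=
  weight (fun A => \int[m]_(y in A) (f y)%:E) (code n x).

Lemma L1dist_code n (g h : {ffun 'I_n -> bool} -> R) :
  L1dist m (fun x => g (code n x)) (fun x => h (code n x)) =
  (\sum_s `|g s - h s| * fine (m (atom s)))%:E.
Proof.
rewrite /L1dist (integral_atoms n)//; last first.
  exact: (measurable_dist (measurable_code mU g) (measurable_code mU h)).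
rewrite -sumEFin; apply: eq_bigr => s _.
transitivity (\int[m]_(x in atom s) (`|g s - h s|)%:E).
  by apply: eq_integral => x /set_mem e; rewrite (e : code n x = s).
have mA : measurable (atom s) by exact: measurable_atom.
by rewrite integral_cst// EFinM fineK// fin_num_measure.
Qed.

(** Averaging over an atom fixes the constant [g s] and contracts the [L^1] norm; an atom of measure
    0 contributes 0 to the left side. *)
Lemma cexp_dist n (f : X -> R) (g : {ffun 'I_n -> bool} -> R) :
  m.-integrable [set: X] (EFin \o f) ->
  L1dist m (cexp n f) (fun x => g (code n x)) <= L1dist m f (fun x => g (code n x)).
Proof.
move=> intf; have mf : measurable_fun [set: X] f.
  by apply/measurable_EFinP; exact: measurable_int intf.
rewrite [leLHS]L1dist_code /L1dist (integral_atoms n)//; last first.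
  exact: (measurable_dist mf (measurable_code mU g)).
rewrite -sumEFin; apply: lee_sum => s _.
have mA : measurable (atom s) by exact: measurable_atom.
have intfA : m.-integrable (atom s) (EFin \o f).
  exact: integrableS intf.
have intc : m.-integrable (atom s) (EFin \o (cst (g s))).
  exact: finite_measure_integrable_cst.
have intB : m.-integrable (atom s) (EFin \o (fun x => f x - g s)%R).
  exact: (integrableB mA intfA intc).
have -> : \int[m]_(x in atom s) `|f x - g (code n x)|%:E =
          (\int[m]_(x in atom s) `|f x - g s|)%:E.
  rewrite fineK; last by apply: integrable_fin_num => //; exact: integrable_norm intB.
  by apply: eq_integral => x /set_mem e; rewrite (e : code n x = s).
rewrite lee_fin; apply: (le_trans _ (le_normr_Rintegral mA intB)).
rewrite RintegralB// Rintegral_cst//.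
rewrite -[X in (_ * X)%R]ger0_norm ?fine_ge0//.
rewrite -normrM /weight -/(Rintegral m (atom s) f).
have [M0|M0] := eqVneq (fine (m (atom s))) 0%R.
  by rewrite M0 !mulr0 normr0.
by rewrite mulrBl divfK.
Qed.

Hypothesis gU : (d.-measurable : set (set X)) `<=` <<s range U>>.

(** A step function within [e / 2] of [f] is also one for every finer partition, and there
    [cexp_dist] puts [cexp n f] within [e / 2] of it as well. *)
Lemma cexp_cvg (f : X -> R) (e : R) :
  m.-integrable [set: X] (EFin \o f) -> (0 < e)%R ->
  exists N, forall n, (N <= n)%N -> L1dist m (cexp n f) f < e%:E.
Proof.
move=> intf e0; have e20 : (0 < e / 2)%R by rewrite divr_gt0.
have mf : measurable_fun [set: X] f.
  by apply/measurable_EFinP; exact: measurable_int intf.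
have [N [g fg]] := approximable_integrable mU gU intf e20.
exists N => n Nn; have [g' gg'] := code_restr U Nn g.
have {}fg : L1dist m f (fun x => g' (code n x)) < (e / 2)%:E.
  by apply: le_lt_trans fg; rewrite /L1dist; under [leRHS]eq_integral do rewrite gg'.
have mg' : measurable_fun [set: X] (fun x => g' (code n x)) by exact: measurable_code.
have mc : measurable_fun [set: X] (cexp n f) by exact: measurable_code.
apply: le_lt_trans (L1dist_triangle m mc mg' mf) _.
rewrite [e]splitr EFinD; apply: lteD => //.
  exact: le_lt_trans (cexp_dist g' intf) fg.
by rewrite L1dist_sym.
Qed.

End conditional_expectation.

(** * Partition averages of a kernel density, uniformly over bounded densities *)

Section kernel_smoothing.
Local Open Scope ereal_scope.
Context d (X : measurableType d) (R : realType) (m : probability X R).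
Variable U : nat -> set X.
Hypothesis mU : forall i, measurable (U i).
Hypothesis gU : (d.-measurable : set (set X)) `<=` <<s range U>>.

Local Notation code := (code U).
Local Notation atom := (atom U).
Local Notation cexp := (cexp m U).

Variables (kappa : X -> set X -> \bar R) (p : X -> X -> R).
Hypothesis p0 : forall x y, (0 <= p x y)%R.
Hypothesis mp : forall x, measurable_fun [set: X] (p x).
Hypothesis kappaE : forall x A, measurable A ->
  kappa x A = \int[m]_(y in A) (p x y)%:E.
Hypothesis kappaT : forall x, kappa x [set: X] = 1.
Hypothesis mkappa : forall A, measurable A -> measurable_fun [set: X] (kappa ^~ A).

Lemma kernel_density_integrable x : m.-integrable [set: X] (EFin \o p x).
Proof.
apply/integrableP; split; first exact/measurable_EFinP.
under eq_integral do rewrite gee0_abs ?lee_fin ?p0//.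
by rewrite -kappaE// kappaT ltry.
Qed.

Lemma kernel_fin_num x A : measurable A -> kappa x A \is a fin_num.
Proof.
move=> mA; rewrite kappaE//; apply: integrable_fin_num => //.
apply: integrableS (kernel_density_integrable x) => //.
Qed.

Lemma kernel_ge0 x A : measurable A -> 0 <= kappa x A.
Proof. by move=> mA; rewrite kappaE//; apply: integral_ge0 => y _; rewrite lee_fin. Qed.

Lemma kernel_le1 x A : measurable A -> kappa x A <= 1.
Proof.
move=> mA; rewrite -(kappaT x) !kappaE//; apply: ge0_subset_integral => //.
  exact/measurable_EFinP.
by move=> y _; rewrite lee_fin.
Qed.

(* [p] is not assumed jointly measurable; its partition averages are, since
   they only involve [kappa x] on the finitely many atoms. *)
Definition smooth n (z : X * X) : R := weight m U (kappa z.1) (code n z.2).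

Lemma smoothE n x y : smooth n (x, y) = cexp n (p x) y.
Proof. by rewrite /smooth /cexp /weight/= kappaE//; exact: measurable_atom. Qed.

(** As [kappa x] has mass at most 1, the value on an atom is at most the inverse of its measure;
    summing over the finitely many atoms gives a bound independent of the point. *)
Lemma smooth_bounded n : exists M : R, forall z, (`|smooth n z| <= M)%R.
Proof.
exists (\sum_(s : {ffun 'I_n -> bool}) (fine (m (atom s)))^-1)%R => -[x y].
rewrite /smooth /weight/=; set s := code n y.
have mA : measurable (atom s) by exact: measurable_atom.
rewrite ger0_norm; last first.
  by rewrite divr_ge0// fine_ge0// kernel_ge0.
apply: (@le_trans _ _ (fine (m (atom s)))^-1%R).
  rewrite ler_piMl// ?invr_ge0 ?fine_ge0// -lee_fin fineK ?kernel_le1//.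
  exact: kernel_fin_num.
rewrite (bigD1 s)//= lerDl sumr_ge0// => t _.
by rewrite invr_ge0 fine_ge0.
Qed.

Lemma measurable_smooth n : measurable_fun [set: X * X] (smooth n).
Proof.
rewrite (_ : smooth n = fun z => \sum_(s : {ffun 'I_n -> bool})
    (weight m U (kappa z.1) s * \1_(atom s) z.2)%R)%R; last first.
  apply/funext => z; rewrite (bigD1 (code n z.2))//= indicE mem_set// mulr1.
  rewrite big1 ?addr0// => s sx; rewrite indicE memNset ?mulr0//.
  by move=> /= e; move: sx; rewrite e eqxx.
apply: measurable_sum => s; apply: measurable_funM.
  apply: measurable_funM => //.
  apply: (measurableT_comp (f := fun x => fine (kappa x (atom s)))) => //.
  apply: measurableT_comp => //; apply: mkappa; exact: measurable_atom.
apply: (measurableT_comp (f := \1_(atom s) : X -> R)) => //.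
exact/measurable_indic/measurable_atom.
Qed.

(** Two averages are compared, rather than an average and [p x], so that joint measurability of
    [smooth] makes the distance measurable in [x]. *)
Definition smooth_dist n l x := L1dist m (cexp n (p x)) (cexp l (p x)).

Lemma smooth_distE n l x :
  smooth_dist n l x = \int[m]_y `|smooth n (x, y) - smooth l (x, y)|%:E.
Proof. by apply: eq_integral => y _; rewrite !smoothE. Qed.

Let mabs n l : measurable_fun [set: X * X]
  (fun z => `|smooth n z - smooth l z|%:E).
Proof. exact: (measurable_dist (measurable_smooth n) (measurable_smooth l)). Qed.

Lemma measurable_smooth_dist n l : measurable_fun [set: X] (smooth_dist n l).
Proof.
rewrite (_ : smooth_dist n l = fun x => \int[m]_y `|smooth n (x, y) - smooth l (x, y)|%:E).
  exact: (measurable_fun_fubini_tonelli_F (m2 := m) _ (mabs n l)).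
by apply/funext => x; rewrite smooth_distE.
Qed.

Lemma measurable_cexp n f : measurable_fun [set: X] (cexp n f).
Proof. exact: measurable_code. Qed.

Lemma smooth_dist_le2 n l x : smooth_dist n l x <= 2%:E.
Proof.
have one k : L1dist m (cexp k (p x)) (fun => 0%R) <= 1.
  apply: (le_trans (cexp_dist mU (fun s : {ffun 'I_k -> bool} => 0%R)
    (kernel_density_integrable x))).
  rewrite /L1dist -(kappaT x) kappaE//.
  by under eq_integral do rewrite subr0 ger0_norm//.
apply: (le_trans (L1dist_triangle m (measurable_cexp n (p x))
  (measurable_cst (0%R : R)) (measurable_cexp l (p x)))).
rewrite (_ : 2%:E = 1 + 1); last by rewrite -EFinD.
by apply: leeD; [exact: one|rewrite L1dist_sym; exact: one].
Qed.

(* Dominated convergence for [sup_(l >= n) smooth_dist n l x]. *)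
Lemma smooth_dist_cauchy (e : R) : (0 < e)%R ->
  exists n, forall l, (n <= l)%N -> \int[m]_x smooth_dist n l x < e%:E.
Proof.
move=> e0; pose f n x := esups (fun l => smooth_dist n l x) n.
have mf n : measurable_fun [set: X] (f n).
  exact: (measurable_fun_esups (f := smooth_dist n) (fun l => measurable_smooth_dist n l) n).
have f0 n x : 0 <= f n x.
  apply: (@le_trans _ _ (smooth_dist n n x)); first exact: L1dist_ge0.
  by apply: ereal_sup_ubound; exists n => //=.
have f2 n x : f n x <= 2%:E.
  by apply: ge_ereal_sup => _ [l _ <-]; exact: smooth_dist_le2.
have cf x : f ^~ x @ \oo --> 0.
  apply/fine_cvgP; split.
    apply: nearW => n; rewrite ge0_fin_numE//.
    exact: le_lt_trans (f2 n x) (ltry _).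
  apply/cvgrPdist_le => r r0; have r20 : (0 < r / 2)%R by rewrite divr_gt0.
  have [N HN] := cexp_cvg mU gU (kernel_density_integrable x) r20.
  exists N => // n /= Nn; rewrite sub0r normrN ger0_norm ?fine_ge0//.
  rewrite -lee_fin fineK; last first.
    by rewrite ge0_fin_numE// (le_lt_trans (f2 n x))// ltry.
  apply: ge_ereal_sup => _ [l /= nl <-].
  apply: (le_trans (L1dist_triangle m (measurable_cexp n (p x))
     (mp x) (measurable_cexp l (p x)))).
  rewrite [r]splitr EFinD; apply: leeD; first exact/ltW/HN.
  by rewrite L1dist_sym; apply/ltW/HN; rewrite (leq_trans Nn).
have [|||||_ + _] := @dominated_convergence _ X R m setT measurableT f (cst 0) (cst 2%:E).
- exact: mf.
- exact: measurable_cst.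
- by apply: aeW => x _; exact: cf.
- exact: finite_measure_integrable_cst.
- by apply: aeW => x n _; rewrite gee0_abs.
move=> /= /cvge0_lt /(_ e0) [N HN]; exists N => l Nl.
have := HN N (leqnn N); apply: le_lt_trans.
rewrite [leRHS](eq_integral (f N)); last by move=> x _; rewrite sube0 gee0_abs.
apply: ge0_le_integral => //.
- by move=> x _; exact: L1dist_ge0.
- exact: measurable_smooth_dist.
- by move=> x _; apply: ereal_sup_ubound; exists l.
Qed.

Let integrable_smooth (a : X -> R) (c : R) n y : (forall x, 0 <= a x <= c)%R ->
  measurable_fun [set: X] a ->
  m.-integrable [set: X] (EFin \o (fun x => a x * smooth n (x, y)))%R.
Proof.
move=> ac ma; have [M HM] := smooth_bounded n.
apply: (@bounded_integrable _ _ _ m _ (c * M)%R).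
  apply: measurable_funM => //; exact: measurableT_comp (measurable_smooth n) _.
move=> x; rewrite normrM ler_pM//.
by have /andP[a0 ac'] := ac x; rewrite ger0_norm.
Qed.

(** On an atom [s] both sides equal the integral of [a(x) kappa(x, s)] divided by [m(s)]. *)
Lemma cexp_smooth (a b : X -> R) (c : R) n y : (forall x, 0 <= a x <= c)%R ->
  measurable_fun [set: X] a ->
  (forall A, measurable A ->
    \int[m]_(x in A) (b x)%:E = \int[m]_x ((a x)%:E * kappa x A)) ->
  cexp n b y = (\int[m]_x (a x * smooth n (x, y)))%R.
Proof.
move=> ac ma abE; rewrite /cexp /weight; set s := code n y.
have mA : measurable (atom s) by exact: measurable_atom.
rewrite abE// -[RHS]/(fine _).
under [in RHS]eq_integral do rewrite /smooth /weight/= -/s mulrA EFinM.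
have -> : \int[m]_x ((a x)%:E * kappa x (atom s)) =
          \int[m]_x (a x * fine (kappa x (atom s)))%:E.
  by apply: eq_integral => x _; rewrite EFinM fineK// kernel_fin_num.
have ik : m.-integrable [set: X] (EFin \o (fun x => a x * fine (kappa x (atom s))))%R.
  apply: (@bounded_integrable _ _ _ m _ c) => [|x].
    by apply: measurable_funM => //; apply: measurableT_comp => //; exact: mkappa.
  have /andP[a0 ac'] := ac x.
  rewrite ger0_norm ?mulr_ge0 ?fine_ge0 ?kernel_ge0//.
  apply: (le_trans _ ac'); rewrite ler_piMr// -lee_fin fineK ?kernel_fin_num//.
  exact: kernel_le1.
have := RintegralZr (fine (m (atom s)))^-1%R measurableT ik.
by rewrite /Rintegral => <-.
Qed.

(** The partition must not depend on [b]. A finer level [l], which may depend on [b], approximates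
    [b]; passing from [n] to [l] costs at most [c] times the mean of [smooth_dist n l], which is
    small for all [l >= n]. *)
Lemma cexp_uniform (c e : R) : (0 <= c)%R -> (0 < e)%R ->
  exists n, forall a b : X -> R, (forall x, 0 <= a x <= c)%R ->
    measurable_fun [set: X] a -> m.-integrable [set: X] (EFin \o b) ->
    (forall A, measurable A ->
      \int[m]_(x in A) (b x)%:E = \int[m]_x ((a x)%:E * kappa x A)) ->
    L1dist m (cexp n b) b <= e%:E.
Proof.
move=> c0 e0; have e20 : (0 < e / 2)%R by rewrite divr_gt0.
(* [c + 1] rather than [c] allows division when [c = 0]. *)
have c1 : (0 < c + 1)%R by rewrite ltr_wpDl.
have [n Hn] := smooth_dist_cauchy (divr_gt0 e20 c1).
exists n => a b ac ma ib abE.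
have mb : measurable_fun [set: X] b.
  by apply/measurable_EFinP; exact: measurable_int ib.
have [N HN] := cexp_cvg mU gU ib e20.
pose l := maxn n N.
apply: (le_trans (L1dist_triangle m (measurable_cexp n b) (measurable_cexp l b) mb)).
rewrite [e]splitr EFinD; apply: leeD; last by apply/ltW/HN; exact: leq_maxr.
apply: (@le_trans _ _ (\int[m]_y (c%:E * \int[m]_x `|smooth n (x, y) - smooth l (x, y)|%:E))).
  apply: ge0_le_integral => //.
  - exact: (measurable_dist (measurable_cexp n b) (measurable_cexp l b)).
  - apply: measurable_funeM.
    exact: (measurable_fun_fubini_tonelli_G (m1 := m) _ (mabs n l)).
  - move=> y _; rewrite (cexp_smooth n y ac ma abE) (cexp_smooth l y ac ma abE).
    rewrite -RintegralB//; [|exact: integrable_smooth ac ma..].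
    have iB : m.-integrable [set: X]
        (EFin \o (fun x => a x * smooth n (x, y) - a x * smooth l (x, y))%R).
      exact: (integrableB measurableT (integrable_smooth n y ac ma)
               (integrable_smooth l y ac ma)).
    apply: (@le_trans _ _ (\int[m]_x (`|a x * smooth n (x, y) - a x * smooth l (x, y)|)%:E)).
      rewrite EFin_normr_Rintegral//.
      by apply: le_abse_integral => //; exact: measurable_int iB.
    have msec k : measurable_fun [set: X] (fun x => smooth k (x, y)).
      exact: measurableT_comp (measurable_smooth k) _.
    have mdx : measurable_fun [set: X] (fun x => `|smooth n (x, y) - smooth l (x, y)|%:E).
      exact: measurable_dist.
    rewrite -ge0_integralZl//.
    apply: ge0_le_integral => //.
    + by apply: measurable_dist; apply: measurable_funM.
    + exact: measurable_funeM.
    + move=> x _; rewrite -mulrBr normrM lee_fin ler_wpM2r//.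
      by have /andP[a0 ac'] := ac x; rewrite ger0_norm.
rewrite ge0_integralZl//; last 2 first.
- exact: (measurable_fun_fubini_tonelli_G (m1 := m) _ (mabs n l)).
- by move=> y _; apply: integral_ge0.
have -> : \int[m]_y \int[m]_x `|smooth n (x, y) - smooth l (x, y)|%:E =
    \int[m]_x smooth_dist n l x.
  transitivity (\int[m]_x \int[m]_y `|smooth n (x, y) - smooth l (x, y)|%:E).
    by apply/esym; exact: (fubini_tonelli (m1 := m) (m2 := m) _ (mabs n l)).
  by apply: eq_integral => x _; rewrite smooth_distE.
apply: (@le_trans _ _ ((c + 1)%:E * \int[m]_x smooth_dist n l x)).
  by apply: lee_wpmul2r; [apply: integral_ge0 => x _; exact: L1dist_ge0|rewrite lee_fin lerDl].
by rewrite muleC -lee_pdivlMr//; apply/ltW/Hn; exact: leq_maxl.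
Qed.

End kernel_smoothing.

Lemma measurable_superlevel d (X : measurableType d) (R : realType) (f : X -> R)
  (c : R) : measurable_fun [set: X] f -> measurable [set x | c < f x].
Proof.
move=> mf; rewrite (_ : mkset _ = [set: X] `&` f @^-1` `]c, +oo[%classic).
  exact: mf.
by apply/seteqP; split=> x /=; rewrite in_itv/= andbT// => -[].
Qed.

(** Tested on the set where [h] is negative, over which the integral can only vanish. *)
Lemma L1_nneg_integral d (X : measurableType d) (R : realType)
    (m : {measure set X -> \bar R}) (h : L1 m) :
  (forall A, measurable A -> (0 <= \int[m]_(x in A) (h x)%:E)%E) -> L1_nneg h.
Proof.
move=> H; pose N := [set x | h x < 0].
have mN : measurable N.
  rewrite (_ : N = [set x | 0 < - h x]); last first.
    by apply/seteqP; split => x /=; rewrite /N/= oppr_gt0.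
  by apply: measurable_superlevel; apply: measurableT_comp => //; exact: L1_measurable.
have h00 : (\int[m]_(x in N) `|h x|%:E = 0)%E.
  have iN := H N mN.
  apply/eqP; rewrite eq_le; apply/andP; split; last by apply: integral_ge0.
  rewrite (_ : \int[m]_(x in N) _ = - \int[m]_(x in N) (h x)%:E)%E; last first.
    rewrite -integralN/=.
      by apply: eq_integral => x /set_mem hx; rewrite ltr0_norm.
    by apply: integrable_add_def => //; apply: integrableS (L1_integrable h).
  by rewrite leeNl oppe0.
have mNn : measurable_fun N (EFin \o h) by exact/measurable_funTS/measurable_EFinP/L1_measurable.
have := (ae_eq_integral_abs m mN mNn).1 h00.
apply: filterS => x hx; rewrite leNgt; apply/negP => hx0.
by have [hx00] := hx hx0; move: hx0; rewrite hx00 ltxx.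
Qed.

(** * Total boundedness and compactness *)

Section Doeblin_compactness.
Context d (X : measurableType d) (R : realType) (m : probability X R).
Variable U : nat -> set X.
Hypothesis mU : forall i, measurable (U i).
Hypothesis gU : (d.-measurable : set (set X)) `<=` <<s range U>>.
Variables (kappa : X -> set X -> \bar R) (p : X -> X -> R).
Hypothesis p0 : forall x y, 0 <= p x y.
Hypothesis mp : forall x, measurable_fun [set: X] (p x).
Hypothesis kappaE : forall x A, measurable A ->
  (kappa x A = \int[m]_(y in A) (p x y)%:E)%E.
Hypothesis kappaT : forall x, kappa x [set: X] = 1%E.
Hypothesis mkappa : forall A, measurable A -> measurable_fun [set: X] (kappa ^~ A).
Variable Q : L1 m -> L1 m.
Hypothesis markovQ : markov_operator Q.
Hypothesis Qkappa : forall h A, L1_nneg h -> measurable A ->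
  (\int[m]_(x in A) (Q h x)%:E = \int[m]_x ((h x)%:E * kappa x A))%E.

Lemma step_integrable n (g : {ffun 'I_n -> bool} -> R) :
  m.-integrable [set: X] (EFin \o (fun x => g (code U n x))).
Proof.
apply: (@bounded_integrable _ _ _ m _ (\sum_s `|g s|)).
  exact: measurable_code.
by move=> x; rewrite (bigD1 (code U n x))//= lerDl sumr_ge0.
Qed.

(** The image is within [e / 2] of its average over a fixed partition. Such an average is determined
    by its masses on the atoms, which lie in [[0, c]] and are rounded to finitely many values. *)
Lemma net_bounded_image (c e : R) : 0 <= c -> 0 < e ->
  exists s : seq (L1 m), forall h, L1_nneg h -> {ae m, forall x, h x <= c} ->
    exists2 g, g \in s & `|Q h - g| <= e.
Proof.
move=> c0 e0; have e20 : 0 < e / 2 by rewrite divr_gt0.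
have [n Hn] := cexp_uniform mU gU p0 mp kappaE kappaT mkappa c0 e20.
pose S : finType := {ffun 'I_n -> bool}.
(* Rounding moves the mass of each of the [#|S|] atoms by at most [delta], hence costs at most
   [e / 2] altogether. *)
pose delta := e / 2 / (#|S|.+1)%:R.
have d0 : 0 < delta by rewrite divr_gt0.
pose N := Num.truncn (c / delta).
(* The step function gives atom [s] the mass [delta * j s], or 0 if the atom is null. *)
pose F (j : {ffun S -> 'I_N.+1}) (s : S) := delta * (j s)%:R / fine (m (atom U s)).
exists [seq mkL1 (step_integrable (F j)) | j <- enum {ffun S -> 'I_N.+1}] => h h0 hc.
(* Truncation turns the almost everywhere bounds on [h] into bounds at every point, as
   [cexp_uniform] requires. *)
pose a x := Num.min (Num.max 0 (h x)) c.
have ma : measurable_fun [set: X] a.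
  by apply: measurable_minr => //; apply: measurable_maxr => //; exact: L1_measurable.
have ac x : 0 <= a x <= c.
  by rewrite /a ge_min lexx orbT andbT le_min le_max lexx.
have ah : {ae m, forall x, h x = a x}.
  by apply: filterS2 h0 hc => x ? ?; rewrite /a max_r// min_l.
have abE A : measurable A ->
    (\int[m]_(x in A) (Q h x)%:E = \int[m]_x ((a x)%:E * kappa x A))%E.
  move=> mA; rewrite Qkappa//; apply: ae_eq_integral => //.
  - by apply: emeasurable_funM; [exact/measurable_EFinP/L1_measurable|exact: mkappa].
  - by apply: emeasurable_funM; [exact/measurable_EFinP|exact: mkappa].
  - by apply: filterS ah => x ->.
have Qc := Hn a (Q h) ac ma (L1_integrable (Q h)) abE.
pose b (s : S) := fine (\int[m]_(x in atom U s) (Q h x)%:E).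
have b0 s : 0 <= b s.
  rewrite /b abE; last exact: measurable_atom.
  rewrite fine_ge0// integral_ge0// => x _; rewrite mule_ge0//.
    by rewrite lee_fin; case/andP: (ac x).
  by apply: (kernel_ge0 p0 kappaE); exact: measurable_atom.
have bc s : b s <= c.
  have mA : measurable (atom U s) by exact: measurable_atom.
  rewrite -lee_fin /b fineK; last first.
    apply: integrable_fin_num => //; apply: integrableS (L1_integrable (Q h)) => //.
  rewrite abE//; apply: (@le_trans _ _ (\int[m]_x (cst c%:E x))%E); last first.
    by rewrite integral_cst//= probability_setT mule1.
  apply: ge0_le_integral => //.
  - move=> x _; rewrite mule_ge0//; first by rewrite lee_fin; case/andP: (ac x).
    exact: (kernel_ge0 p0 kappaE).
  - by apply: emeasurable_funM; [exact/measurable_EFinP|exact: mkappa].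
  - move=> x _; rewrite -[leRHS]mule1; apply: lee_pmul => //.
    + by rewrite lee_fin; case/andP: (ac x).
    + exact: (kernel_ge0 p0 kappaE).
    + by rewrite lee_fin; case/andP: (ac x).
    + exact: (kernel_le1 p0 mp kappaE kappaT).
have jN s : (Num.truncn (b s / delta) < N.+1)%N.
  by rewrite ltnS le_truncn// ler_pM2r ?invr_gt0.
pose j : {ffun S -> 'I_N.+1} := [ffun s => Ordinal (jN s)].
exists (mkL1 (step_integrable (F j))).
  by apply/mapP; exists j => //; rewrite mem_enum.
have mQ := L1_measurable (Q h).
have mFj : measurable_fun [set: X] (fun x => F j (code U n x)) by exact: measurable_code.
have mce : measurable_fun [set: X] (cexp m U n (Q h)) by exact: measurable_code.
rewrite -lee_fin L1_norm_dist.
have -> : (\int[m]_x (`|Q h x - mkL1 (step_integrable (F j)) x|)%:E =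
           L1dist m (Q h) (fun x => F j (code U n x)))%E.
  apply: ae_eq_integral => //.
  - exact: (measurable_dist mQ (L1_measurable _)).
  - exact: measurable_dist.
  - by apply: filterS (mkL1E (step_integrable (F j))) => x ->.
apply: (le_trans (L1dist_triangle m mQ mce mFj)).
rewrite [e]splitr EFinD; apply: leeD; first by rewrite L1dist_sym.
rewrite [leLHS](L1dist_code m mU) lee_fin.
apply: (@le_trans _ _ (\sum_(s : S) delta)); last first.
  rewrite sumr_const -[leLHS]mulr_natr /delta mulrAC ler_pdivrMr//.
  by rewrite ler_pM2l// ler_nat.
apply: ler_sum => s _.
have M0 : 0 <= fine (m (atom U s)) by exact: fine_ge0.
have bd : `|b s - delta * (j s)%:R| <= delta.
  rewrite ffunE /=.
  have /truncn_itv/andP[l1 l2] : 0 <= b s / delta by rewrite divr_ge0// ltW.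
  rewrite ler_pdivlMr// in l1; rewrite ltr_pdivrMr// -natr1 mulrDl mul1r in l2.
  rewrite ger0_norm; last by rewrite subr_ge0 mulrC.
  by rewrite lerBlDr ltW// mulrC addrC.
have [M00|Mn0] := eqVneq (fine (m (atom U s))) 0.
  by rewrite M00 mulr0 ltW.
rewrite -[X in _ * X]ger0_norm// -normrM mulrBl.
by rewrite /weight -/(b s) /F !divfK.
Qed.

Variables c rho : R.
Hypothesis c_gt0 : 0 < c.
Hypothesis rho_gt0 : 0 < rho.
Hypothesis doeblin : {ae m, forall x, forall A, measurable A ->
  (kappa x A <= rho%:E + c%:E * m A)%E}.

(** The pointwise bound is integrated against [h], of mass at most 1. *)
Lemma doeblin_integral h A : L1_nneg h -> `|h| <= 1 -> measurable A ->
  (\int[m]_(x in A) (Q h x)%:E <= rho%:E + c%:E * m A)%E.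
Proof.
move=> h0 h1 mA; rewrite Qkappa//.
have rc0 : (0 <= rho%:E + c%:E * m A)%E.
  by rewrite adde_ge0// ?mule_ge0// lee_fin ltW.
have [f [f0 mf hf]] := L1_nneg_repr h0.
apply: (@le_trans _ _ (\int[m]_x ((f x)%:E * (rho%:E + c%:E * m A)))%E).
  rewrite (ae_eq_integral (fun x => (f x)%:E * kappa x A)%E)//; last 3 first.
  - by apply: emeasurable_funM; [exact/measurable_EFinP/L1_measurable|exact: mkappa].
  - by apply: emeasurable_funM; [exact/measurable_EFinP|exact: mkappa].
  - by apply: filterS hf => x ->.
  apply: ae_ge0_le_integral => //.
  - by move=> x _; rewrite mule_ge0// ?lee_fin// (kernel_ge0 p0 kappaE).
  - by apply: emeasurable_funM; [exact/measurable_EFinP|exact: mkappa].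
  - by move=> x _; rewrite mule_ge0// lee_fin.
  - by apply: emeasurable_funM => //; exact/measurable_EFinP.
  - by apply: filterS doeblin => x dx _; rewrite lee_wpmul2l ?lee_fin//; exact: dx.
have mfE : measurable_fun [set: X] (fun x => (f x)%:E) by exact/measurable_EFinP.
have hfE : (`|h|%:E = \int[m]_x (f x)%:E)%E.
  rewrite L1_nnegE//; apply: ae_eq_integral => //.
  - exact/measurable_EFinP/L1_measurable.
  - by apply: filterS hf => x ->.
rewrite (ge0_integralZr m measurableT mfE)//; last by move=> x _; rewrite lee_fin.
by rewrite -hfE -[leRHS]mul1e; apply: lee_wpmul2r.
Qed.

(** [g] is the minimum of [Q h] and [c]. With [A = {Q h > c}], the rest has mass
    [(Q h)(A) - c m(A)], and the Doeblin bound is used for this one set. *)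
Lemma Doeblin_splitting h : L1_nneg h -> `|h| <= 1 -> exists g r : L1 m,
  [/\ Q h = g + r, L1_nneg g, {ae m, forall x, g x <= c}, L1_nneg r & `|r| <= rho].
Proof.
move=> h0 h1; have [_ Q0 _] := markovQ; have Qh0 := Q0 _ h0.
have mQ := L1_measurable (Q h).
have ig : m.-integrable [set: X] (EFin \o (fun x => Num.min (Q h x) c)).
  apply: (le_integrable measurableT (g := (fun x => `|Q h x|%:E + c%:E)%E)).
  - by apply/measurable_EFinP; exact: measurable_minr.
  - move=> x _; rewrite -EFinD lee_fin [leRHS]ger0_norm ?addr_ge0// ?(ltW c_gt0)//.
    have [_|_] := leP (Q h x) c; first by rewrite lerDl ltW.
    by rewrite ger0_norm ?lerDr// ltW.
  - apply: integrableD => //; last exact: finite_measure_integrable_cst.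
    exact: integrable_norm (L1_integrable (Q h)).
have ir : m.-integrable [set: X] (EFin \o (fun x => Num.max (Q h x - c) 0)).
  apply: (le_integrable measurableT (g := (fun x => `|Q h x|%:E))).
  - by apply/measurable_EFinP; apply: measurable_maxr => //; exact: measurable_funB.
  - move=> x _; rewrite lee_fin normr_id.
    have [qc|qc] := leP (Q h x - c) 0; first by rewrite normr0.
    rewrite ger0_norm ?(ltW qc)// (le_trans _ (ler_norm _))//.
    by rewrite lerBlDr lerDl ltW.
  - exact: integrable_norm (L1_integrable (Q h)).
have nr : L1_nneg (mkL1 ir).
  by apply: filterS (mkL1E ir) => x ->; rewrite le_max lexx orbT.
exists (mkL1 ig), (mkL1 ir); split => //.
- apply: L1_ext; apply: filterS3 (mkL1E ig) (mkL1E ir) (L1_addE (mkL1 ig) (mkL1 ir)).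
  move=> x ge re ->; rewrite ge re.
  have [qc|qc] := leP (Q h x) c.
    by rewrite max_r ?addr0// subr_le0.
  by rewrite max_l ?subr_ge0 ?(ltW qc)// addrC subrK.
- apply: filterS2 (mkL1E ig) Qh0 => x -> q0.
  by rewrite le_min q0 ltW.
- by apply: filterS (mkL1E ig) => x ->; rewrite ge_min lexx orbT.
pose A := [set x | c < Q h x].
have mA : measurable A.
  exact: measurable_superlevel.
rewrite -lee_fin L1_nnegE//.
have iA : m.-integrable A (EFin \o Q h) by exact: integrableS (L1_integrable (Q h)).
have icA : m.-integrable A (EFin \o (cst c)) by exact: finite_measure_integrable_cst.
have -> : (\int[m]_x (mkL1 ir x)%:E = \int[m]_(x in A) (Q h x)%:E - c%:E * m A)%E.
  rewrite -integral_cst// -(integralB mA iA icA) [RHS]integral_mkcond.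
  apply: ae_eq_integral => //.
  - exact/measurable_EFinP/L1_measurable.
  - apply/(measurable_restrictT _ mA).1; apply/measurable_funTS.
    by apply/measurable_EFinP; exact: measurable_funB.
  - apply: filterS (mkL1E ir) => x -> _; rewrite /patch; case: ifPn.
      by move=> /set_mem /= xA; rewrite max_l// subr_ge0 ltW.
    move=> /negP xA; rewrite max_r// subr_le0 leNgt; apply/negP => cx.
    by apply: xA; rewrite inE.
rewrite leeBlDr ?fin_numM// ?fin_num_measure//.
exact: doeblin_integral.
Qed.

(** The bounded part of [Q h] is covered by a net of bounded images, pushed forward by the
    contraction [iter n Q]. The rest divided by [rho] has norm at most 1, and the induction
    hypothesis applies to it. *)
Lemma Doeblin_nets n (e : R) : 0 < e -> exists s : seq (L1 m),
  forall h, L1_nneg h -> `|h| <= 1 ->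
    exists2 g, g \in s & `|iter n.+1 Q h - g| <= rho ^+ n + e.
Proof.
have [_ Q0 _] := markovQ.
elim: n e => [|n IH] e e0.
  (* One step keeps the norm at most [1 = rho ^+ 0], so 0 alone is a net; hence [n.+1] steps for the
     exponent [n]. *)
  exists [:: 0] => h h0 h1; exists 0; first by rewrite mem_head.
  by rewrite subr0 (le_trans (markov_contract h markovQ))// (le_trans h1)// lerDl ltW.
have e20 : 0 < e / 2 by rewrite divr_gt0.
have [s1 H1] := net_bounded_image (ltW c_gt0) e20.
(* Divided by [rho] because the second net is scaled back by [rho]. *)
have er0 : 0 < e / 2 / rho by rewrite divr_gt0.
have [s2 H2] := IH _ er0.
exists [seq iter n Q g1 + rho *: g2 | g1 <- s1, g2 <- s2] => h h0 h1.
have [g [r [Qh g0 gc r0 rr]]] := Doeblin_splitting h0 h1.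
have [g1 g1s g1e] := H1 g g0 gc.
have r'0 : L1_nneg (rho^-1 *: r).
  apply: filterS2 (L1_scaleE rho^-1 r) r0 => x -> ?.
  by rewrite mulr_ge0// invr_ge0 ltW.
have r'1 : `|rho^-1 *: r| <= 1.
  by rewrite normrZ gtr0_norm ?invr_gt0// ler_pdivrMl// mulr1.
have [g2 g2s g2e] := H2 _ r'0 r'1.
exists (iter n Q g1 + rho *: g2).
  by apply/allpairsP; exists (g1, g2).
have -> : iter n.+2 Q h = iter n Q (Q g) + rho *: iter n.+1 Q (rho^-1 *: r).
  rewrite iterSr Qh (markovD _ _ (markov_iter n.+1 markovQ)) -iterSr; congr +%R.
  rewrite -(markovZ _ _ (markov_iter n.+1 markovQ)) scalerA divff ?scale1r//.
  by rewrite gt_eqF.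
rewrite opprD addrACA (le_trans (ler_normD _ _))// -scalerBr normrZ.
rewrite gtr0_norm// -(markovB _ _ (markov_iter n markovQ)).
apply: (@le_trans _ _ (e / 2 + rho * (rho ^+ n + e / 2 / rho))).
  apply: lerD; last by rewrite ler_wpM2l// ltW.
  exact: le_trans (markov_contract _ (markov_iter n markovQ)) g1e.
rewrite mulrDr -exprS [rho * (_ / _)]mulrC divfK ?gt_eqF//.
by rewrite addrCA -splitr.
Qed.

End Doeblin_compactness.

Lemma pow2_lt (R : realType) (e : R) : 0 < e -> exists n, 2 ^- n < e.
Proof.
move=> e0; exists (Num.truncn e^-1).+1.
rewrite invf_plt ?posrE ?exprn_gt0//.
apply: (lt_le_trans (truncnS_gt _)).
by rewrite -natrX ler_nat ltnW// ltn_expl.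
Qed.

(** * Completeness of L^1(m) *)

Section L1_completeness.
Context d (X : measurableType d) (R : realType) (m : {measure set X -> \bar R}).

Lemma geometric_partial n k :
  \sum_(0 <= i < k) 2 ^- (n + i)%N = 2 * 2 ^- n - 2 * 2 ^- (n + k)%N :> R.
Proof.
elim: k => [|k IH]; first by rewrite big_geq// addn0 subrr.
rewrite big_nat_recr//= IH addnS.
have -> : 2 * 2 ^- (n + k).+1 = 2 ^- (n + k)%N :> R.
  by rewrite exprS invfM mulrA divff// mul1r.
by ring.
Qed.

Lemma geometric_series n :
  (\sum_(0 <= k <oo) (2 ^- (n + k)%N : R)%:E <= (2 * 2 ^- n)%:E)%E.
Proof.
apply: lime_le.
  by apply: is_cvg_nneseries => k _ _; rewrite lee_fin invr_ge0 exprn_ge0.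
apply: nearW => k; rewrite sumEFin lee_fin geometric_partial.
by rewrite lerBlDr lerDl mulr_ge0// invr_ge0 exprn_ge0.
Qed.

Lemma dist_increments (f : nat -> R) n k :
  `|f n - f (n + k)%N| <= \sum_(0 <= i < k) `|f (n + i).+1 - f (n + i)%N|.
Proof.
elim: k => [|k IH]; first by rewrite addn0 subrr normr0 big_geq.
rewrite big_nat_recr//= addnS (le_trans (ler_distD (f (n + k)%N) _ _))//.
by rewrite lerD// distrC.
Qed.

Lemma summable_increments_cvg (f : nat -> R) :
  (\sum_(0 <= n <oo) `|f n.+1 - f n|%:E < +oo)%E -> cvgn f.
Proof.
move=> fin; have cs : cvgn [normed series (telescope f)].
  apply: nondecreasing_is_cvgn.
    by apply: nondecreasing_series => n _ _; exact: normr_ge0.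
  exists (fine (\sum_(0 <= n <oo) `|f n.+1 - f n|%:E)%E) => _ [n _ <-].
  rewrite -lee_fin fineK; last first.
    by rewrite ge0_fin_numE// nneseries_ge0.
  rewrite /series /= -sumEFin; exact: nneseries_lim_ge.
have := normed_cvg cs => ct.
have -> : f = (fun n => f 0%N + series (telescope f) n).
  by apply/funext => n; exact: eq_sum_telescope.
by apply: is_cvgD => //; exact: is_cvg_cst.
Qed.

(** Riesz-Fischer: the increments are summable in norm, hence almost everywhere, and the tail sums
    [G n] dominate the distance to the limit. *)
Lemma L1_complete (u : nat -> L1 m) : (forall n, `|u n.+1 - u n| <= 2 ^- n) ->
  exists l, forall n, `|u n - l| <= 2 * 2 ^- n.
Proof.
move=> uS; have mu n := L1_measurable (u n).
pose G n x := (\sum_(0 <= k <oo) `|u (n + k).+1 x - u (n + k)%N x|%:E)%E.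
have G0 n x : (0 <= G n x)%E by exact: nneseries_ge0.
have mG n : measurable_fun [set: X] (G n).
  apply: (ge0_emeasurable_sum (h := fun k x => `|u (n + k).+1 x - u (n + k)%N x|%:E)) => // k _.
  exact: measurable_dist.
have iG n : (\int[m]_x G n x <= (2 * 2 ^- n)%:E)%E.
  rewrite /G integral_nneseries//; last by move=> k; exact: measurable_dist.
  apply: le_trans (geometric_series n); apply: lee_nneseries => [k _ _|k _].
    by apply: integral_ge0 => x _; rewrite lee_fin.
  by rewrite -L1_norm_dist lee_fin.
have aeG : {ae m, forall x, (G 0%N x < +oo)%E}.
  have : m.-integrable [set: X] (G 0%N).
    apply/integrableP; split => //.
    under eq_integral do rewrite gee0_abs//.
    exact: le_lt_trans (iG 0%N) (ltry _).
  move=> /(integrable_ae measurableT); apply: filterS => x /(_ I).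
  by rewrite ge0_fin_numE.
(* The upper limit is measurable whether or not the sequence converges; [fine] sends its infinite
   values to 0. *)
pose g x := fine (limn_esup (fun n => (u n x)%:E)).
have mg : measurable_fun [set: X] g.
  apply: measurableT_comp => //.
  apply: (measurable_fun_limn_esup (f := fun n x => (u n x)%:E)) => n.
  exact/measurable_EFinP.
have aeg : {ae m, forall x, (fun n => u n x) @ \oo --> g x}.
  apply: filterS aeG => x /summable_increments_cvg cu.
  have cuE : (fun n => (u n x)%:E) @ \oo --> (limn (fun n => u n x))%:E.
    by apply: cvg_EFin => //; exact: nearW.
  by rewrite /g (cvg_limn_einf_sup cuE).2.
have tail n : (\int[m]_x `|u n x - g x|%:E <= (2 * 2 ^- n)%:E)%E.
  apply: le_trans (iG n); apply: ae_ge0_le_integral => //.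
    exact: measurable_dist.
  apply: filterS aeg => x ux _.
  have [Goo|Goo] := eqVneq (G n x) +oo%E; first by rewrite Goo leey.
  have Gfin : G n x \is a fin_num by rewrite ge0_fin_numE// lt_neqAle Goo leey.
  rewrite -(fineK Gfin) lee_fin.
  have cn : (fun j => `|u n x - u j x|) @ \oo --> `|u n x - g x|.
    by apply: cvg_norm; apply: cvgB => //; exact: cvg_cst.
  rewrite -(cvg_lim _ cn)//; apply: limr_le; first by apply/cvg_ex; eexists; exact: cn.
  exists n => // j /= nj; rewrite -(subnKC nj).
  apply: (le_trans (dist_increments (fun i => u i x) n (j - n))).
  rewrite -lee_fin fineK// -sumEFin; exact: nneseries_lim_ge.
have ig : m.-integrable [set: X] (EFin \o g).
  apply/integrableP; split; first exact/measurable_EFinP.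
  apply: (@le_lt_trans _ _ (\int[m]_x (`|u 0%N x|%:E + `|u 0%N x - g x|%:E))%E).
    apply: ge0_le_integral => //.
    - by apply: measurableT_comp => //; exact/measurable_EFinP.
    - apply: emeasurable_funD; last exact: measurable_dist.
      by apply/measurable_EFinP; exact: measurableT_comp.
    - move=> x _; rewrite -EFinD lee_fin -{1}[g x](subKr (u 0%N x)).
      by rewrite (le_trans (ler_normB _ _)).
  rewrite ge0_integralD//; last 2 first.
  - by apply/measurable_EFinP; exact: measurableT_comp.
  - exact: measurable_dist.
  rewrite -L1_normEFin lte_add_pinfty ?ltry//.
  exact: le_lt_trans (tail 0%N) (ltry _).
exists (mkL1 ig) => n; rewrite -lee_fin L1_norm_dist.
apply: le_trans (tail n); rewrite le_eqVlt; apply/orP; left; apply/eqP.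
apply: ae_eq_integral => //.
- exact: (measurable_dist (mu n) (L1_measurable _)).
- exact: measurable_dist.
- by apply: filterS (mkL1E ig) => x ->.
Qed.

End L1_completeness.

Section L1_compactness.
Context d (X : measurableType d) (R : realType) (m : {measure set X -> \bar R}).

Definition has_finite_nets (S : set (L1 m)) := forall e : R, 0 < e ->
  exists s : seq (L1 m), forall h, S h -> exists2 g, g \in s & `|h - g| <= e.

Lemma ultra_seq (I : eqType) (T : Type) (G : set_system T) (B : I -> set T) (s : seq I) :
  UltraFilter G -> G [set x | exists2 i, i \in s & B i x] ->
  exists2 i, i \in s & G (B i).
Proof.
move=> GU; elim: s => [|i s IH] Gs.
  have : G set0 by apply: filterS Gs => x [].
  by move=> /filter_ex [].
have [Bi|nBi] := in_ultra_setVsetC (B i) GU.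
  by exists i => //; rewrite mem_head.
have [|j js Bj] := IH _; last by exists j => //; rewrite inE js orbT.
apply: filterS2 Gs nBi => x [j]; rewrite inE => /orP[/eqP ->|js] Bj nB //.
by exists j.
Qed.

(* An ultrafilter on the closure contains balls of radii [2^-(n + 2)]; it
   converges to the limit of their centers. *)
Lemma compact_closure_nets (S : set (L1 m)) : has_finite_nets S ->
  compact (closure S).
Proof.
move=> nS; rewrite compact_ultra => G GU GS.
have ncl (e : R) : 0 < e -> exists c, G [set h : L1 m | `|h - c| <= e].
  move=> e0; have e20 : 0 < e / 2 by rewrite divr_gt0.
  have [s Hs] := nS _ e20.
  have [|c _ Gc] := @ultra_seq _ _ G (fun c => [set h : L1 m | `|h - c| <= e]) s GU.
    apply: filterS GS => h /(_ (ball h (e / 2)) (nbhsx_ballx h _ e20)) [h' [Sh' hh']].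
    have [g gs h'g] := Hs _ Sh'; exists g => //=.
    rewrite (le_trans (ler_distD h' _ _))// [leRHS]splitr lerD//.
    by move: hh'; rewrite -ball_normE /= => /ltW.
  by exists c.
have pos n : 0 < 2 ^- n.+2 :> R by rewrite invr_gt0 exprn_gt0.
have /choice[c Gc] : forall n, exists c, G [set h : L1 m | `|h - c| <= 2 ^- n.+2].
  by move=> n; exact: ncl.
have GP : ProperFilter G by exact: ultra_proper.
have GI A B : G A -> G B -> exists h, A h /\ B h.
  by move=> GA GB; exact: filter_ex (filterI GA GB).
(* Two members of the filter meet, so their centers are no farther apart than the sum of the
   radii. *)
have cS n : `|c n.+1 - c n| <= 2 ^- n.
  have [h [/= h1 h2]] := GI _ _ (Gc n) (Gc n.+1).
  rewrite (le_trans (ler_distD h _ _))// distrC.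
  apply: (le_trans (lerD h2 h1)).
  have p0 : 0 < 2 ^- n :> R by rewrite invr_gt0 exprn_gt0.
  have e1 k : 2 ^- k.+1 = 2 ^- k / 2 :> R by rewrite exprS invfM mulrC.
  rewrite !e1; lra.
have [l Hl] := L1_complete cS.
have Gl : G --> l.
  move=> A /nbhs_ballP[e /= e0 eA].
  (* The distance to [l] will be at most [2^-(n + 2) + 2 * 2^-n], which is below [3 * 2^-n]. *)
  have [n ne] := pow2_lt (divr_gt0 e0 (ltr0n R 3)).
  apply: filterS (Gc n) => h /= hc; apply: eA.
  rewrite -ball_normE /= distrC (le_lt_trans (ler_distD (c n) _ _))//.
  apply: (le_lt_trans (lerD hc (Hl n))).
  have p0 : 0 < 2 ^- n :> R by rewrite invr_gt0 exprn_gt0.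
  have e1 k : 2 ^- k.+1 = 2 ^- k / 2 :> R by rewrite exprS invfM mulrC.
  rewrite !e1; lra.
exists l; split => //=.
apply: closed_closure => B lB.
by have [h ?] := GI _ _ GS (Gl _ lB); exists h.
Qed.

End L1_compactness.

(** * Uniform constrictivity *)

Section constrictive.
Context d (X : measurableType d) (R : realType) (m : probability X R).
Variable P : L1 m -> L1 m.
Hypothesis markovP : markov_operator P.

Lemma densities_iter n h : @densities _ _ _ m h -> @densities _ _ _ m (iter n P h).
Proof.
move=> [h0 h1]; split; first by have [_ P0 _] := markov_iter n markovP; exact: P0.
by rewrite (markov_norm_nneg (markov_iter n markovP)).
Qed.

Lemma densities_nonempty : exists h : L1 m, @densities _ _ _ m h.
Proof.
have i1 : m.-integrable [set: X] (EFin \o (cst 1 : X -> R)).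
  exact: finite_measure_integrable_cst.
have n1 : L1_nneg (mkL1 i1) by apply: filterS (mkL1E i1) => x ->.
exists (mkL1 i1); split => //; apply: EFin_inj.
rewrite L1_nnegE// (_ : 1%:E = \int[m]_x (1%:E))%E; last first.
  by rewrite integral_cst//= probability_setT mule1.
apply: ae_eq_integral => //.
- exact/measurable_EFinP/L1_measurable.
- by apply: filterS (mkL1E i1) => x ->.
Qed.

(** The centers of the nets need not be totally bounded: one of a fine net may lie far from the
    coarser nets. They are replaced by nearby orbit points [pick k g], taken at a time [N k] no
    earlier than that of any coarser net, so that these points lie close to the coarser nets too. *)
Lemma uniformly_constrictive_nets :
  (forall e : R, 0 < e -> exists n (s : seq (L1 m)), forall h, @densities _ _ _ m h ->
     exists2 g, g \in s & `|iter n P h - g| <= e) ->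
  uniformly_constrictive P.
Proof.
move=> H.
have pos k : 0 < 2 ^- k :> R by rewrite invr_gt0 exprn_gt0.
have /choice[ns Hns] : forall k, exists ns : nat * seq (L1 m), forall h,
    @densities _ _ _ m h -> exists2 g, g \in ns.2 & `|iter ns.1 P h - g| <= 2 ^- k.
  by move=> k; have [n [s ?]] := H _ (pos k); exists (n, s).
pose N k := (\sum_(i < k.+1) (ns i).1)%N.
have Nge k i : (i <= k)%N -> ((ns i).1 <= N k)%N.
  by move=> ik; rewrite /N (bigD1 (Ordinal (ik : (i < k.+1)%N)))//= leq_addr.
have near_net k n h : (N k <= n)%N -> @densities _ _ _ m h ->
    forall i, (i <= k)%N -> exists2 g, g \in (ns i).2 & `|iter n P h - g| <= 2 ^- i.
  move=> kn Dh i ik; have ln : ((ns i).1 <= n)%N := leq_trans (Nge _ _ ik) kn.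
  have := Hns i _ (densities_iter (n - (ns i).1) Dh).
  by rewrite -iterD subnKC.
(* The default 0 is taken when no orbit point is near [g]; for this case 0 is put into the net
   below. *)
pose pick k g := xget (0 : L1 m) [set psi | exists h, [/\ @densities _ _ _ m h,
  psi = iter (N k) P h & `|psi - g| <= 2 ^- k]].
pose S := [set psi | exists k g, g \in (ns k).2 /\ psi = pick k g].
exists (closure S).
  apply: compact_closure_nets => e e0.
  have [k ke] := pow2_lt e0.
  exists (0 :: (ns k).2 ++ flatten [seq [seq pick j g | g <- (ns j).2] | j <- iota 0 k.+1]).
  move=> psi [j [g [gj ->]]].
  have [jk|kj] := leqP j k.
    exists (pick j g); last by rewrite subrr normr0 ltW.
    rewrite inE mem_cat; apply/orP; right; apply/orP; right.
    apply/flattenP; exists [seq pick j g | g <- (ns j).2]; last exact: map_f.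
    by apply/mapP; exists j => //; rewrite mem_iota.
  rewrite /pick; case: xgetP => [_ _ [h [Dh -> _]]|_].
    have Nkj : (N k <= N j)%N.
      rewrite /N -!(big_mkord predT (fun i => (ns i).1)).
      by rewrite [leqRHS](big_cat_nat (n := k.+1))//= ?leq_addr// ltnW.
    have [g' g's hg'] := near_net k (N j) h Nkj Dh k (leqnn k).
    exists g'; last exact: le_trans hg' (ltW ke).
    by rewrite inE mem_cat g's orbT.
  by exists 0; rewrite ?mem_head// subrr normr0 ltW.
have main (e : R) : 0 < e -> exists M, forall n, (M <= n)%N -> forall h, @densities _ _ _ m h ->
    exists2 psi, S psi & `|iter n P h - psi| <= e.
  move=> e0; have [k ke] := pow2_lt (divr_gt0 e0 (ltr0n R 2)).
  exists (N k) => n kn h Dh.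
  have Dh' := densities_iter (n - N k) Dh.
  have e1 : iter n P h = iter (N k) P (iter (n - N k) P h) by rewrite -iterD subnKC.
  have [g gs hg] := near_net k (N k) _ (leqnn _) Dh' k (leqnn k).
  exists (pick k g); first by exists k, g.
  rewrite /pick; case: xgetP => [psi _ [h2 [_ _ psig]]|/(_ (iter n P h)) []].
    rewrite (le_trans (ler_distD g _ _))// e1.
    apply: (le_trans (lerD hg _)); first by rewrite distrC; exact: psig.
    by rewrite ltW// [ltRHS]splitr ltrD.
  by exists (iter (n - N k) P h); split => //; rewrite e1.
set u := (X in X @ \oo --> _).
have u0 n : (0 <= u n)%E.
  have [h Dh] := densities_nonempty.
  apply: (@le_trans _ _ (ereal_inf [set (`|iter n P h - psi|)%:E | psi in closure S])).
    by apply: le_ereal_inf_tmp => _ [psi _ <-]; rewrite lee_fin.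
  by apply: ereal_sup_ubound; exists h.
have ule (e : R) : 0 < e -> exists M, forall n, (M <= n)%N -> (u n <= e%:E)%E.
  move=> e0; have [M HM] := main _ e0; exists M => n Mn.
  apply: ge_ereal_sup => _ [h Dh <-].
  have [psi Spsi hpsi] := HM n Mn h Dh.
  apply: (@le_trans _ _ (`|iter n P h - psi|)%:E); last by rewrite lee_fin.
  by apply: ereal_inf_lbound; exists psi => //; exact: subset_closure.
apply/fine_cvgP; split.
  have [M HM] := ule 1 ltr01; exists M => // n /= Mn.
  by rewrite ge0_fin_numE// (le_lt_trans (HM n Mn))// ltry.
apply/cvgrPdist_le => e e0; have [M HM] := ule e e0; exists M => // n /= Mn.
rewrite sub0r normrN ger0_norm ?fine_ge0// -lee_fin fineK ?HM//.
by rewrite ge0_fin_numE// (le_lt_trans (HM n Mn))// ltry.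
Qed.

End constrictive.

(** * The Doeblin bound from either condition on the density *)

Section Doeblin_condition.
Context d (X : measurableType d) (R : realType) (m : probability X R).
Variable p : X -> X -> R.
Hypothesis p0 : forall x y, 0 <= p x y.
Hypothesis mp : forall x, measurable_fun [set: X] (p x).
Hypothesis p1 : forall x, (\int[m]_y (p x y)%:E = 1)%E.

Lemma measurable_supp x : measurable (supp (p x)).
Proof.
rewrite (_ : supp _ = [set y | 0 < p x y]); first exact: measurable_superlevel.
by apply/seteqP; split => y /=; rewrite /supp/= lt_neqAle p0 andbT eq_sym.
Qed.

Lemma Doeblin_condition : lower_bound_condition m p \/ upper_bound_condition m p ->
  exists c rho : R, [/\ 0 < c, 0 < rho, rho < 1 &
    {ae m, forall x, forall A, measurable A ->
      (\int[m]_(y in A) (p x y)%:E <= rho%:E + c%:E * m A)%E}].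
Proof.
have mpE x D : measurable_fun D (EFin \o p x).
  by apply/measurable_funTS/measurable_EFinP.
move=> [[gamma [alpha [g0 a0 Hg Ha]]]|[beta b0 Hb]].
  (* [kappa(x, A) = 1 - kappa(x, ~A) <= 1 - alpha (gamma - m(A))]; the maximum
     only ensures that [rho] is positive. *)
  exists alpha, (Num.max (1 - alpha * gamma) (2^-1)); split => //.
  - by rewrite lt_max invr_gt0 ltr0n orbT.
  - rewrite gt_max; apply/andP; split; last by rewrite invf_lt1// ltr1n.
    by rewrite ltrBlDr ltrDl mulr_gt0.
  apply: filterS2 Hg Ha => x gx ax A mA.
  have mS := measurable_supp x.
  have mSA : measurable (supp (p x) `\` A) by exact: measurableD.
  have iT : m.-integrable [set: X] (EFin \o p x).
    apply/integrableP; split; first exact/measurable_EFinP.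
    by under eq_integral do rewrite gee0_abs ?lee_fin ?p0//; rewrite p1 ltry.
  have iA : m.-integrable A (EFin \o p x) by exact: integrableS iT.
  have step1 : (alpha%:E * m (supp (p x) `\` A) <= \int[m]_(y in ~` A) (p x y)%:E)%E.
    rewrite -integral_cst//.
    apply: (@le_trans _ _ (\int[m]_(y in supp (p x) `\` A) (p x y)%:E)%E).
      apply: ae_ge0_le_integral => //.
      - by move=> y _; rewrite lee_fin ltW.
      - by move=> y _; rewrite lee_fin.
      - exact: mpE.
      - by apply: filterS ax => y ay [Sy _]; rewrite lee_fin ay.
    apply: ge0_subset_integral => //; first exact: measurableC.
    - exact: mpE.
    - by move=> y _; rewrite lee_fin.
  have step2 : (m (supp (p x)) <= m (supp (p x) `\` A) + m A)%E.
    rewrite -[X in (_ <= X)%E]measureU//; last first.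
    - by rewrite setDE -setIA setICl setI0.
    by apply: le_measure; rewrite ?inE//; [exact: measurableU|move=> y Sy;
      have [Ay|nAy] := pselect (A y); [right|left]].
  have step3 : (\int[m]_(y in A) (p x y)%:E + \int[m]_(y in ~` A) (p x y)%:E = 1)%E.
    rewrite -(p1 x) -(setUv A) ge0_integral_setU//.
    - exact: measurableC.
    - exact: mpE.
    - by move=> y _; rewrite lee_fin.
    - by rewrite disj_set2E setICr.
  have fA : (\int[m]_(y in A) (p x y)%:E)%E \is a fin_num by exact: integrable_fin_num.
  have fC : (\int[m]_(y in ~` A) (p x y)%:E)%E \is a fin_num.
    apply: integrable_fin_num; first exact: measurableC.
    by apply: integrableS iT => //; exact: measurableC.
  have mAf : m A \is a fin_num by exact: fin_num_measure.
  have mSf : m (supp (p x)) \is a fin_num by exact: fin_num_measure.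
  have mSAf : m (supp (p x) `\` A) \is a fin_num by exact: fin_num_measure.
  have s4 : gamma < fine (m (supp (p x))) by rewrite -lte_fin fineK.
  move: step1 step2 step3.
  rewrite -(fineK fA) -(fineK fC) -(fineK mAf) -(fineK mSf) -(fineK mSAf).
  rewrite -EFinM -!EFinD !lee_fin => s1 s2 [s3].
  apply: (@le_trans _ _ (1 - alpha * gamma + alpha * fine (m A))).
    nra.
  by rewrite lerD2r le_max lexx.
(* Under the upper bound, [kappa(x, A) <= beta m(A)], and any [rho] strictly between 0 and 1 will
   do. *)
exists beta, 2^-1; split => //.
- by rewrite invf_lt1// ltr1n.
apply: filterS Hb => x bx A mA.
apply: (@le_trans _ _ (beta%:E * m A)%E); last by rewrite leeDr// lee_fin.
rewrite -integral_cst//; apply: ae_ge0_le_integral => //.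
- by move=> y _; rewrite lee_fin.
- exact: mpE.
- by move=> y _; rewrite lee_fin ltW.
- apply: filterS bx => y + _; have [->|py] := eqVneq (p x y) 0.
    by move=> _; rewrite lee_fin ltW.
  by move=> /(_ py); rewrite lee_fin.
Qed.

End Doeblin_condition.

(** * Countable generation of the Borel sets of a Polish space *)

Section Polish.
Context (R : realType) (X : ptopologicalType).

(** The base consists of the balls of radii [1 / (b + 1)] centered in the dense set; integers that
    code no pair give the empty set. *)
Lemma polish_countable_base : is_polish R X -> exists U : nat -> set X,
  (forall i, open (U i)) /\
  forall O, open O -> forall x, O x -> exists2 i, U i x & U i `<=` O.
Proof.
move=> [[D cD dD] [dist [d0 ds dt nb _]]].
have /countable_injP[f finj] := cD.
(* [e] inverts the injection of [D] into [nat], with the default [point] outside its range. *)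
pose e n := xget point [set x | D x /\ f x = n].
have ef x : D x -> e (f x) = x.
  move=> Dx; rewrite /e; case: xgetP => [y _ [Dy fy]|/(_ x)]; last by case.
  by apply: finj => //; rewrite inE.
pose B (ab : nat * nat) : set X := [set y | dist (e ab.1) y < (ab.2.+1)%:R^-1].
have oB ab : open (B ab).
  rewrite openE => y; rewrite /B /= => yB; rewrite /interior nb /=.
  exists ((ab.2.+1)%:R^-1 - dist (e ab.1) y); first by rewrite subr_gt0.
  move=> z /= yz; apply: (le_lt_trans (dt _ y _)).
  by rewrite -ltrBrDl.
exists (fun i => if unpickle i is Some ab then B ab else set0); split.
  by move=> i; case: (unpickle i) => [ab|]; [exact: oB|exact: open0].
move=> O oO x Ox.
have : nbhs x O by exact: open_nbhs_nbhs.
rewrite nb /= => -[r r0 rO].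
(* The radius is below [r / 2], so a ball containing [x] stays within [r] of it. *)
pose b := Num.truncn (2 / r).
have br : 2 * (b.+1)%:R^-1 < r.
  by rewrite ltr_pdivrMr// mulrC -ltr_pdivrMr// truncnS_gt.
have b0 : 0 < (b.+1)%:R^-1 :> R by rewrite invr_gt0.
have [y [/= xy Dy]] : [set y | dist x y < (b.+1)%:R^-1] `&` D !=set0.
  apply: dD.
    exists x => /=; have -> : dist x x = 0 by exact/d0.
    exact: b0.
  rewrite openE => y /= yB; rewrite /interior nb /=.
  exists ((b.+1)%:R^-1 - dist x y); first by rewrite subr_gt0.
  move=> z /= yz; apply: (le_lt_trans (dt _ y _)).
  by rewrite -ltrBrDl.
exists (pickle (f y, b)); rewrite pickleK /B /= ef//; first by rewrite ds.
move=> z /= yz; apply: rO => /=; apply: (le_lt_trans (dt _ y _)).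
by apply: lt_trans br; rewrite mulrC mulr_natr mulr2n ltrD.
Qed.

(** Every open set is the union of the countably many basic sets that it contains. *)
Lemma polish_countably_generated : is_polish R X -> exists U : nat -> set (Borel X),
  (forall i, measurable (U i)) /\
  (measurable : set (set (Borel X))) `<=` <<s range U>>.
Proof.
move=> /polish_countable_base[U [oU bU]]; exists U; split.
  by move=> i; apply: sub_sigma_algebra; exact: oU.
apply: smallest_sub; first exact: smallest_sigma_algebra.
move=> O oO.
have -> : O = \bigcup_i (if `[< U i `<=` O >] then U i else set0).
  apply/seteqP; split => x.
    move=> Ox; have [i Ux UO] := bU O oO x Ox.
    by exists i => //; rewrite (asboolT UO).
  by move=> [i _]; case: ifPn => // /asboolP; exact.
have [s0 _ sU] := smallest_sigma_algebra setT (range U).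
apply: sU => i; case: ifPn => _; last exact: s0.
by apply: sub_sigma_algebra; exists i.
Qed.

End Polish.

(** The second conclusion speaks of fixed densities of [P] and not of [k], so that it is available
    for every random map inducing [P]. *)
Lemma constrictive_invariant_bound (R : realType) (X : ptopologicalType)
    (m : probability (Borel X) R) (P : L1 m -> L1 m)
    (k : R.-pker Borel X ~> Borel X) (n0 : nat) (p : Borel X -> Borel X -> R) :
  is_polish R X -> markov_operator P -> induces (fun x A => k x A) P ->
  (forall x y, 0 <= p x y) ->
  (forall x, measurable_fun [set: Borel X] (p x)) ->
  (forall x (A : set (Borel X)), measurable A ->
     kernel_iter k n0 x A = (\int[m]_(y in A) (p x y)%:E)%E) ->
  lower_bound_condition m p \/ upper_bound_condition m p ->
  uniformly_constrictive P /\
  exists c rho : R, [/\ 0 < c, 0 < rho, rho < 1 & forall h : L1 m,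
    L1_nneg h -> `|h| <= 1 -> P h = h -> forall A, measurable A ->
    (\int[m]_(x in A) (h x)%:E <= rho%:E + c%:E * m A)%E].
Proof.
move=> pX mP kP p0 mp kE bnd.
have [U [mU gU]] := polish_countably_generated pX.
have kT x : kernel_iter k n0 x [set: Borel X] = 1%E by exact: kernel_iterT.
have mk A : measurable A ->
    measurable_fun [set: Borel X] (fun x => kernel_iter k n0 x A).
  by move=> mA; exact: measurable_kernel_iter.
have p1 x : (\int[m]_y (p x y)%:E = 1)%E by rewrite -kE.
have [c [rho [c0 r0 r1 Hd]]] := Doeblin_condition p0 mp p1 bnd.
have {}Hd : {ae m, forall x, forall A, measurable A ->
    (kernel_iter k n0 x A <= rho%:E + c%:E * m A)%E}.
  by apply: filterS Hd => x Hx A mA; rewrite kE//; exact: Hx.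
have mQ := markov_iter n0 mP.
have Qk h A : L1_nneg h -> measurable A ->
  (\int[m]_(x in A) (iter n0 P h x)%:E =
   \int[m]_x ((h x)%:E * kernel_iter k n0 x A))%E.
  by move=> h0 mA; exact: induces_iter.
split; last first.
  exists c, rho; split => // h h0 h1 Ph A mA.
  have Qh : iter n0 P h = h by elim: n0 {kE kT mk Hd mQ Qk} => //= n ->.
  by rewrite -{1}Qh; exact: (doeblin_integral p0 kE mk Qk c0 r0 Hd).
apply: uniformly_constrictive_nets => // e e0.
have e20 : 0 < e / 2 by rewrite divr_gt0.
have [n rn] : exists n, rho ^+ n <= e / 2.
  have /cvgrPdist_lt /(_ _ e20) [n _ Hn] : rho ^+ n @[n --> \oo] --> (0 : R).
    by apply: cvg_expr; rewrite gtr0_norm.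
  by exists n; have := Hn n (leqnn n); rewrite /= sub0r normrN gtr0_norm ?exprn_gt0// => /ltW.
have [s Hs] := Doeblin_nets mU gU p0 mp kE kT mk mQ Qk c0 r0 Hd n e20.
exists (n.+1 * n0)%N, s => h [h0 h1].
have h1le : `|h| <= 1 by rewrite h1.
have [g gs hg] := Hs h h0 h1le.
exists g => //; rewrite iterM (le_trans hg)// [leRHS]splitr lerD2r//.
Qed.

(** * Stationary measures and harmonic functions *)

Section density_measure.
Local Open Scope ereal_scope.
Context d (X : measurableType d) (R : realType) (m : {measure set X -> \bar R}).
Variables (h : L1 m) (h0 : L1_nneg h).

(** The positive part makes the integral nonnegative on every set, although [h] is nonnegative only
    almost everywhere. *)
Definition density_measure (A : set X) : \bar R :=
  \int[m]_(x in A) (Num.max (h x) 0)%:E.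

Lemma density_measureE A : measurable A -> density_measure A = \int[m]_(x in A) (h x)%:E.
Proof.
move=> mA; apply: ae_eq_integral => //.
- by apply/measurable_funTS/measurable_EFinP; apply: measurable_maxr => //; exact: L1_measurable.
- exact/measurable_funTS/measurable_EFinP/L1_measurable.
- by apply: filterS h0 => x ? _; rewrite max_l.
Qed.

Let measure0_dm : density_measure set0 = 0.
Proof. by rewrite /density_measure integral_set0. Qed.

Let dm_ge0 A : 0 <= density_measure A.
Proof. by apply: integral_ge0 => x _; rewrite lee_fin le_max lexx orbT. Qed.

Let dm_sigma_additive : semi_sigma_additive density_measure.
Proof.
apply: semi_sigma_additive_nng_induced.
- by apply/measurable_EFinP; apply: measurable_maxr => //; exact: L1_measurable.
- by move=> x; rewrite lee_fin le_max lexx orbT.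
Qed.

HB.instance Definition _ := isMeasure.Build _ _ _ density_measure
  measure0_dm dm_ge0 dm_sigma_additive.

Hypothesis h1 : `|h|%R = 1%R.

Let dm1 : density_measure [set: X] = 1.
Proof. by rewrite density_measureE// -L1_nnegE// h1. Qed.

HB.instance Definition _ := Measure_isProbability.Build _ _ _ density_measure dm1.

Definition density_probability : probability X R := density_measure.

Lemma density_probabilityE A : measurable A ->
  density_probability A = \int[m]_(x in A) (h x)%:E.
Proof. exact: density_measureE. Qed.

Lemma density_probability_dominates : density_probability `<< m.
Proof.
apply/null_content_dominatesP => A mA mA0.
rewrite density_probabilityE//; apply: null_set_integral => //.
exact/measurable_funTS/measurable_EFinP/L1_measurable.
Qed.

End density_measure.

Section annealed.
Context dT (T : measurableType dT) dX (X : measurableType dX) (R : realType).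
Variables (q : probability T R) (m : probability X R) (f : T * X -> X).
Hypothesis mf : measurable_fun [set: T * X] f.

Lemma measurable_section x : measurable_fun [set: T] (fun t => f (t, x)).
Proof. exact: measurableT_comp mf _. Qed.

Definition section_map x : {mfun T >-> X} :=
  HB.pack (fun t => f (t, x)) (isMeasurableFun.Build _ _ _ _ _ (measurable_section x)).

(** The same values as [annealed_transition], as a probability measure against which one can
    integrate. *)
Definition annealed x : probability X R := distribution q (section_map x).

Lemma annealedE x A : annealed x A = annealed_transition q f x A.
Proof. by []. Qed.

Lemma integral_annealed x (g : X -> \bar R) : (forall y, 0 <= g y)%E ->
  measurable_fun [set: X] g ->
  (\int[annealed x]_y g y = \int[q]_t g (f (t, x)))%E.
Proof. by move=> g0 mg; rewrite ge0_integral_distribution. Qed.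

Lemma measurable_annealed A : measurable A -> measurable_fun [set: X] (annealed ^~ A).
Proof.
move=> mA; have mfA : measurable (f @^-1` A).
  by rewrite -[X in measurable X]setTI; exact: mf.
have := measurable_fun_ysection q mfA; congr (measurable_fun _ _).
apply/funext => x /=; rewrite annealedE /annealed_transition; congr (q _).
by apply/seteqP; split => t /=; rewrite /ysection /= inE.
Qed.

Lemma measurable_comp_f (g : X -> \bar R) : measurable_fun [set: X] g ->
  measurable_fun [set: T * X] (fun z => g (f z)).
Proof. by move=> mg; exact: measurableT_comp mg mf. Qed.

Lemma measurable_integral_annealed (g : X -> \bar R) : (forall y, 0 <= g y)%E ->
  measurable_fun [set: X] g -> measurable_fun [set: X] (fun x => \int[q]_t g (f (t, x)))%E.
Proof.
move=> g0 mg; exact: (measurable_fun_fubini_tonelli_G (m1 := q) _ (measurable_comp_f mg)).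
Qed.

(** Tonelli exchanges [t] and [x]. *)
Lemma stationaryP (mu : probability X R) : stationary q f mu <->
  forall A, measurable A -> (mu A = \int[mu]_x annealed x A)%E.
Proof.
have E A : measurable A -> (\int[q]_t mu [set x | A (f (t, x))] = \int[mu]_x annealed x A)%E.
  move=> mA.
  have mfA : measurable_fun [set: T * X] (fun z => (\1_A (f z))%:E : \bar R).
    by apply: (measurable_comp_f (g := fun y => (\1_A y)%:E)); exact/measurable_EFinP.
  have h := fubini_tonelli (m1 := q) (m2 := mu) _ mfA (fun z => _ : (0 <= (\1_A (f z))%:E)%E).
  transitivity (\int[q]_t \int[mu]_x (\1_A (f (t, x)))%:E)%E.
    apply: eq_integral => t _.
    have mS : measurable [set x | A (f (t, x))].
      rewrite -[X in measurable X]setTI.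
      exact: (measurableT_comp mf (pair1_measurable t)).
    have <- : (\int[mu]_x (\1_[set x | A (f (t, x))] x)%:E = mu [set x | A (f (t, x))])%E.
      by rewrite integral_indic// setIT.
    by apply: eq_integral => x _; rewrite !indicE.
  rewrite h//; apply: eq_integral => x _.
  have mS : measurable [set t | A (f (t, x))].
    by rewrite -[X in measurable X]setTI; exact: measurable_section.
  have <- : (\int[q]_t (\1_[set t | A (f (t, x))] t)%:E = annealed x A)%E.
    by rewrite integral_indic// setIT.
  by apply: eq_integral => t _; rewrite !indicE.
by split=> H A mA; rewrite H// E.
Qed.

Lemma stationary_integral (mu : probability X R) : stationary q f mu ->
  forall g : X -> \bar R, (forall y, 0 <= g y)%E -> measurable_fun [set: X] g ->
  (\int[mu]_y g y = \int[mu]_x \int[q]_t g (f (t, x)))%E.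
Proof.
move=> /stationaryP smu g g0 mg.
have H A : measurable A ->
    (\int[mu]_(y in A) (cst 1 y)%:E = \int[mu]_x ((cst 1 x)%:E * annealed x A))%E.
  move=> mA; transitivity (\int[mu]_(y in A) cst 1%E y)%E => //.
  rewrite integral_cst// mul1e; apply: (etrans (smu A mA)).
  by apply: eq_integral => x _; rewrite mul1e.
have e := integral_disintegration measurable_annealed (fun=> ler01)
  (measurable_cst _) (fun=> ler01) (measurable_cst _) H g0 mg.
transitivity (\int[mu]_y ((cst 1 y)%:E * g y))%E.
  by apply: eq_integral => y _; rewrite mul1e.
by rewrite e; apply: eq_integral => x _; rewrite mul1e integral_annealed.
Qed.

Variable P : L1 m -> L1 m.
Hypothesis markovP : markov_operator P.
Hypothesis aP : induces (annealed_transition q f) P.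

(** Averaging [g] over one random step is the dual of [P]. *)
Lemma annealed_duality (h : L1 m) (g : X -> \bar R) : L1_nneg h ->
  (forall y, 0 <= g y)%E -> measurable_fun [set: X] g ->
  (\int[m]_y ((P h y)%:E * g y) = \int[m]_x ((h x)%:E * \int[q]_t g (f (t, x))))%E.
Proof.
move=> h0 g0 mg.
have [a [a0 ma ha]] := L1_nneg_repr h0.
have [b [b0 mb hb]] : exists b : X -> R, [/\ forall x, 0 <= b x,
    measurable_fun setT b & {ae m, forall x, P h x = b x}].
  by apply: L1_nneg_repr; have [_ P0 _] := markovP; exact: P0.
have mI := measurable_integral_annealed g0 mg.
transitivity (\int[m]_y ((b y)%:E * g y))%E.
  apply: ae_eq_integral => //.
  - by apply: emeasurable_funM => //; exact/measurable_EFinP/L1_measurable.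
  - by apply: emeasurable_funM => //; exact/measurable_EFinP.
  - by apply: filterS hb => x ->.
rewrite (integral_disintegration (m1 := m) measurable_annealed a0 ma b0 mb _ g0 mg).
  apply: ae_eq_integral => //.
  - apply: emeasurable_funM; first exact/measurable_EFinP.
    apply: measurable_fun_integral_kernel => //; exact: measurable_annealed.
  - by apply: emeasurable_funM => //; exact/measurable_EFinP/L1_measurable.
  - by apply: filterS ha => x -> _; rewrite integral_annealed.
move=> A mA; transitivity (\int[m]_(x in A) (P h x)%:E)%E.
  apply: ae_eq_integral => //.
  - exact/measurable_funTS/measurable_EFinP.
  - exact/measurable_funTS/measurable_EFinP/L1_measurable.
  - by apply: filterS hb => x ->.
rewrite (aP.2 _ _ mA); apply: ae_eq_integral => //.
- by apply: emeasurable_funM; [exact/measurable_EFinP/L1_measurable|exact: measurable_annealed].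
- by apply: emeasurable_funM; [exact/measurable_EFinP|exact: measurable_annealed].
- by apply: filterS ha => x ->.
Qed.

(** The disintegration formula with the Dirac masses as kernel and [mu] as first measure. *)
Lemma integral_dominated_density (mu : probability X R) (h : L1 m) :
  L1_nneg h -> (forall A, measurable A -> mu A = \int[m]_(x in A) (h x)%:E)%E ->
  forall g : X -> \bar R, (forall y, 0 <= g y)%E -> measurable_fun [set: X] g ->
  (\int[mu]_y g y = \int[m]_y ((h y)%:E * g y))%E.
Proof.
move=> h0 muE g g0 mg.
have [a [a0 ma ha]] := L1_nneg_repr h0.
have H A : measurable A ->
    (\int[m]_(y in A) (a y)%:E = \int[mu]_x ((cst 1 x)%:E * \d_x A))%E.
  move=> mA; rewrite -(_ : mu A = \int[m]_(y in A) (a y)%:E)%E; last first.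
    rewrite muE//; apply: ae_eq_integral => //.
    - exact/measurable_funTS/measurable_EFinP/L1_measurable.
    - exact/measurable_funTS/measurable_EFinP.
    - by apply: filterS ha => x ->.
  under eq_integral do rewrite mul1e.
  by rewrite integral_indic// setIT.
have mdirac A : measurable A -> measurable_fun [set: X] (fun x => \d_x A : \bar R).
  by move=> mA; apply/measurable_EFinP; exact: measurable_indic.
have e := integral_disintegration mdirac (fun=> ler01)
  (measurable_cst _) a0 ma H g0 mg.
transitivity (\int[m]_y ((a y)%:E * g y))%E; last first.
  apply: ae_eq_integral => //.
  - by apply: emeasurable_funM => //; exact/measurable_EFinP.
  - by apply: emeasurable_funM => //; exact/measurable_EFinP/L1_measurable.
  - by apply: filterS ha => x ->.
rewrite e; apply: eq_integral => x _.
by rewrite mul1e integral_dirac// diracT mul1e.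
Qed.

(** [P h] is the density of [mu] after one random step, so both sides say that this step preserves
    [mu]. *)
Lemma invariant_density_stationary (mu : probability X R) (h : L1 m) : L1_nneg h ->
  (forall A, measurable A -> mu A = \int[m]_(x in A) (h x)%:E)%E ->
  P h = h <-> stationary q f mu.
Proof.
move=> h0 muE.
have E A : measurable A -> (\int[m]_(x in A) (P h x)%:E = \int[mu]_x annealed x A)%E.
  move=> mA; rewrite (aP.2 _ _ mA) (integral_dominated_density h0 muE)//.
  exact: measurable_annealed.
split=> [Ph|/stationaryP smu].
  by apply/stationaryP => A mA; rewrite muE// -{1}Ph E.
by apply: L1_eqP => A mA; rewrite E// -smu// muE.
Qed.

Lemma dominated_density (mu : probability X R) : mu `<< m -> exists h : L1 m,
  [/\ L1_nneg h, `|h| = 1,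
      forall A, measurable A -> (mu A = \int[m]_(x in A) (h x)%:E)%E &
      {ae m, forall x, Radon_Nikodym (charge_of_finite_measure mu) m x = (h x)%:E}].
Proof.
move=> mum; pose nu := charge_of_finite_measure mu.
have numu : nu `<< m by exact: mum.
have iRN := Radon_Nikodym_integrable numu.
pose g x := fine (Radon_Nikodym nu m x).
have gE x : (g x)%:E = Radon_Nikodym nu m x by rewrite fineK// Radon_Nikodym_fin_num.
have ig : m.-integrable [set: X] (EFin \o g).
  by apply: eq_integrable iRN => // x _; rewrite /= gE.
have RNE : {ae m, forall x, Radon_Nikodym nu m x = (mkL1 ig x)%:E}.
  by apply: filterS (mkL1E ig) => x ->; rewrite gE.
have muE A : measurable A -> (mu A = \int[m]_(x in A) (mkL1 ig x)%:E)%E.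
  move=> mA; apply: (etrans (Radon_Nikodym_integral numu mA)).
  apply: ae_eq_integral => //.
  - exact/measurable_funTS/(measurable_int m iRN).
  - exact/measurable_funTS/measurable_EFinP/L1_measurable.
  - by apply: filterS RNE.
have h0 : L1_nneg (mkL1 ig) by apply: L1_nneg_integral => A mA; rewrite -muE.
exists (mkL1 ig); split => //; apply: EFin_inj.
by rewrite L1_nnegE// -muE// probability_setT.
Qed.

End annealed.

Section harmonic.
Context dT (T : measurableType dT) dX (X : measurableType dX) (R : realType).
Variables (q : probability T R) (f : T * X -> X).
Hypothesis mf : measurable_fun [set: T * X] f.

Definition harmonic (u : X -> R) := [/\ measurable_fun [set: X] u,
  forall x, 0 <= u x <= 1 &
  forall x, ((u x)%:E = \int[q]_t (u (f (t, x)))%:E)%E].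

Lemma harmonic_compl u : harmonic u -> harmonic (fun x => 1 - u x).
Proof.
move=> [mu u01 hu]; split.
- exact: measurable_funB.
- by move=> x; have /andP[u0 u1] := u01 x; rewrite subr_ge0 u1 lerBlDr lerDl u0.
move=> x; have muf : measurable_fun [set: T] (fun t => u (f (t, x))).
  by apply: measurableT_comp => //; exact: measurable_section.
have iu : q.-integrable [set: T] (EFin \o (fun t => u (f (t, x)))).
  apply: (@bounded_integrable _ _ _ q _ 1) => // t.
  by have /andP[u0 u1] := u01 (f (t, x)); rewrite ger0_norm.
have i1 : q.-integrable [set: T] (EFin \o (cst 1 : T -> R)).
  exact: finite_measure_integrable_cst.
have := integralB_EFin measurableT i1 iu.
rewrite EFinB hu /= => ->.
by rewrite integral_cst//= probability_setT mule1.
Qed.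

(** Along the orbit [u] is a martingale, whose second moment is constant under a stationary law;
    hence its increments vanish. [D x] is the variance of the first increment and [W x] the second
    moment after one step. *)
Lemma harmonic_invariant (mu : probability X R) (u : X -> R) :
  stationary q f mu -> harmonic u ->
  {ae mu, forall x, {ae q, forall t, u (f (t, x)) = u x}}.
Proof.
move=> smu [mu' u01 hu].
have u0 x : 0 <= u x by case/andP: (u01 x).
have u1 x : u x <= 1 by case/andP: (u01 x).
have muf : measurable_fun [set: T * X] (fun z => u (f z)).
  exact: measurableT_comp mu' mf.
have mg : measurable_fun [set: T * X] (fun z => ((u (f z) - u z.2) ^+ 2)%:E).
  apply/measurable_EFinP; apply: measurable_funX; apply: measurable_funB => //.
  exact: measurableT_comp.
have g0 z : (0 <= ((u (f z) - u z.2) ^+ 2)%:E)%E by rewrite lee_fin sqr_ge0.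
have msec x : measurable_fun [set: T] (fun t => u (f (t, x))).
  by apply: measurableT_comp => //; exact: measurable_section.
have mgx x : measurable_fun [set: T] (fun t => ((u (f (t, x)) - u x) ^+ 2)%:E).
  by apply/measurable_EFinP; apply: measurable_funX; apply: measurable_funB.
pose D x := (\int[q]_t ((u (f (t, x)) - u x) ^+ 2)%:E)%E.
have mD : measurable_fun [set: X] D.
  exact: (measurable_fun_fubini_tonelli_G (m1 := q) _ mg).
have D0 x : (0 <= D x)%E by apply: integral_ge0 => t _; rewrite lee_fin sqr_ge0.
pose W x := (\int[q]_t ((u (f (t, x))) ^+ 2)%:E)%E.
have sq0 x : (0 <= ((u x) ^+ 2)%:E)%E by rewrite lee_fin sqr_ge0.
have msq : measurable_fun [set: X] (fun x => ((u x) ^+ 2)%:E).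
  by apply/measurable_EFinP; exact: measurable_funX.
have mW : measurable_fun [set: X] W.
  exact: (measurable_integral_annealed q mf (g := fun y => ((u y) ^+ 2)%:E)).
have W0 x : (0 <= W x)%E by apply: integral_ge0 => t _; rewrite lee_fin sqr_ge0.
have pointwise x : (D x + (2 * u x ^+ 2)%:E = W x + (u x ^+ 2)%:E)%E.
  have -> : ((2 * u x ^+ 2)%:E = \int[q]_t (2 * u x * u (f (t, x)))%:E)%E.
    under eq_integral do rewrite EFinM.
    have me : measurable_fun [set: T] (fun t => (u (f (t, x)))%:E) by exact/measurable_EFinP.
    rewrite (ge0_integralZl q measurableT me).
    - by rewrite -hu -EFinM -mulrA expr2.
    - by move=> t _; rewrite lee_fin.
    - by rewrite lee_fin mulr_ge0.
  have -> : ((u x ^+ 2)%:E = \int[q]_t cst (u x ^+ 2)%:E t)%E.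
    by rewrite integral_cst//= probability_setT mule1.
  rewrite -ge0_integralD//=; last 2 first.
  - by move=> t _; rewrite lee_fin !mulr_ge0.
  - apply/measurable_EFinP; apply: measurable_funM => //.
  rewrite -ge0_integralD//=; last first.
    by apply/measurable_EFinP; exact: measurable_funX.
  by apply: eq_integral => t _; rewrite -!EFinD; congr EFin; ring.
have sW : (\int[mu]_x W x = \int[mu]_x ((u x) ^+ 2)%:E)%E.
  by rewrite [RHS](stationary_integral mf smu sq0 msq).
have fin2 : (\int[mu]_x ((u x) ^+ 2)%:E)%E \is a fin_num.
  apply: integrable_fin_num => //; apply: (@bounded_integrable _ _ _ mu _ 1).
    exact: measurable_funX.
  by move=> x; rewrite ger0_norm ?sqr_ge0// expr_le1.
(* By harmonicity [D + 2 u^2 = W + u^2] pointwise, and by stationarity [W] has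
   the same integral as [u^2]. *)
have ID : (\int[mu]_x D x = 0)%E.
  have : (\int[mu]_x (D x + (2 * u x ^+ 2)%:E) = \int[mu]_x (W x + (u x ^+ 2)%:E))%E.
    by apply: eq_integral => x _; exact: pointwise.
  have -> : (\int[mu]_x (W x + (u x ^+ 2)%:E) =
      \int[mu]_x W x + \int[mu]_x (u x ^+ 2)%:E)%E by exact: ge0_integralD.
  have -> : (\int[mu]_x (D x + (2 * u x ^+ 2)%:E) =
      \int[mu]_x D x + \int[mu]_x (2 * u x ^+ 2)%:E)%E.
    apply: ge0_integralD => //.
    - by move=> x _; rewrite lee_fin mulr_ge0// sqr_ge0.
    - by apply/measurable_EFinP; apply: measurable_funM => //; exact: measurable_funX.
  have -> : (\int[mu]_x (2 * u x ^+ 2)%:E =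
     \int[mu]_x (u x ^+ 2)%:E + \int[mu]_x (u x ^+ 2)%:E)%E.
    transitivity (\int[mu]_x ((u x ^+ 2)%:E + (u x ^+ 2)%:E))%E.
      by apply: eq_integral => x _; rewrite -EFinD; congr EFin; ring.
    by apply: ge0_integralD.
  rewrite sW => e.
  have fin4 : (\int[mu]_x (u x ^+ 2)%:E + \int[mu]_x (u x ^+ 2)%:E)%E \is a fin_num.
    by rewrite fin_numD fin2.
  by rewrite -[LHS](addeK _ fin4) e subee.
have mDn : (\int[mu]_(x in [set: X]) `|D x| = 0)%E.
  by under eq_integral do rewrite gee0_abs//.
have := (ae_eq_integral_abs mu measurableT mD).1 mDn.
apply: filterS => x /(_ I) Dx0.
have : (\int[q]_(t in [set: T]) `|((u (f (t, x)) - u x) ^+ 2)%:E| = 0)%E.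
  by under eq_integral do rewrite gee0_abs ?lee_fin ?sqr_ge0//.
move=> /(ae_eq_integral_abs q measurableT (mgx x)).
apply: filterS => t /(_ I) [] /eqP; rewrite sqrf_eq0 subr_eq0 => /eqP.
exact.
Qed.

(** Weighting by [h] before or after a random step amounts to the same, so the step preserves
    [h dmu] as it preserves [mu]. *)
Lemma invariant_function_stationary (mu : probability X R) (h : X -> R) :
  stationary q f mu -> measurable_fun [set: X] h -> (forall x, 0 <= h x) ->
  (\int[mu]_x (h x)%:E = 1)%E ->
  {ae mu, forall x, {ae q, forall t, h (f (t, x)) = h x}} ->
  exists nu : probability X R, stationary q f nu /\
    forall A, measurable A -> (nu A = \int[mu]_(x in A) (h x)%:E)%E.
Proof.
move=> smu mh h0 h1 inv.
have ih : mu.-integrable [set: X] (EFin \o h).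
  apply/integrableP; split; first exact/measurable_EFinP.
  by under eq_integral do rewrite gee0_abs ?lee_fin//; rewrite h1 ltry.
have n0 : L1_nneg (mkL1 ih) by apply: filterS (mkL1E ih) => x ->.
have hE A : measurable A ->
    (\int[mu]_(x in A) (mkL1 ih x)%:E = \int[mu]_(x in A) (h x)%:E)%E.
  move=> mA; apply: ae_eq_integral => //.
  - exact/measurable_funTS/measurable_EFinP/L1_measurable.
  - exact/measurable_funTS/measurable_EFinP.
  - by apply: filterS (mkL1E ih) => x ->.
have n1 : `|mkL1 ih| = 1 by apply: EFin_inj; rewrite L1_nnegE// hE// h1.
exists (density_probability n0 n1); split; last first.
  by move=> A mA; rewrite density_probabilityE// hE.
apply/stationaryP => // A mA.
have mann := measurable_annealed q mf mA.
rewrite (integral_dominated_density n0 (density_probabilityE n0 n1))//.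
transitivity (\int[mu]_x ((h x)%:E * annealed q mf x A))%E; last first.
  apply: ae_eq_integral => //.
  - by apply: emeasurable_funM => //; exact/measurable_EFinP.
  - by apply: emeasurable_funM => //; exact/measurable_EFinP/L1_measurable.
  - by apply: filterS (mkL1E ih) => x ->.
rewrite density_probabilityE// hE//.
have mhA : measurable_fun [set: X] (fun x => (h x * \1_A x)%:E).
  by apply/measurable_EFinP; apply: measurable_funM => //; exact: measurable_indic.
have hA0 x : (0 <= (h x * \1_A x)%:E)%E by rewrite lee_fin mulr_ge0.
transitivity (\int[mu]_x (h x * \1_A x)%:E)%E.
  rewrite integral_mkcond; apply: eq_integral => x _.
  by rewrite /patch indicE; case: ifPn; rewrite ?mulr1 ?mulr0.
rewrite (stationary_integral mf smu hA0 mhA).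
apply: ae_eq_integral => //.
- exact: (measurable_integral_annealed q mf hA0 mhA).
- by apply: emeasurable_funM => //; exact/measurable_EFinP.
apply: filterS inv => x invx _.
have mS : measurable [set t | A (f (t, x))].
  by rewrite -[X in measurable X]setTI; exact: (measurable_section mf x).
have mfx : measurable_fun [set: T] (fun t => f (t, x)) by exact: measurable_section.
transitivity (\int[q]_t ((h x)%:E * (\1_A (f (t, x)))%:E))%E.
  apply: ae_eq_integral => //.
  - exact: (measurableT_comp (f := fun y => (h y * \1_A y)%:E) mhA mfx).
  - apply: measurable_funeM; apply/measurable_EFinP.
    by apply: (measurableT_comp (f := \1_A : X -> R)) => //; exact: measurable_indic.
  - by apply: filterS invx => t -> _; rewrite EFinM.
rewrite ge0_integralZl//; last 2 first.
- apply/measurable_EFinP.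
  by apply: (measurableT_comp (f := \1_A : X -> R)) => //; exact: measurable_indic.
- by rewrite lee_fin.
congr (_ * _)%E; rewrite annealedE /annealed_transition.
have <- : (\int[q]_t (\1_[set t | A (f (t, x))] t)%:E = q [set t | A (f (t, x))])%E.
  by rewrite integral_indic// setIT.
by apply: eq_integral => t _; rewrite !indicE.
Qed.

(** The normalized indicator of the superlevel set is constant along almost every transition because
    [u] is. *)
Lemma restrict_stationary (mu : probability X R) (u : X -> R) (c : R) :
  stationary q f mu -> harmonic u -> (mu [set x | c < u x]%R != 0)%E ->
  exists nu : probability X R, [/\ stationary q f nu, nu `<< mu &
    nu [set x | c < u x] = 1%E].
Proof.
move=> smu hu; have [mu' _ _] := hu; set B := [set x | c < u x] => B0.
have mB : measurable B by exact: measurable_superlevel.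
have Bf : mu B \is a fin_num by exact: fin_num_measure.
pose b := fine (mu B).
have b0 : 0 < b by rewrite fine_gt0// lt0e B0 measure_ge0/= ltey_eq Bf.
have bE : mu B = b%:E by rewrite fineK.
pose h x := b^-1 * \1_B x.
have mh : measurable_fun [set: X] h.
  by apply: measurable_funM => //; exact: measurable_indic.
have h0 x : 0 <= h x by rewrite mulr_ge0// invr_ge0 ltW.
have hI A : measurable A -> (\int[mu]_(x in A) (h x)%:E = b^-1%:E * mu (B `&` A))%E.
  move=> mA; under eq_integral do rewrite EFinM.
  rewrite ge0_integralZl//; last 2 first.
  - by apply/measurable_funTS/measurable_EFinP; exact: measurable_indic.
  - by rewrite lee_fin invr_ge0 ltW.
  by rewrite integral_indic.
have h1 : (\int[mu]_x (h x)%:E = 1)%E.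
  by rewrite hI// setIT bE -EFinM mulVf// gt_eqF.
have [nu [snu nuE]] : exists nu : probability X R, stationary q f nu /\
    forall A, measurable A -> (nu A = \int[mu]_(x in A) (h x)%:E)%E.
  apply: invariant_function_stationary => //.
  apply: filterS (harmonic_invariant smu hu) => x; apply: filterS => t e.
  rewrite /h; congr (_ * _); rewrite !indicE; congr (_%:R); congr nat_of_bool.
  by apply/idP/idP; rewrite !inE /B/= e.
exists nu; split => //.
  apply/null_content_dominatesP => A mA mA0; rewrite nuE// hI//.
  rewrite (_ : mu (B `&` A) = 0)%E ?mule0//.
  apply/eqP; rewrite eq_le measure_ge0 andbT -mA0.
  by apply: le_measure; rewrite ?inE//; exact: measurableI.
by rewrite nuE// hI// setIid bE -EFinM mulVf// gt_eqF.
Qed.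

End harmonic.

(** * Invariant densities as limits of Cesaro means *)

Section L1_functional.
Context d (X : measurableType d) (R : realType) (m : {measure set X -> \bar R}).
Variable w : X -> R.
Hypothesis mw : measurable_fun [set: X] w.
Hypothesis w1 : forall x, `|w x| <= 1.
Implicit Types phi psi : L1 m.

Definition L1_pairing phi : R := \int[m]_x (w x * phi x).

Lemma L1_pairing_integrable phi : m.-integrable [set: X] (EFin \o (fun x => w x * phi x)).
Proof.
apply: (le_integrable measurableT _ _ (L1_integrable phi)).
- by apply/measurable_EFinP; apply: measurable_funM => //; exact: L1_measurable.
- by move=> x _; rewrite lee_fin normrM ler_piMl.
Qed.

Lemma L1_pairing_ae phi (g : X -> R) : {ae m, forall x, phi x = g x} ->
  measurable_fun [set: X] g -> L1_pairing phi = \int[m]_x (w x * g x).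
Proof.
move=> e mg; congr fine; apply: ae_eq_integral => //.
- by apply/measurable_EFinP; apply: measurable_funM => //; exact: L1_measurable.
- by apply/measurable_EFinP; apply: measurable_funM.
- by apply: filterS e => x ->.
Qed.

Lemma L1_pairingD phi psi : L1_pairing (phi + psi) = L1_pairing phi + L1_pairing psi.
Proof.
rewrite (L1_pairing_ae (L1_addE phi psi)); last first.
  by apply: measurable_funD; exact: L1_measurable.
rewrite /L1_pairing -RintegralD//; [|exact: L1_pairing_integrable..].
by apply: eq_Rintegral => x _; rewrite mulrDr.
Qed.

Lemma L1_pairingZ a phi : L1_pairing (a *: phi) = a * L1_pairing phi.
Proof.
rewrite (L1_pairing_ae (L1_scaleE a phi)); last first.
  by apply: measurable_funM => //; exact: L1_measurable.
rewrite /L1_pairing -RintegralZl//; last exact: L1_pairing_integrable.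
by apply: eq_Rintegral => x _; rewrite mulrCA.
Qed.

Lemma L1_pairingB phi psi : L1_pairing (phi - psi) = L1_pairing phi - L1_pairing psi.
Proof. by rewrite L1_pairingD -scaleN1r L1_pairingZ mulN1r. Qed.

Lemma L1_pairing_le phi : `|L1_pairing phi| <= `|phi|.
Proof.
rewrite -lee_fin L1_normEFin EFin_normr_Rintegral//; last exact: L1_pairing_integrable.
apply: (@le_trans _ _ (\int[m]_x `|w x * phi x|%:E)%E).
  by apply: le_abse_integral => //; exact: measurable_int (L1_pairing_integrable phi).
apply: ge0_le_integral => //.
- apply/measurable_EFinP; apply: measurableT_comp => //.
  by apply: measurable_funM => //; exact: L1_measurable.
- by apply/measurable_EFinP; apply: measurableT_comp => //; exact: L1_measurable.
- by move=> x _; rewrite lee_fin normrM ler_piMl.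
Qed.

End L1_functional.

Section Cesaro.
Context d (X : measurableType d) (R : realType) (m : probability X R).
Variable P : L1 m -> L1 m.
Hypothesis markovP : markov_operator P.

Definition Cesaro (h : L1 m) N : L1 m :=
  (N.+1%:R)^-1 *: \sum_(0 <= n < N.+1) iter n P h.

Lemma L1_scale_nneg c (h : L1 m) : 0 <= c -> L1_nneg h -> L1_nneg (c *: h).
Proof. by move=> c0 h0; apply: filterS2 (L1_scaleE c h) h0 => x -> ?; exact: mulr_ge0. Qed.

Lemma Cesaro_density h N : densities h -> densities (Cesaro h N).
Proof.
move=> Dh.
have [s0 sn] : L1_nneg (\sum_(0 <= n < N.+1) iter n P h) /\
    `|\sum_(0 <= n < N.+1) iter n P h| = N.+1%:R.
  elim: N.+1 => [|k [k0 kn]].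
    rewrite big_geq// normr0; split => //.
    by apply: filterS (L1_0E m) => x ->.
  have [h0 h1] := densities_iter markovP k Dh.
  rewrite big_nat_recr//=; split.
    by apply: filterS3 (L1_addE (\sum_(0 <= n < k) iter n P h) (iter k P h)) k0 h0 => x -> ? ?; rewrite addr_ge0.
  by rewrite L1_norm_add_nneg// kn h1 -natr1.
split; first by apply: L1_scale_nneg s0; rewrite invr_ge0.
by rewrite normrZ sn gtr0_norm ?invr_gt0// mulVf.
Qed.

(** The sum telescopes to [P^(N+1) h - h], of norm at most 2. *)
Lemma Cesaro_almost_invariant h N : densities h ->
  `|P (Cesaro h N) - Cesaro h N| <= 2 / N.+1%:R.
Proof.
move=> Dh; rewrite /Cesaro (markovZ _ _ markovP) -scalerBr normrZ.
have -> : P (\sum_(0 <= n < N.+1) iter n P h) - \sum_(0 <= n < N.+1) iter n P h =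
    iter N.+1 P h - h.
  elim: N => [|k IH]; first by rewrite !big_nat1.
  rewrite big_nat_recr//= (markovD _ _ markovP) opprD addrACA IH /=.
  by rewrite addrC addrA subrK.
rewrite gtr0_norm ?invr_gt0// mulrC ler_pM2r ?invr_gt0//.
have [_ h1] := densities_iter markovP N.+1 Dh; have [_ h2] := Dh.
by rewrite (le_trans (ler_normB _ _))// h1 h2.
Qed.

Lemma Cesaro_almost_invariant_iter h N n : densities h ->
  `|iter n P (Cesaro h N) - Cesaro h N| <= n%:R * (2 / N.+1%:R).
Proof.
move=> Dh; elim: n => [|n IH]; first by rewrite subrr normr0 mul0r.
rewrite (le_trans (ler_distD (P (Cesaro h N)) _ _))// -natr1 mulrDl mul1r.
apply: lerD; last exact: Cesaro_almost_invariant.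
by rewrite /= -(markovB _ _ markovP) (le_trans (markov_contract _ markovP)).
Qed.

Hypothesis ucP : uniformly_constrictive P.

(* (UC) brings [P^n (Cesaro h N)] close to a compact set, and it is close to
   [Cesaro h N] itself once [N] is large compared with [n]. *)
Lemma Cesaro_cluster h : densities h -> exists p : L1 m,
  forall (e : R) K, 0 < e -> exists N, (K <= N)%N /\ `|Cesaro h N - p| < e.
Proof.
move=> Dh; have [F cF ucF] := ucP.
have near_F (e : R) K : 0 < e -> exists Npsi : nat * L1 m,
    [/\ (K <= Npsi.1)%N, F Npsi.2 & `|Cesaro h Npsi.1 - Npsi.2| < e].
  move=> e0; have e20 : 0 < e / 2 by rewrite divr_gt0.
  have [n /(_ n (leqnn n)) Hn] := cvge0_lt ucF e20.
  (* The second argument makes the defect of invariance under [n] steps, [2 n / (N + 1)], at most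
     [e / 2]. *)
  pose N := maxn K (Num.truncn (n%:R * 2 / (e / 2))).
  have DN := Cesaro_density N Dh.
  have : (ereal_inf [set (`|iter n P (Cesaro h N) - psi|)%:E | psi in F] < (e / 2)%:E)%E.
    by apply: le_lt_trans Hn; apply: ereal_sup_ubound; exists (Cesaro h N).
  move=> /ereal_inf_lt[_ [psi Fpsi <-]]; rewrite lte_fin => psie.
  exists (N, psi); split => //=; first exact: leq_maxl.
  rewrite (le_lt_trans (ler_distD (iter n P (Cesaro h N)) _ _))// [ltRHS]splitr ler_ltD//.
  rewrite distrC (le_trans (Cesaro_almost_invariant_iter N n Dh))// mulrA.
  rewrite ler_pdivrMr// [leRHS]mulrC -ler_pdivrMr//.
  apply: (le_trans (ltW (truncnS_gt _))); rewrite ler_nat ltnS.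
  exact: leq_maxr.
have pos k : 0 < 2 ^- k :> R by rewrite invr_gt0 exprn_gt0.
have /choice[s Hs] : forall k, exists Npsi : nat * L1 m,
    [/\ (k <= Npsi.1)%N, F Npsi.2 & `|Cesaro h Npsi.1 - Npsi.2| < 2 ^- k].
  by move=> k; exact: near_F.
have sF : ((fun k => (s k).2) @ \oo) F by exists 0%N => // k _ /=; have [] := Hs k.
have [p [Fp clp]] := cF _ _ sF.
exists p => e K e0; have e20 : 0 < e / 2 by rewrite divr_gt0.
have [k0 k0e] := pow2_lt e20.
pose B := [set psi | exists k, (maxn K k0 <= k)%N /\ psi = (s k).2].
have [_ [[k [Kk ->]] pk]] : B `&` ball p (e / 2) !=set0.
  apply: clp; last exact: nbhsx_ballx.
  by exists (maxn K k0) => // k /= Kk; exists k.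
have [ks _ cs] := Hs k; exists (s k).1; split.
  by rewrite (leq_trans _ ks)// (leq_trans (leq_maxl _ _) Kk).
apply: (le_lt_trans (ler_distD (s k).2 _ _)); rewrite [ltRHS]splitr; apply: ltrD.
  apply: (lt_le_trans cs); apply: le_trans (ltW k0e).
  by rewrite lef_pV2 ?posrE ?exprn_gt0// ler_eXn2l ?ltr1n// (leq_trans (leq_maxr _ _) Kk).
by rewrite distrC; move: pk; rewrite -ball_normE.
Qed.

(** The cluster point inherits closed conditions: nonnegativity is tested by pairing with
    indicators, and invariance follows from almost invariance of the means. The last clause carries
    integrals of harmonic functions to the limit. *)
Lemma Cesaro_limit h : densities h -> exists p : L1 m,
  [/\ densities p, P p = p &
   forall w : X -> R, measurable_fun [set: X] w -> (forall x, `|w x| <= 1) ->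
     (forall n, L1_pairing w (iter n P h) = L1_pairing w h) ->
     L1_pairing w p = L1_pairing w h].
Proof.
move=> Dh; have [p Hp] := Cesaro_cluster Dh; exists p.
have small (x : R) : (forall e, 0 < e -> `|x| <= e) -> x = 0.
  move=> H; apply/eqP; rewrite -normr_eq0 eq_le normr_ge0 andbT.
  by apply/ler_addgt0Pl => e e0; rewrite addr0; exact: H.
split.
- split.
    apply: L1_nneg_integral => A mA.
    have m1A : measurable_fun [set: X] (\1_A : X -> R) by exact: measurable_indic.
    have A1 x : `|\1_A x| <= 1 :> R.
      by rewrite indicE; case: (x \in A); rewrite ?normr1// normr0 ler01.
    have AE (phi : L1 m) : (\int[m]_(x in A) (phi x)%:E = (L1_pairing \1_A phi)%:E)%E.
      transitivity (\int[m]_x (\1_A x * phi x)%:E)%E.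
        rewrite integral_mkcond; apply: eq_integral => x _.
        by rewrite /patch indicE; case: ifPn; rewrite ?mul1r ?mul0r.
      rewrite /L1_pairing /Rintegral fineK//; apply: integrable_fin_num => //.
      exact: L1_pairing_integrable.
    rewrite AE lee_fin; apply/ler_addgt0Pl => e e0.
    have [N [_ HN]] := Hp e 0%N e0.
    have := le_trans (L1_pairing_le m1A A1 (Cesaro h N - p)) (ltW HN).
    rewrite (L1_pairingB m1A A1) => /(le_trans (ler_norm _)).
    rewrite lerBlDr => /(le_trans _); apply.
    rewrite -lee_fin -AE; have [c0 _] := Cesaro_density N Dh.
    rewrite -(density_measureE c0 mA); exact: measure_ge0.
  apply/eqP; rewrite -subr_eq0; apply/eqP; apply: small => e e0.
  have [N [_ HN]] := Hp e 0%N e0; have [_ c1] := Cesaro_density N Dh.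
  by rewrite -c1 (le_trans (ler_dist_dist _ _))// distrC ltW.
- apply/eqP; rewrite -subr_eq0 -normr_eq0; apply/eqP; apply: small => e e0.
  rewrite normr_id; have e40 : 0 < e / 4 by rewrite divr_gt0.
  have [N [KN HN]] := Hp _ (Num.truncn (2 / (e / 4))) e40.
  have inv : `|P (Cesaro h N) - Cesaro h N| <= e / 4.
    rewrite (le_trans (Cesaro_almost_invariant N Dh))//.
    rewrite ler_pdivrMr// [leRHS]mulrC -ler_pdivrMr//.
    by rewrite (le_trans (ltW (truncnS_gt _)))// ler_nat ltnS.
  have : `|P p - P (Cesaro h N)| <= e / 4.
    by rewrite -(markovB _ _ markovP) (le_trans (markov_contract _ markovP))// distrC ltW.
  move=> Pp; rewrite (le_trans (ler_distD (P (Cesaro h N)) _ _))//.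
  apply: (le_trans (lerD Pp (ler_distD (Cesaro h N) _ _))).
  apply: (le_trans (lerD (lexx _) (lerD inv (ltW HN)))).
  lra.
- move=> w mw w1 wP; apply/eqP; rewrite -subr_eq0; apply/eqP; apply: small => e e0.
  have [N [_ HN]] := Hp e 0%N e0.
  have <- : L1_pairing w (Cesaro h N) = L1_pairing w h.
    rewrite /Cesaro (L1_pairingZ mw w1).
    have -> : L1_pairing w (\sum_(0 <= n < N.+1) iter n P h) = N.+1%:R * L1_pairing w h.
      elim: N.+1 => [|k IH].
        by rewrite big_geq// mul0r -(scale0r 0) (L1_pairingZ mw w1) mul0r.
      by rewrite big_nat_recr//= (L1_pairingD mw w1) IH wP -natr1 mulrDl mul1r.
    by rewrite mulrA mulVf// mul1r.
  rewrite distrC -(L1_pairingB mw w1).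
  exact: le_trans (L1_pairing_le mw w1 _) (ltW HN).
Qed.

End Cesaro.

Section prob_one.
Context d (X : measurableType d) (R : realType).
Implicit Types mu nu : probability X R.

Lemma prob1P mu A : measurable A -> (mu A = 1 <-> mu (~` A) = 0)%E.
Proof.
move=> mA; rewrite probability_setC//.
have Af : mu A \is a fin_num by exact: fin_num_measure.
split=> [->|]; first by rewrite subee.
by rewrite -(fineK Af) -EFinB => -[/eqP]; rewrite subr_eq0 => /eqP <-.
Qed.

Lemma prob1I mu A B : measurable A -> measurable B ->
  mu A = 1%E -> mu B = 1%E -> mu (A `&` B) = 1%E.
Proof.
move=> mA mB /(prob1P mu mA) A1 /(prob1P mu mB) B1.
apply/prob1P; first exact: measurableI.
rewrite setCI; apply: null_set_setU => //; exact: measurableC.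
Qed.

Lemma prob1_dominated mu nu A : nu `<< mu -> measurable A -> mu A = 1%E -> nu A = 1%E.
Proof.
move=> numu mA /(prob1P mu mA) A0; apply/prob1P => //.
by apply: (null_content_dominatesP nu mu).1 => //; exact: measurableC.
Qed.

Lemma prob1_ae mu (P : X -> Prop) : measurable (P : set X) ->
  {ae mu, forall x, P x} -> mu (P : set X) = 1%E.
Proof.
move=> mP aeP; apply/prob1P => //.
by apply/negligibleP; [exact: measurableC|exact: aeP].
Qed.

(** [c - u] is nonnegative almost everywhere with integral 0. *)
Lemma eq_mean_ae mu (u : X -> R) (c : R) : measurable_fun [set: X] u ->
  (forall x, 0 <= u x <= 1) -> (c%:E = \int[mu]_x (u x)%:E)%E ->
  {ae mu, forall x, u x <= c} -> {ae mu, forall x, u x = c}.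
Proof.
move=> mu' u01 cE uc.
have iu : mu.-integrable [set: X] (EFin \o u).
  apply: (@bounded_integrable _ _ _ mu _ 1) => // x.
  by have /andP[? ?] := u01 x; rewrite ger0_norm.
have ic : mu.-integrable [set: X] (EFin \o (cst c)).
  exact: finite_measure_integrable_cst.
have cI : (\int[mu]_x (c - u x)%:E = 0)%E.
  have := integralB_EFin measurableT ic iu; rewrite /= => ->.
  by rewrite -cE integral_cst//= probability_setT mule1 subee.
have mcu : measurable_fun [set: X] (fun x => (c - u x)%:E).
  by apply/measurable_EFinP; exact: measurable_funB.
have aI : (\int[mu]_(x in [set: X]) `|(c - u x)%:E| = 0)%E.
  rewrite -cI; apply: ae_eq_integral => //.
  - exact: measurableT_comp.
  - by apply: filterS uc => x ux _; rewrite gee0_abs// lee_fin subr_ge0.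
have := (ae_eq_integral_abs mu measurableT mcu).1 aI.
by apply: filterS => x /(_ I) [] /eqP; rewrite subr_eq0 => /eqP.
Qed.

End prob_one.

(** * Maximal families of stationary measures *)

Section ergodic_family.
Context dT (T : measurableType dT) dX (X : measurableType dX) (R : realType).
Variables (q : probability T R) (m : probability X R) (f : T * X -> X).
Hypothesis mf : measurable_fun [set: T * X] f.
Implicit Types (mu : nat -> probability X R) (S : nat -> set X).

(** Only the indices below [r] count. The carriers [S i] are part of the data and are disjoint as
    sets, not just up to null sets. *)
Definition disjoint_family r mu S :=
  (forall i, (i < r)%N -> [/\ stationary q f (mu i), mu i `<< m,
     measurable (S i) & mu i (S i) = 1%E]) /\
  (forall i j, (i < r)%N -> (j < r)%N -> i <> j -> S i `&` S j = set0).

Variables c rho : R.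
Hypotheses (c0 : 0 < c) (rho1 : rho < 1).
Hypothesis stationary_bound : forall nu : probability X R,
  stationary q f nu -> nu `<< m -> forall A, measurable A ->
  (nu A <= rho%:E + c%:E * m A)%E.

(** For a carrier the bound reads [1 <= rho + c m(S i)], so each has measure at least [delta]; being
    disjoint, they have total measure at most 1. *)
Lemma disjoint_family_bound r mu S : disjoint_family r mu S ->
  (r <= Num.truncn (c / (1 - rho)))%N.
Proof.
move=> [H dis]; pose delta := (1 - rho) / c.
have rho0 : 0 < 1 - rho by rewrite subr_gt0.
have d0 : 0 < delta by rewrite divr_gt0.
have mSd i : (i < r)%N -> (delta%:E <= m (S i))%E.
  move=> /H[smu mum mS S1].
  have := stationary_bound smu mum mS; rewrite S1.
  have mSf : m (S i) \is a fin_num by exact: fin_num_measure.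
  rewrite -(fineK mSf) -EFinM -EFinD !lee_fin => h.
  by rewrite /delta ler_pdivrMr// lerBlDl mulrC.
have key n : (n <= r)%N -> measurable (\big[setU/set0]_(i < n) S i) /\
    ((n%:R * delta)%:E <= m (\big[setU/set0]_(i < n) S i))%E.
  elim: n => [_|n IH nr]; first by rewrite big_ord0 mul0r measure0.
  have [mU Un] := IH (ltnW nr); have [_ _ mS _] := H n nr.
  rewrite big_ord_recr/=; split; first exact: measurableU.
  rewrite measureU//.
    by rewrite -natr1 mulrDl mul1r EFinD leeD// mSd.
  rewrite setIC big_distrr/= big1// => i _.
  apply: dis => //; first exact: ltn_trans (ltn_ord i) nr.
  by move=> e; have := ltn_ord i; rewrite -e ltnn.
have [mU /le_trans /(_ (probability_le1 m mU))] := key r (leqnn r).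
rewrite lee_fin /delta mulrA ler_pdivrMr// mul1r -ler_pdivlMr// => rle.
by rewrite truncn_ge_nat// divr_ge0// ltW.
Qed.

(** Maximal in number, not for inclusion: this excludes both adding a member and splitting one. *)
Definition maximal_family r mu S := disjoint_family r mu S /\
  forall mu' S', ~ disjoint_family r.+1 mu' S'.

Lemma maximal_family_exists : exists r mu S, maximal_family r mu S.
Proof.
pose p r := `[< exists mu S, disjoint_family r mu S >].
have p0 : exists r, p r.
  by exists 0%N; apply/asboolP; exists (fun=> m), (fun=> set0); split.
have pb r : p r -> (r <= Num.truncn (c / (1 - rho)))%N.
  by move=> /asboolP[mu [S]]; exact: disjoint_family_bound.
case: (ex_maxnP p0 pb) => r /asboolP[mu [S H]] max.
exists r, mu, S; split => // mu' S' H'.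
have /max : p r.+1 by apply/asboolP; exists mu', S'.
by rewrite ltnn.
Qed.

(** The new carrier [B] is removed from the old ones, which lose no mass. *)
Lemma family_extend r mu S (nu : probability X R) (B : set X) :
  disjoint_family r mu S -> stationary q f nu -> nu `<< m -> measurable B ->
  nu B = 1%E -> (forall i, (i < r)%N -> mu i (~` B) = 1%E) ->
  disjoint_family r.+1 (fun j => if j == r then nu else mu j)
    (fun j => if j == r then B else S j `&` ~` B).
Proof.
move=> [H dis] snu num mB B1 muB.
have lt i : (i < r.+1)%N -> i != r -> (i < r)%N by rewrite ltnS ltn_neqAle => ->; rewrite andbT.
split=> [i ir|i j ir jr ij].
  case: ifPn => [_|inr]; first by split.
  have [smu mum mS S1] := H i (lt i ir inr).
  have mBC : measurable (~` B) by exact: measurableC.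
  split => //; first exact: measurableI.
  by apply: prob1I => //; apply: muB; exact: lt.
case: ifPn => [/eqP ei|inr]; case: ifPn => [/eqP ej|jnr].
- by move: ij; rewrite ei ej.
- by rewrite setIA [B `&` _]setIC -setIA setICr setI0.
- by rewrite -setIA setICl setI0.
- by rewrite setIACA (dis _ _ (lt _ ir inr) (lt _ jr jnr) ij) set0I.
Qed.

(** [nu1] replaces [mu i] at its index, [nu2] takes the new index [r], and their carriers are
    disjoint parts of [S i]. *)
Lemma family_split r mu S i (nu1 nu2 : probability X R) (B1 B2 : set X) :
  disjoint_family r mu S -> (i < r)%N ->
  stationary q f nu1 -> stationary q f nu2 -> nu1 `<< mu i -> nu2 `<< mu i ->
  measurable B1 -> measurable B2 -> B1 `&` B2 = set0 ->
  nu1 B1 = 1%E -> nu2 B2 = 1%E ->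
  disjoint_family r.+1 (fun j => if j == r then nu2 else if j == i then nu1 else mu j)
    (fun j => if j == r then S i `&` B2 else if j == i then S i `&` B1 else S j).
Proof.
move=> [H dis] ir s1 s2 d1 d2 mB1 mB2 B12 n1 n2.
have lt j : (j < r.+1)%N -> j != r -> (j < r)%N by rewrite ltnS ltn_neqAle => ->; rewrite andbT.
have [smu mum mS S1] := H i ir.
split=> [j jr|j k jr kr jk].
  case: ifPn => [_|jnr].
    split => //; [exact: null_dominates_trans mum|exact: measurableI|].
    by apply: prob1I => //; exact: prob1_dominated S1.
  case: ifPn => [_|jni]; last exact: H (lt j jr jnr).
  split => //; [exact: null_dominates_trans mum|exact: measurableI|].
  by apply: prob1I => //; exact: prob1_dominated S1.
have disS A k' : (k' < r)%N -> k' != i -> (S i `&` A) `&` S k' = set0.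
  move=> k'r k'i; rewrite setIAC (dis _ _ ir k'r) ?set0I// => e.
  by move: k'i; rewrite e eqxx.
case: (eqVneq j r) => [ej|jnr]; case: (eqVneq k r) => [ek|knr].
- by move: jk; rewrite ej ek.
- case: (eqVneq k i) => [_|kni]; last by apply: disS => //; exact: lt.
  by rewrite setIACA [B2 `&` _]setIC B12 setI0.
- case: (eqVneq j i) => [_|jni]; first by rewrite setIACA B12 setI0.
  by rewrite setIC; apply: disS => //; exact: lt.
- case: (eqVneq j i) => [ej|jni]; case: (eqVneq k i) => [ek|kni].
  + by move: jk; rewrite ej ek.
  + by apply: disS => //; exact: lt.
  + by rewrite setIC; apply: disS => //; exact: lt.
  + exact: dis (lt _ jr jnr) (lt _ kr knr) jk.
Qed.

Lemma harmonic_constant r mu S i (u : X -> R) : maximal_family r mu S ->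
  (i < r)%N -> harmonic q f u -> {ae mu i, forall x, u x = fine (\int[mu i]_x (u x)%:E)}.
Proof.
move=> [fam max] ir hu; set a := fine _.
have [mu' u01 _] := hu; have [smu mum mS S1] := fam.1 i ir.
have iu : (mu i).-integrable [set: X] (EFin \o u).
  apply: (@bounded_integrable _ _ _ (mu i) _ 1) => // x.
  by have /andP[? ?] := u01 x; rewrite ger0_norm.
have aE : (a%:E = \int[mu i]_x (u x)%:E)%E by rewrite /a fineK//; exact: integrable_fin_num.
have hu' := harmonic_compl mf hu; have [mu'' u01' _] := hu'.
have ae_le (v : X -> R) (b : R) : measurable_fun [set: X] v ->
    mu i [set x | b < v x] = 0%E -> {ae mu i, forall x, v x <= b}.
  move=> mv h0; exists [set x | b < v x]; split => //; first exact: measurable_superlevel.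
  by move=> x /= /negP; rewrite -ltNge.
have [A0|An0] := eqVneq (mu i [set x | a < u x]) 0%E.
  by apply: eq_mean_ae => //; exact: ae_le.
have [B0|Bn0] := eqVneq (mu i [set x | 1 - a < 1 - u x]) 0%E.
  have bE : ((1 - a)%:E = \int[mu i]_x (1 - u x)%:E)%E.
    have i1 : (mu i).-integrable [set: X] (EFin \o (cst 1 : X -> R)).
      exact: finite_measure_integrable_cst.
    have := integralB_EFin measurableT i1 iu; rewrite /= => ->.
    by rewrite -aE integral_cst//= probability_setT mule1.
  apply: filterS (eq_mean_ae mu'' u01' bE (ae_le _ _ mu'' B0)) => x e.
  by rewrite -[u x](subKr 1) e subKr.
(* Otherwise [u] is above and below its mean with positive probability, and
   restricting [mu i] to these two sets splits it in two. *)
exfalso.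
have [nu1 [s1 d1 e1]] := restrict_stationary mf smu hu An0.
have [nu2 [s2 d2 e2]] := restrict_stationary mf smu hu' Bn0.
apply: max; apply: (family_split fam ir s1 s2 d1 d2 _ _ _ e1 e2).
- exact: measurable_superlevel.
- exact: measurable_superlevel.
- apply/seteqP; split => // x [/= h1 h2].
  by move: h2; rewrite ltrD2l ltrN2 => /(lt_trans h1); rewrite ltxx.
Qed.

Variable P : L1 m -> L1 m.
Hypothesis markovP : markov_operator P.
Hypothesis aP : induces (annealed_transition q f) P.
Hypothesis ucP : uniformly_constrictive P.

(** The Cesaro means start from the constant density 1. As [v] is harmonic, its pairing with [P^n 1]
    does not depend on [n]. *)
Lemma stationary_exists (v : X -> R) : harmonic q f v ->
  exists nu : probability X R, [/\ stationary q f nu, nu `<< m &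
    (\int[nu]_x (v x)%:E = \int[m]_x (v x)%:E)%E].
Proof.
move=> [mv v01 hv].
have v1 x : `|v x| <= 1 by have /andP[? ?] := v01 x; rewrite ger0_norm.
have v0 x : (0 <= (v x)%:E)%E by rewrite lee_fin; case/andP: (v01 x).
have mvE : measurable_fun [set: X] (fun x => (v x)%:E) by exact/measurable_EFinP.
have i1 : m.-integrable [set: X] (EFin \o (cst 1 : X -> R)).
  exact: finite_measure_integrable_cst.
have D1 : densities (mkL1 i1).
  have n1 : L1_nneg (mkL1 i1) by apply: filterS (mkL1E i1) => x ->.
  split => //; apply: EFin_inj; rewrite L1_nnegE//.
  transitivity (\int[m]_x cst 1%E x)%E; last first.
    by rewrite integral_cst//= probability_setT mule1.
  apply: ae_eq_integral => //.
  - exact/measurable_EFinP/L1_measurable.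
  - by apply: filterS (mkL1E i1) => x ->.
have pairE (h : L1 m) : ((L1_pairing v h)%:E = \int[m]_x ((h x)%:E * (v x)%:E))%E.
  rewrite /L1_pairing /Rintegral fineK; last first.
    by apply: integrable_fin_num => //; exact: L1_pairing_integrable.
  by apply: eq_integral => x _; rewrite EFinM muleC.
have pairP h : L1_nneg h -> L1_pairing v (P h) = L1_pairing v h.
  move=> h0; apply: EFin_inj; rewrite !pairE.
  rewrite (annealed_duality mf markovP aP h0 v0 mvE).
  by apply: eq_integral => x _; rewrite hv.
have pairPn n : L1_pairing v (iter n P (mkL1 i1)) = L1_pairing v (mkL1 i1).
  elim: n => // n IH; rewrite iterS pairP//.
  by have [] := densities_iter markovP n D1.
have [p [[p0 p1] Pp /(_ v mv v1 pairPn) vp]] := Cesaro_limit markovP ucP D1.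
have nuE := density_probabilityE p0 p1.
exists (density_probability p0 p1); split.
- exact/(invariant_density_stationary mf aP p0 nuE).
- exact: density_probability_dominates.
rewrite (integral_dominated_density p0 nuE v0 mvE) -pairE vp pairE.
apply: ae_eq_integral => //.
- by apply: emeasurable_funM => //; exact/measurable_EFinP/L1_measurable.
- by apply: filterS (mkL1E i1) => x ->; rewrite mul1e.
Qed.

(** If [B = {u < 1}] had positive measure, the harmonic function [1 - u] would yield a stationary
    measure charging [B]. Its restriction to [B] is stationary as well and enlarges the family,
    since no member charges [B]. *)
Lemma maximal_family_absorbs r mu S (u : X -> R) : maximal_family r mu S ->
  harmonic q f u -> (forall i, (i < r)%N -> {ae mu i, forall x, u x = 1}) ->
  {ae m, forall x, u x = 1}.
Proof.
move=> [fam max] hu ui.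
have hv := harmonic_compl mf hu; have [mv v01 _] := hv.
have [mu' u01 _] := hu.
pose B := [set x | 0 < 1 - u x].
have mB : measurable B by exact: measurable_superlevel.
have mvE : measurable_fun [set: X] (fun x => (1 - u x)%:E) by exact/measurable_EFinP.
have v0 x : 0 <= 1 - u x by case/andP: (v01 x).
have nuB0 (nu : probability X R) : nu B = 0%E <-> (\int[nu]_x (1 - u x)%:E = 0)%E.
  split=> [B0|I0].
    rewrite (ae_eq_integral (cst 0%E))// ?integral0//.
    exists B; split => // x /= /not_implyP[_] ne.
    by rewrite /B/= lt_neqAle v0 andbT; apply/eqP => e; apply: ne; rewrite -e.
  have /(ae_eq_integral_abs nu measurableT mvE) aev :
      (\int[nu]_(x in [set: X]) `|(1 - u x)%:E| = 0)%E.
    by under eq_integral do rewrite gee0_abs ?lee_fin//.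
  apply/(negligibleP nu mB); apply: negligibleS aev => x /= Bx e.
  by have [e0] := e I; move: Bx; rewrite /B/= e0 ltxx.
suff mB0 : m B = 0%E.
  exists B; split => // x /= ux; rewrite /B/= lt_neqAle v0 andbT.
  by apply/eqP => /esym/eqP; rewrite subr_eq0 => /eqP /esym.
apply/eqP/negPn/negP => mBn0.
have [nu [snu num nuv]] := stationary_exists hv.
have nuBn0 : (nu B != 0)%E.
  apply/eqP => /nuB0; rewrite nuv => /nuB0 /eqP; exact/negP.
have [nu' [snu' nu'nu nu'B]] := restrict_stationary mf snu hv nuBn0.
apply: max; apply: (family_extend fam snu' (null_dominates_trans nu'nu num) mB nu'B).
move=> i ir; apply: prob1_ae; first exact: measurableC.
by apply: filterS (ui i ir) => x ux; rewrite /B /= ux subrr ltxx.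
Qed.

End ergodic_family.

(** * Birkhoff's ergodic theorem *)

Section Birkhoff.
Context d (S : measurableType d) (R : realType) (nu : probability S R) (F : S -> S).
Hypothesis erg : ergodic nu F.

Let mF : measurable_fun [set: S] F. Proof. by case: erg. Qed.

Lemma ergodic_integral (g : S -> R) : measurable_fun [set: S] g ->
  (forall z, 0 <= g z) -> (\int[nu]_z (g (F z))%:E = \int[nu]_z (g z)%:E)%E.
Proof.
move=> mg g0; have [_ inv _] := erg.
have mgE : measurable_fun [set: S] (EFin \o g) by exact/measurable_EFinP.
have := ge0_integral_pushforward mF nu measurableT mgE (fun z _ => g0 z).
rewrite preimage_setT => <-; apply: eq_measure_integral => A mA _.
exact: inv.
Qed.

Section maximal_inequality.
Variables (h : S -> R) (K : R).
Hypotheses (mh : measurable_fun [set: S] h) (hK : forall z, `|h z| <= K).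

(** The maximum of the Birkhoff sums of [h] at [z] with 0 to [n] terms; the recursion splits off the
    first term. *)
Fixpoint maxsum n z : R := if n is n'.+1 then Num.max 0 (h z + maxsum n' (F z)) else 0.

Lemma maxsum_ge0 n z : 0 <= maxsum n z.
Proof. by case: n => //= n; rewrite le_max lexx. Qed.

Lemma maxsumS n z : maxsum n z <= maxsum n.+1 z.
Proof.
elim: n z => [|n IH] z; first exact: maxsum_ge0.
by rewrite [leRHS]/= [leLHS]/= ge_max !le_max lexx/= lerD2l IH orbT.
Qed.

Lemma maxsum_mono n k z : (n <= k)%N -> maxsum n z <= maxsum k z.
Proof.
by move=> /subnKC <-; elim: (k - n)%N => [|j IH]; rewrite ?addn0// addnS (le_trans IH)// maxsumS.
Qed.

Lemma maxsum_le n z : maxsum n z <= n%:R * K.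
Proof.
have K0 : 0 <= K := le_trans (normr_ge0 _) (hK z).
elim: n z => [|n IH] z; first by rewrite mul0r.
rewrite /= ge_max mulr_ge0//= -natr1 mulrDl mul1r addrC lerD//.
exact: le_trans (ler_norm _) (hK z).
Qed.

Lemma measurable_maxsum n : measurable_fun [set: S] (maxsum n).
Proof.
elim: n => [|n IH] //=.
apply: measurable_maxr => //; apply: measurable_funD => //.
exact: measurableT_comp IH mF.
Qed.

Lemma sum_le_maxsum n z : \sum_(j < n) h (iter j F z) <= maxsum n z.
Proof.
elim: n z => [|n IH] z; first by rewrite big_ord0.
rewrite big_ord_recl /= le_max; apply/orP; right; rewrite lerD2l.
apply: le_trans (IH (F z)); rewrite le_eqVlt; apply/orP; left; apply/eqP.
by apply: eq_bigr => j _; rewrite -iterSr.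
Qed.

(* Garsia's proof of the maximal ergodic theorem. *)
Lemma maxsum_telescope n z :
  maxsum n z - maxsum n (F z) - K * \1_[set z | maxsum n z <= 0] z <= h z.
Proof.
have K0 : 0 <= K := le_trans (normr_ge0 _) (hK z).
rewrite indicE; have [M0|M0] := boolP (z \in _).
  rewrite mulr1; move: M0; rewrite inE/= => M0.
  have -> : maxsum n z = 0 by apply/eqP; rewrite eq_le M0 maxsum_ge0.
  rewrite sub0r -opprD lerNl (le_trans (_ : _ <= K))//.
    by rewrite (le_trans _ (hK z))// -normrN ler_norm.
  by rewrite lerDr maxsum_ge0.
rewrite mulr0 subr0; move: M0; rewrite notin_setE/= => /negP; rewrite -ltNge.
case: n => [|n] M0; first by move: M0; rewrite /= ltxx.
have hM : 0 < h z + maxsum n (F z) by move: M0; rewrite /= lt_max ltxx.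
have -> : maxsum n.+1 z = h z + maxsum n (F z) by rewrite /= max_r// ltW.
by rewrite -addrA gerDl subr_le0; exact: maxsumS.
Qed.

(** On integrating [maxsum_telescope], the first two terms cancel because [F] preserves [nu]. *)
Lemma maximal_ergodic n :
  - (K * fine (nu [set z | maxsum n z <= 0])) <= \int[nu]_z h z.
Proof.
set Z := [set z | maxsum n z <= 0].
have mM := measurable_maxsum n.
have mZ : measurable Z.
  rewrite (_ : Z = ~` [set z | 0 < maxsum n z]).
    exact/measurableC/measurable_superlevel.
  by apply/seteqP; split => z /=; rewrite /Z/= leNgt => /negP.
have iM : nu.-integrable [set: S] (EFin \o maxsum n).
  apply: (@bounded_integrable _ _ _ nu _ (n%:R * K)) => // z.
  by rewrite ger0_norm ?maxsum_ge0 ?maxsum_le.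
have iMF : nu.-integrable [set: S] (EFin \o (fun z => maxsum n (F z))).
  apply: (@bounded_integrable _ _ _ nu _ (n%:R * K)).
    exact: measurableT_comp mM mF.
  by move=> z; rewrite ger0_norm ?maxsum_ge0 ?maxsum_le.
have iZ : nu.-integrable [set: S] (EFin \o (fun z => K * \1_Z z)).
  apply: (@bounded_integrable _ _ _ nu _ K).
    by apply: measurable_funM => //; exact: measurable_indic.
  move=> z; have K0 : 0 <= K := le_trans (normr_ge0 _) (hK z).
  by rewrite indicE ger0_norm; case: (z \in Z); rewrite ?mulr1 ?mulr0.
have ih : nu.-integrable [set: S] (EFin \o h) by exact: bounded_integrable hK.
have iD : nu.-integrable [set: S] (EFin \o (fun z => maxsum n z - maxsum n (F z))).
  exact: (integrableB measurableT iM iMF).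
have iDZ : nu.-integrable [set: S]
    (EFin \o (fun z => maxsum n z - maxsum n (F z) - K * \1_Z z)).
  exact: (integrableB measurableT iD iZ).
have := le_Rintegral measurableT iDZ ih (fun z _ => maxsum_telescope n z).
rewrite RintegralB// RintegralB//.
have -> : \int[nu]_z maxsum n (F z) = \int[nu]_z maxsum n z.
  by rewrite /Rintegral ergodic_integral//; exact: maxsum_ge0.
rewrite subrr sub0r RintegralZl//; last exact: integrable_indic.
by rewrite /Rintegral integral_indic// setIT.
Qed.

(* The set where [maxsum] is unbounded is exactly, not only a.e., invariant;
   were it of full measure, letting n tend to infinity in [maximal_ergodic]
   would give a nonnegative integral. *)
Lemma maxsum_bounded : \int[nu]_z h z < 0 ->
  {ae nu, forall z, exists C : nat, forall n, maxsum n z <= C%:R}.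
Proof.
move=> hneg; pose E := [set z | forall C : nat, exists n, C%:R < maxsum n z].
have mE : measurable E.
  rewrite (_ : E = \bigcap_C \bigcup_n [set z | C%:R < maxsum n z]).
    apply: bigcap_measurable => // C _; apply: bigcup_measurable => n _.
    exact: measurable_superlevel (measurable_maxsum n).
  apply/seteqP; split => z /= Ez C; first by move=> _; have [n ?] := Ez C; exists n.
  by have [n _ ?] := Ez C I; exists n.
have invE : F @^-1` E = E.
  apply/seteqP; split => z /= Ez C.
    (* [maxsum n.+1 z] is [h z + maxsum n (F z)] truncated at 0, so unboundedness passes both ways;
       the integer above [|h z|] absorbs the extra term. *)
    have [n Hn] := Ez (C + Num.truncn `|h z|).+1.
    exists n.+1; rewrite /= lt_max; apply/orP; right.
    rewrite -ltrBlDl; apply: le_lt_trans Hn; rewrite -addnS natrD lerD2l.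
    by rewrite (le_trans _ (ltW (truncnS_gt _)))// -normrN ler_norm.
  have [[|n] Hn] := Ez (C + Num.truncn `|h z|).+1.
    by move: Hn; rewrite /= ltrn0.
  exists n; move: Hn; rewrite /= lt_max ltrn0/= -ltrBlDl; apply: le_lt_trans.
  rewrite -addnS natrD -addrA lerDl subr_ge0.
  by rewrite (le_trans (ler_norm _))// ltW// truncnS_gt.
have [_ _ /(_ E mE invE)[E0|E1]] := erg.
  exists E; split => // z /= nz C; apply: contrapT => H; apply: nz.
  by exists C => n; rewrite leNgt; apply/negP => Cn; apply: H; exists n.
exfalso; move: hneg; apply/negP; rewrite -leNgt.
(* Every point of [E] eventually leaves [Z n], so the error term of [maximal_ergodic] tends to 0. *)
pose Z n := [set z | maxsum n z <= 0].
have mZ n : measurable (Z n).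
  rewrite (_ : Z n = ~` [set z | 0 < maxsum n z]).
    exact/measurableC/measurable_superlevel/measurable_maxsum.
  by apply/seteqP; split => z /=; rewrite /Z/= leNgt => /negP.
have mIZ : measurable (\bigcap_n Z n) by apply: bigcap_measurable.
have IZ0 : nu (\bigcap_n Z n) = 0%E.
  apply/eqP; rewrite eq_le measure_ge0 andbT.
  have /(prob1P nu mE) <- := E1.
  apply: le_measure; rewrite ?inE//; first exact: measurableC.
  move=> z Hz Ez; have [n] := Ez 0%N; have := Hz n I; rewrite /Z /=.
  by rewrite leNgt => /negP.
have cZ : (nu \o Z) @ \oo --> 0%E.
  rewrite -IZ0; apply: nonincreasing_cvg_mu => //.
    by rewrite (le_lt_trans (probability_le1 nu (mZ 0%N)))// ltry.
  move=> a b ab; apply/subsetPset => z; rewrite /Z/=; apply: le_trans.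
  exact: maxsum_mono.
(* This takes a point of [S], which [E], of measure 1, provides. *)
have K0 : 0 <= K.
  have [E0|/set0P[z _]] := eqVneq E set0; last exact: le_trans (normr_ge0 _) (hK z).
  by move: E1; rewrite E0 measure0 => /eqP; rewrite eq_sym onee_eq0.
rewrite -(opprK (\int[nu]_z h z)) oppr_ge0; apply/ler_addgt0Pl => e e0; rewrite addr0.
have K1 : 0 < K + 1 by rewrite ltr_wpDl.
have [N /(_ N (leqnn N)) HN] := cvge0_lt cZ (divr_gt0 e0 K1).
have := maximal_ergodic N; rewrite lerNl => /le_trans; apply.
have Zf : nu (Z N) \is a fin_num by exact: fin_num_measure.
rewrite /= -(fineK Zf) lte_fin in HN.
apply: (@le_trans _ _ ((K + 1) * fine (nu (Z N)))).
  by apply: ler_wpM2r; rewrite ?fine_ge0 ?measure_ge0 ?lerDl.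
by rewrite mulrC -ler_pdivlMr// ltW.
Qed.

End maximal_inequality.

(** [maxsum_bounded] applies to [g - a], whose integral is negative, and bounds its Birkhoff sums
    from above. *)
Lemma Birkhoff_upper (g : S -> R) (M a : R) : measurable_fun [set: S] g ->
  (forall z, `|g z| <= M) -> \int[nu]_z g z < a ->
  {ae nu, forall z, exists C : nat, forall n,
    \sum_(j < n) g (iter j F z) <= n%:R * a + C%:R}.
Proof.
move=> mg gM ga.
have ig : nu.-integrable [set: S] (EFin \o g) by exact: bounded_integrable gM.
have ia : nu.-integrable [set: S] (EFin \o (cst a)) by exact: finite_measure_integrable_cst.
have mh : measurable_fun [set: S] (fun z => g z - a) by exact: measurable_funB.
have hK z : `|g z - a| <= M + `|a| by rewrite (le_trans (ler_normB _ _))// lerD2r.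
have hneg : \int[nu]_z (g z - a) < 0.
  rewrite RintegralB// Rintegral_cst//= [X in fine X]probability_setT mulr1.
  by rewrite subr_lt0.
apply: filterS (maxsum_bounded mh hK hneg) => z [C HC]; exists C => n.
have := le_trans (sum_le_maxsum (fun z => g z - a) n z) (HC n).
rewrite sumrB sumr_const card_ord lerBlDr => /le_trans; apply.
by rewrite addrC mulr_natl.
Qed.

(** [Birkhoff_upper] is used for [g] and [- g] at the countably many levels [1 / (k + 1)] above the
    mean; the constants [C] vanish after division by [n]. *)
Lemma Birkhoff (g : S -> R) (M : R) : measurable_fun [set: S] g ->
  (forall z, `|g z| <= M) ->
  {ae nu, forall z, (fun n => n%:R^-1 * \sum_(j < n) g (iter j F z)) @ \oo -->
    \int[nu]_z g z}.
Proof.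
move=> mg gM; set I := \int[nu]_z g z.
have ig : nu.-integrable [set: S] (EFin \o g) by exact: bounded_integrable gM.
have mg' : measurable_fun [set: S] (fun z => - g z) by exact: measurableT_comp.
have gM' z : `|- g z| <= M by rewrite normrN.
have IN : \int[nu]_z - g z = - I.
  under eq_Rintegral do rewrite -mulN1r.
  by rewrite RintegralZl// mulN1r.
have up k : {ae nu, forall z, exists C : nat, forall n,
    \sum_(j < n) g (iter j F z) <= n%:R * (I + k.+1%:R^-1) + C%:R}.
  by apply: (Birkhoff_upper mg gM); rewrite ltrDl invr_gt0.
have low k : {ae nu, forall z, exists C : nat, forall n,
    \sum_(j < n) - g (iter j F z) <= n%:R * (- I + k.+1%:R^-1) + C%:R}.
  by apply: (Birkhoff_upper mg' gM'); rewrite IN ltrDl invr_gt0.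
apply: filterS2 (ae_foralln up) (ae_foralln low) => z Hup Hlow.
apply/cvgrPdist_le => e e0.
pose k := Num.truncn (2 / e).
have ke : k.+1%:R^-1 <= e / 2.
  rewrite -[leRHS]invrK lef_pV2 ?posrE ?invr_gt0 ?divr_gt0// invf_div.
  exact/ltW/truncnS_gt.
have [C1 H1] := Hup k; have [C2 H2] := Hlow k.
pose C := maxn C1 C2.
exists (Num.truncn (C%:R / (e / 2))).+1 => // n /= nC.
have n0 : 0 < n%:R :> R by rewrite ltr0n (leq_trans _ nC).
have Cn : C%:R / n%:R <= e / 2.
  rewrite ler_pdivrMr// mulrC -ler_pdivrMr ?divr_gt0//.
  by rewrite (le_trans (ltW (truncnS_gt _)))// ler_nat.
have C1n : n%:R^-1 * C1%:R <= e / 2.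
  by rewrite mulrC (le_trans _ Cn)// ler_pM2r ?invr_gt0// ler_nat leq_maxl.
have C2n : n%:R^-1 * C2%:R <= e / 2.
  by rewrite mulrC (le_trans _ Cn)// ler_pM2r ?invr_gt0// ler_nat leq_maxr.
have scale (x a b : R) : x <= n%:R * a + b -> n%:R^-1 * x <= a + n%:R^-1 * b.
  by move=> xab; rewrite ler_pdivrMl// mulrDr mulrA divff ?gt_eqF// mul1r.
have := scale _ _ _ (H1 n); have := scale _ _ _ (H2 n).
rewrite sumrN mulrN; set A := n%:R^-1 * \sum_(j < n) _ => l1 l2.
move: ke C1n C2n l1 l2; move: (k.+1%:R^-1) (n%:R^-1 * C1%:R) (n%:R^-1 * C2%:R).
by move=> x y z' *; rewrite ler_distl; apply/andP; split; lra.
Qed.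

End Birkhoff.

(** * Ergodicity of the skew product *)

Section sequence_space.
Context dT (T : measurableType dT) (R : realType).
Local Notation W := (sequence_space T).

Lemma measurable_coordinate n : measurable_fun [set: W] (fun w : W => (w : nat -> T) n).
Proof. by move=> _ B mB; rewrite setTI; apply: sub_sigma_algebra; exists n, B. Qed.

Lemma measurable_sequence d (S : measurableType d) (g : S -> W) :
  (forall n, measurable_fun [set: S] (fun s => (g s : nat -> T) n)) ->
  measurable_fun [set: S] g.
Proof.
move=> mg; apply: (@measurability _ _ S W setT g (@cylinders _ T) erefl).
by move=> _ [_ [n [A [mA ->]]] <-]; exact: mg.
Qed.

Definition shift (w : W) : W := fun n => w n.+1.

Definition cons_seq (z : T * W) : W := fun n => if n is n'.+1 then z.2 n' else z.1.

Lemma measurable_shift : measurable_fun [set: W] shift.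
Proof. by apply: measurable_sequence => n; exact: measurable_coordinate. Qed.

Lemma measurable_cons_seq : measurable_fun [set: T * W] cons_seq.
Proof.
apply: measurable_sequence => -[|n] /=; first exact: measurable_fst.
exact: measurableT_comp (measurable_coordinate n) measurable_snd.
Qed.

Definition box n (A : nat -> set T) : set W :=
  [set w | forall i, (i < n)%N -> A i (w i)].

Lemma measurable_box n A : (forall i, measurable (A i)) -> measurable (box n A).
Proof.
move=> mA; rewrite (_ : box n A = \bigcap_i [set w | (i < n)%N -> A i (w i)]).
  apply: bigcap_measurable => // i _; case: (ltnP i n) => [lt_in|le_ni].
    rewrite (_ : [set _ | _] = (fun w : W => (w : nat -> T) i) @^-1` A i).
      by rewrite -[X in measurable X]setTI; exact: measurable_coordinate.
    by apply/seteqP; split => w /=; [apply|move=> ? _].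
  by rewrite (_ : [set _ | _] = setT)//; apply/seteqP; split.
by apply/seteqP; split => w /= H i //; [move=> _; exact: H|exact: (H i I)].
Qed.

Lemma boxS n A : box n.+1 A =
  [set w | A 0%N (w 0%N) /\ box n (fun i => A i.+1) (shift w)].
Proof.
apply/seteqP; split => w /=; first by move=> H; split=> [|i ?]; exact: H.
by move=> [A0 H] [|i] //; rewrite ltnS; exact: H.
Qed.

(** Boxes are stable under intersection and generate the product sigma-algebra. *)
Lemma box_measure_unique (M1 M2 : {measure set W -> \bar R}) : (M1 setT < +oo)%E ->
  (forall n A, (forall i, measurable (A i)) -> M1 (box n A) = M2 (box n A)) ->
  forall E, measurable E -> M1 E = M2 E.
Proof.
move=> fin H.
pose G : set (set W) := [set E | exists n A, (forall i, measurable (A i)) /\ E = box n A].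
apply: (measure_unique G (fun=> setT)) => //.
- apply/seteqP; split; apply: smallest_sub.
  + exact: smallest_sigma_algebra.
  + move=> _ [n [A [mA ->]]]; apply: sub_sigma_algebra.
    (* A cylinder over coordinate [n] is a box of length [n + 1] with full sides before [n]. *)
    exists n.+1, (fun i => if i == n then A else setT); split=> [i|]; first by case: eqP.
    apply/seteqP; split => w /=; last by move=> /(_ n (leqnn _)); rewrite eqxx.
    by move=> ? i _; case: eqP => // ->.
  + exact: sigma_algebra_measurable.
  + by move=> _ [n [A [mA ->]]]; exact: measurable_box.
- move=> _ _ [n [A [mA ->]]] [k [B [mB ->]]].
  exists (maxn n k), (fun i => (if (i < n)%N then A i else setT) `&`
    (if (i < k)%N then B i else setT)); split.
    by move=> i; apply: measurableI; case: ifP.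
  apply/seteqP; split => w /=.
    by move=> [HA HB] i _; split; case: ifP => // /[dup] lt; [move=> _; exact: HA|move=> _; exact: HB].
  move=> HAB; split=> i lt.
    by have [] := HAB i (leq_trans lt (leq_maxl _ _)); rewrite lt.
  by have [] := HAB i (leq_trans lt (leq_maxr _ _)); rewrite lt.
- move=> _; exists 0%N, (fun=> setT); split => //; apply/seteqP; split => //.
- by rewrite bigcup_const.
- by move=> _ [n [A [mA ->]]]; exact: H.
Qed.

Variables (q : probability T R) (Q : probability W R).
Hypothesis prodQ : is_product_probability q Q.

(** [Q] is the image of [q \x Q] under [cons_seq], as is seen on boxes: the first coordinate is
    independent of the shifted sequence. *)
Lemma product_cons E : measurable E ->
  (Q E = \int[q]_t Q [set w | E (cons_seq (t, w))])%E.
Proof.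
pose C : {mfun (T * W)%type >-> W} :=
  HB.pack cons_seq (isMeasurableFun.Build _ _ _ _ _ measurable_cons_seq).
pose nu := distribution (q \x Q)%E C.
have nuE B : nu B = (\int[q]_t Q [set w | B (cons_seq (t, w))])%E.
  rewrite /nu /distribution /pushforward /product_measure1.
  apply: eq_integral => t _ /=; congr (Q _).
  by apply/seteqP; split => w; rewrite /xsection /= inE.
move=> mE; rewrite -nuE; apply: box_measure_unique mE.
  by rewrite (le_lt_trans (probability_le1 _ _))// ltry.
case=> [|n] A mA.
  have -> : box 0 A = setT by apply/seteqP; split.
  by apply: (etrans (probability_setT Q)); apply/esym; exact: probability_setT.
rewrite [LHS]prodQ// big_ord_recl; apply: (etrans _ (esym (nuE _))).
have mbox := measurable_box n (fun i => mA i.+1).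
transitivity (\int[q]_(t in A 0%N) (cst (Q (box n (fun i => A i.+1))) t))%E.
  by rewrite integral_cst// muleC; congr (_ * _)%E; apply/esym; exact: prodQ.
rewrite integral_mkcond; apply: eq_integral => t _; rewrite patchE boxS /=.
case: (boolP (t \in A 0%N)) => [|/negP]; rewrite inE => At.
  by congr (Q _); apply/seteqP; split => w //=; case.
by rewrite -[LHS](measure0 Q); congr (Q _); apply/seteqP; split => w //= -[].
Qed.

End sequence_space.

Section skew_product.
Context dT (T : measurableType dT) dX (X : measurableType dX) (R : realType).
Variables (q : probability T R) (Q : probability (sequence_space T) R) (f : T * X -> X).
Hypothesis mf : measurable_fun [set: T * X] f.
Hypothesis prodQ : is_product_probability q Q.
Local Notation W := (sequence_space T).
Local Notation F := (skew_product f).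

Lemma measurable_skew_product : measurable_fun [set: W * X] F.
Proof.
apply: measurable_fun_pair.
  exact: (measurableT_comp (@measurable_shift _ T) measurable_fst).
apply: (measurableT_comp mf); apply: measurable_fun_pair => //.
exact: (measurableT_comp (measurable_coordinate 0) measurable_fst).
Qed.

Lemma measurable_skew_preimage A : measurable A -> measurable (F @^-1` A).
Proof. by move=> mA; rewrite -[X in measurable X]setTI; exact: measurable_skew_product. Qed.

Lemma measurable_slice_set (A : set (W * X)) x : measurable A -> measurable [set w | A (w, x)].
Proof.
move=> /(measurable_ysection x); congr measurable.
by apply/seteqP; split => w; rewrite /ysection/= inE.
Qed.

Definition slice (A : set (W * X)) (x : X) : \bar R := Q [set w | A (w, x)].

Lemma slice_fin_num A x : measurable A -> slice A x \is a fin_num.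
Proof. by move=> mA; apply: fin_num_measure; exact: measurable_slice_set. Qed.

Lemma slice_ge0 A x : (0 <= slice A x)%E.
Proof. exact: measure_ge0. Qed.

Lemma sliceE A x : slice A x = Q (ysection A x).
Proof. by congr (Q _); apply/seteqP; split => w; rewrite /ysection/= inE. Qed.

Lemma measurable_slice A : measurable A -> measurable_fun [set: X] (slice A).
Proof.
move=> mA; rewrite (_ : slice A = Q \o ysection A); last exact/funext/sliceE.
exact: measurable_fun_ysection.
Qed.

Lemma integral_slice (mu : probability X R) A : measurable A ->
  ((Q \x mu) A = \int[mu]_x slice A x)%E.
Proof.
(* The product measure is defined through sections at fixed [w]; uniqueness on rectangles gives
   access to those at fixed [x]. *)
move=> mA; rewrite (@product_measure_unique _ _ _ _ _ Q mu (Q \x^ mu)%E)//.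
  by apply: eq_integral => x _ /=; rewrite sliceE.
by move=> B C mB mC; exact: product_measure2E.
Qed.

(** On [cons_seq (t, w)] the skew product forgets [t] and moves [x] to [f (t, x)]. *)
Lemma slice_cons (A : set (W * X)) (C : set T) x : measurable A -> measurable C ->
  (Q [set w | C ((w : nat -> T) 0%N) /\ A (F (w, x))] = \int[q]_(t in C) slice A (f (t, x)))%E.
Proof.
move=> mA mC; rewrite (product_cons prodQ); last first.
  apply: measurableI; last exact: measurable_slice_set (measurable_skew_preimage mA).
  by rewrite -[X in measurable X]setTI; exact: measurable_coordinate.
rewrite [RHS]integral_mkcond; apply: eq_integral => t _; rewrite patchE.
case: (boolP (t \in C)) => [|/negP]; rewrite inE => Ct.
  by congr (Q _); apply/seteqP; split => w //=; case.
by rewrite -[RHS](measure0 Q); congr (Q _); apply/seteqP; split => w //= -[].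
Qed.

Lemma slice_preimage A x : measurable A ->
  (slice (F @^-1` A) x = \int[q]_t slice A (f (t, x)))%E.
Proof.
move=> mA; rewrite -(slice_cons x mA measurableT); congr (Q _).
by apply/seteqP; split => w //= [].
Qed.

Lemma skew_product_preserves (mu : probability X R) A : stationary q f mu ->
  measurable A -> ((Q \x mu) (F @^-1` A) = (Q \x mu) A)%E.
Proof.
move=> smu mA; rewrite !integral_slice//; last exact: measurable_skew_preimage.
rewrite [RHS](stationary_integral mf smu (@slice_ge0 A) (measurable_slice mA)).
by apply: eq_integral => x _; exact: slice_preimage.
Qed.

Lemma invariant_harmonic A : measurable A -> F @^-1` A = A ->
  harmonic q f (fun x => fine (slice A x)).
Proof.
move=> mA invA; split.
- by apply: measurableT_comp => //; exact: measurable_slice.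
- move=> x; rewrite fine_ge0 ?slice_ge0//= -lee_fin fineK ?slice_fin_num//.
  by apply: probability_le1; exact: measurable_slice_set.
- move=> x; rewrite fineK ?slice_fin_num// -[in LHS]invA slice_preimage//.
  by apply: eq_integral => t _; rewrite fineK ?slice_fin_num.
Qed.

(** One random step preserves [mu], so almost surely it does not enter a null set. *)
Lemma stationary_ae (mu : probability X R) (N : set X) : stationary q f mu ->
  mu.-negligible N -> {ae mu, forall x, {ae q, forall t, ~ N (f (t, x))}}.
Proof.
move=> smu [M [mM M0 NM]].
have I0 : (\int[mu]_x `|annealed q mf x M| = 0)%E.
  rewrite -M0 ((stationaryP q mf mu).1 smu M mM).
  by apply: eq_integral => x _; rewrite gee0_abs.
have := (ae_eq_integral_abs mu measurableT (measurable_annealed q mf mM)).1 I0.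
apply: filterS => x /(_ I) aM; exists [set t | M (f (t, x))]; split => //.
  by rewrite -[X in measurable X]setTI; exact: (measurable_section mf x).
by move=> t /= /contrapT; exact: NM.
Qed.

(** For almost every [x], the section of [A] is independent of boxes. By invariance one reads the
    first coordinate [t] and moves to [f (t, x)], where the induction hypothesis holds for almost
    every [t] by [stationary_ae]. *)
Lemma invariant_box (mu : probability X R) (A : set (W * X)) (c : R) : stationary q f mu ->
  measurable A -> F @^-1` A = A -> {ae mu, forall x, slice A x = c%:E} ->
  forall n B, (forall i, measurable (B i)) ->
    {ae mu, forall x, (Q [set w | box n B w /\ A (w, x)] = c%:E * Q (box n B))%E}.
Proof.
move=> smu mA invA sliceA; elim=> [|n IH] B mB.
  apply: filterS sliceA => x <-; have -> : box 0 B = setT by apply/seteqP; split.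
  rewrite [Q setT]probability_setT mule1.
  by congr (Q _); apply/seteqP; split => w //= [].
pose B' i := B i.+1; have mB' i : measurable (B' i) by exact: mB.
pose D : set (W * X) := [set z | box n B' z.1] `&` A.
have mD : measurable D.
  apply: measurableI => //; rewrite -[X in measurable X]setTI.
  by have := @measurable_fst _ _ W X measurableT _ (measurable_box n mB').
have /(stationary_ae smu) := IH B' mB'; apply: filterS => x Hx.
transitivity (\int[q]_(t in B 0%N) slice D (f (t, x)))%E.
  rewrite -slice_cons//; congr (Q _); rewrite boxS.
  have AF w : A (F (w, x)) = A (w, x) by rewrite -[in RHS]invA.
  apply/seteqP; split => w /=; first by move=> [[? ?] ?]; split => //; split => //; rewrite AF.
  by move=> [? [? ]]; rewrite AF.
transitivity (\int[q]_(t in B 0%N) (cst (c%:E * Q (box n B'))%E t))%E.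
  apply: ae_eq_integral => //.
  - apply: measurable_funTS; apply: (measurableT_comp (measurable_slice mD)).
    exact: measurable_section.
  - by apply: filterS Hx => t /contrapT.
rewrite integral_cst// -muleA; congr (_ * _)%E.
by rewrite !prodQ// big_ord_recl muleC.
Qed.

Lemma skew_product_ergodic (mu : probability X R) : stationary q f mu ->
  (forall u, harmonic q f u -> {ae mu, forall x, u x = fine (\int[mu]_x (u x)%:E)}) ->
  ergodic (Q \x mu)%E F.
Proof.
move=> smu Hu; split; first exact: measurable_skew_product.
  by move=> A mA; exact: skew_product_preserves.
move=> A mA invA; have hu := invariant_harmonic mA invA.
have := Hu _ hu; move: (fine _) => c uc.
have sliceA : {ae mu, forall x, slice A x = c%:E}.
  by apply: filterS uc => x <-; rewrite fineK// slice_fin_num.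
have nuA : ((Q \x mu) A = c%:E)%E.
  rewrite integral_slice//; transitivity (\int[mu]_x (cst c%:E x))%E.
    by apply: ae_eq_integral => //; [exact: measurable_slice|exact: filterS sliceA].
  by rewrite integral_cst//= probability_setT mule1.
have [c0|c0] := eqVneq c 0; [by left; rewrite nuA c0|right].
have c_gt0 : 0 < c by rewrite lt_neqAle eq_sym c0 -lee_fin -nuA measure_ge0.
have rectP E B : measurable E -> measurable B ->
    ((Q \x mu) ((E `*` B) `&` A) = c%:E * (Q E * mu B))%E.
  move=> mE mB; have Bf : mu B \is a fin_num by exact: fin_num_measure.
  have cB : 0 <= c * fine (mu B) by apply: mulr_ge0; [exact: ltW|exact: fine_ge0].
  have mDA (D : set W) : measurable D -> measurable ((D `*` B) `&` A).
    by move=> mD; apply: measurableI => //; exact: measurableX.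
  (* For fixed [B] both sides of [rectP] are measures in [E], so it is enough to compare them on
     boxes. *)
  pose M1 : {measure set W -> \bar R} :=
    measure_function.measure_function_pushforward__canonical__measure_function_Measure
      (mrestr (Q \x mu)%E (mDA _ measurableT)) (@measurable_fst _ _ W X).
  pose M2 : {measure set W -> \bar R} := mscale (NngNum cB) Q.
  have M1E D : M1 D = (Q \x mu)%E ((D `*` B) `&` A).
    rewrite /M1/= /pushforward /mrestr; congr ((Q \x mu)%E _).
    by apply/seteqP; split => -[w x] /=; [move=> [? [[]]]|move=> [[]]].
  have M2E D : M2 D = (c%:E * (Q D * mu B))%E.
    transitivity ((c * fine (mu B))%:E * Q D)%E => //.
    by rewrite EFinM fineK// -muleA; congr (_ * _)%E; exact: muleC.
  rewrite -M1E -M2E; apply: box_measure_unique mE => [|n C mC].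
    rewrite M1E; apply: (@le_lt_trans _ _ 1%E); last exact: ltry.
    by apply: probability_le1; exact: (mDA _ measurableT).
  rewrite M1E M2E integral_slice; last exact: (mDA _ (measurable_box n mC)).
  transitivity (\int[mu]_(x in B) (cst (c%:E * Q (box n C))%E x))%E; last first.
    by rewrite integral_cst// muleA.
  rewrite [RHS]integral_mkcond; apply: ae_eq_integral => //.
  - exact: (measurable_slice (mDA _ (measurable_box n mC))).
  - by apply/(measurable_restrictT _ _).1 => //; exact: measurable_cst.
  apply: filterS (invariant_box smu mA invA sliceA n mC) => x Hx _.
  rewrite patchE; case: (boolP (x \in B)) => [|/negP]; rewrite inE => Bx.
    by rewrite /cst -Hx; congr (Q _); apply/seteqP; split => w /=; [move=> [[]]|case].
  by rewrite -[RHS](measure0 Q); congr (Q _); apply/seteqP; split => w //= -[[]].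
have ci : 0 <= c^-1 by rewrite invr_ge0 ltW.
(* By [rectP] the restriction of [Q \x mu] to [A], divided by [c], agrees with [Q \x mu] on
   rectangles, hence everywhere; at [A] its value is [c^-1 * c = 1]. *)
have := @product_measure_unique _ _ _ _ _ Q mu (mscale (NngNum ci) (mrestr (Q \x mu)%E mA)).
move=> /(_ _ A mA) ->.
  transitivity (c^-1%:E * (Q \x mu) (A `&` A))%E => //.
  by rewrite setIid nuA -EFinM mulVf.
move=> E B mE mB.
transitivity (c^-1%:E * (Q \x mu) ((E `*` B) `&` A))%E => //.
by rewrite rectP// muleA -EFinM mulVf// mul1e.
Qed.

End skew_product.

(** Off [S] the density has integral 0, so it vanishes there almost everywhere. *)
Lemma density_supp_subset d (X : measurableType d) (R : realType)
    (m mu : probability X R) (S : set X) :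
  mu `<< m -> measurable S -> mu S = 1%E -> {ae m, forall x, density_supp m mu x -> S x}.
Proof.
move=> mum mS /(prob1P mu mS) S0.
have [h [h0 _ muE RNE]] := dominated_density mum.
have mC : measurable (~` S) by exact: measurableC.
have mh : measurable_fun (~` S) (EFin \o h).
  exact/measurable_funTS/measurable_EFinP/L1_measurable.
have hC : (\int[m]_(x in ~` S) `|(h x)%:E| = 0)%E.
  rewrite -S0 muE//; apply: ae_eq_integral => //; first exact: measurableT_comp.
  by apply: filterS h0 => x ? _; rewrite gee0_abs.
have := (ae_eq_integral_abs m mC mh).1 hC.
apply: filterS2 RNE => x RNx hx; rewrite /density_supp /= RNx => nz.
by apply: contrapT => /hx /= [] hx0; move: nz; rewrite hx0 eqxx.
Qed.

Lemma density_supp_disjoint d (X : measurableType d) (R : realType)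
    (m mu1 mu2 : probability X R) (S1 S2 : set X) :
  mu1 `<< m -> mu2 `<< m -> measurable S1 -> measurable S2 ->
  mu1 S1 = 1%E -> mu2 S2 = 1%E -> S1 `&` S2 = set0 ->
  m (density_supp m mu1 `&` density_supp m mu2) = 0%E.
Proof.
move=> mum1 mum2 mS1 mS2 S11 S21 dis.
have msupp (mu : probability X R) : mu `<< m -> measurable (density_supp m mu).
  move=> mum; have mRN : measurable_fun [set: X] (Radon_Nikodym (charge_of_finite_measure mu) m).
    by apply: (measurable_int m); exact: Radon_Nikodym_integrable.
  rewrite (_ : density_supp m mu =
    ~` (Radon_Nikodym (charge_of_finite_measure mu) m @^-1` [set 0%E])).
    apply: measurableC; rewrite -[X in measurable X]setTI; exact: mRN.
  by apply/seteqP; split => x /=; rewrite /density_supp /= => /eqP.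
apply/negligibleP; first by apply: measurableI; exact: msupp.
have : {ae m, forall x, ~ (density_supp m mu1 x /\ density_supp m mu2 x)}.
  apply: filterS2 (density_supp_subset mum1 mS1 S11) (density_supp_subset mum2 mS2 S21).
  by move=> x H1 H2 [/H1 ? /H2 ?]; have : (S1 `&` S2) x by []; rewrite dis.
by apply: negligibleS => x ? /=; exact.
Qed.

(** * Basins *)

Section time_averages.
Context (R : realType) (S : Type) (F : S -> S) (g : S -> R) (M : R).
Hypothesis gM : forall z, `|g z| <= M.

Definition time_average n z : R := n%:R^-1 * \sum_(j < n) g (iter j F z).

(** The averages at [F z] and at [z] differ by [(g (F^n z) - g z) / n]. This makes sets of
    convergence exactly invariant. *)
Lemma time_average_shift (a : R) z :
  time_average ^~ (F z) @ \oo --> a <-> time_average ^~ z @ \oo --> a.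
Proof.
have D : (fun n => time_average n (F z) - time_average n z) @ \oo --> (0 : R).
  apply/cvgrPdist_le => e e0; exists (Num.truncn (2 * M / e)).+1 => // n /= nM.
  have n0 : 0 < n%:R :> R by rewrite ltr0n (leq_trans _ nM).
  have sumE : \sum_(j < n) g (iter j F (F z)) - \sum_(j < n) g (iter j F z) =
      g (iter n F z) - g z.
    elim: n {nM n0} => [|n IH]; first by rewrite !big_ord0 !subrr.
    rewrite !big_ord_recr /= opprD addrACA IH -iterSr /=.
    by rewrite addrACA addrC addrACA [- g z + _]addrC; ring.
  rewrite sub0r normrN /time_average -mulrBr sumE normrM gtr0_norm ?invr_gt0//.
  rewrite ler_pdivrMl// (le_trans (ler_normB _ _))// (le_trans (lerD (gM _) (gM _)))//.
  rewrite -mulr2n -[M *+ 2]mulr_natl -ler_pdivrMr//.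
  by rewrite (le_trans (ltW (truncnS_gt _)))// ler_nat.
split=> H.
  rewrite -[a]subr0 (_ : time_average ^~ z = fun n => time_average n (F z) -
    (time_average n (F z) - time_average n z)); first exact: cvgB.
  by apply/funext => n; rewrite opprB addrC subrK.
rewrite -[a]addr0 (_ : time_average ^~ (F z) = fun n => time_average n z +
  (time_average n (F z) - time_average n z)); first exact: cvgD.
by apply/funext => n; rewrite addrC subrK.
Qed.

End time_averages.

Lemma measurable_cvg_set d (S : measurableType d) (R : realType) (u : nat -> S -> R) (a : R) :
  (forall n, measurable_fun [set: S] (u n)) -> measurable [set z | u ^~ z @ \oo --> a].
Proof.
move=> mu.
rewrite (_ : [set _ | _] = \bigcap_k \bigcup_N \bigcap_n
  [set z | (N <= n)%N -> `|a - u n z| <= k.+1%:R^-1]).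
  apply: bigcap_measurable => // k _; apply: bigcup_measurable => N _.
  apply: bigcap_measurable => // n _; case: (leqP N n) => [Nn|nN]; last first.
    by rewrite (_ : [set _ | _] = setT)//; apply/seteqP; split.
  rewrite (_ : [set _ | _] = ~` [set z | k.+1%:R^-1 < `|a - u n z|]).
    apply/measurableC/measurable_superlevel; apply: measurableT_comp => //.
    exact: measurable_funB.
  apply/seteqP; split => z /=; first by move=> /(_ isT) h /(le_lt_trans h); rewrite ltxx.
  by move=> /negP; rewrite -leNgt.
apply/seteqP; split => z /=.
  move=> /cvgrPdist_le H k _; have [N _ HN] := H k.+1%:R^-1 ltac:(by rewrite invr_gt0).
  by exists N => // n _ /= Nn; exact: HN.
move=> H; apply/cvgrPdist_le => e e0.
have [N _ HN] := H (Num.truncn e^-1) I; exists N => // n /= Nn.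
apply: (le_trans (HN n I Nn)); rewrite -[leRHS]invrK lef_pV2 ?posrE ?invr_gt0//.
exact/ltW/truncnS_gt.
Qed.

Section physical_measures.
Context dT (T : measurableType dT) dX (X : measurableType dX) (R : realType).
Variables (q : probability T R) (Q : probability (sequence_space T) R).
Variables (m : probability X R) (f : T * X -> X).
Hypothesis mf : measurable_fun [set: T * X] f.
Hypothesis prodQ : is_product_probability q Q.
Local Notation W := (sequence_space T).
Local Notation F := (skew_product f).

Lemma iter_skew_product j w x :
  iter j F (w, x) = (fun n => w (n + j)%N, random_iter f j w x).
Proof.
elim: j => [|j IH] /=; first by congr pair; apply/funext => n; rewrite addn0.
by rewrite IH; congr pair; apply/funext => n; rewrite /= addSnnS.
Qed.

Lemma basinE (mu : probability X R) (psi : X -> R) w x : basin f w mu psi x =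
  (time_average F (psi \o snd) ^~ (w, x) @ \oo --> \int[mu]_y psi y).
Proof.
rewrite /basin /=; congr (cvg_to (_ @ \oo) _); apply/funext => n.
by congr (_ * _); apply: eq_bigr => j _; rewrite iter_skew_product.
Qed.

Lemma Rintegral_snd (mu : probability X R) (psi : X -> R) (M : R) :
  measurable_fun [set: X] psi -> (forall x, `|psi x| <= M) ->
  \int[(Q \x mu)%E]_z psi z.2 = \int[mu]_y psi y.
Proof.
move=> mpsi psiM; congr fine.
pose nu : probability (W * X)%type R := (Q \x mu)%E.
have ipsi : nu.-integrable [set: W * X] ((EFin \o psi) \o snd).
  have mps : measurable_fun [set: W * X] (psi \o snd).
    exact: measurableT_comp mpsi measurable_snd.
  exact: (@bounded_integrable _ _ _ nu _ M mps (fun z => psiM z.2)).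
have mpsiE : measurable_fun [set: X] (EFin \o psi) by exact/measurable_EFinP.
have := @integral_pushforward _ _ _ _ R _ (@measurable_snd _ _ W X) _ setT _ mpsiE ipsi measurableT.
rewrite preimage_setT => <-; apply: eq_measure_integral => A mA _.
rewrite /= /pushforward (_ : snd @^-1` A = setT `*` A); last first.
  by apply/seteqP; split => z //= -[].
rewrite product_measure1E// -[RHS]mul1e; congr (_ * _)%E; exact: probability_setT.
Qed.

Lemma measurable_time_average (psi : X -> R) n : measurable_fun [set: X] psi ->
  measurable_fun [set: W * X] (time_average F (psi \o snd) n).
Proof.
move=> mpsi; apply: measurable_funM => //; apply: measurable_sum => j.
apply: (measurableT_comp (measurableT_comp mpsi measurable_snd)).
elim: (nat_of_ord j) => [|k IH] /=; first exact: measurable_id.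
exact: measurableT_comp (measurable_skew_product mf) IH.
Qed.

Variable P : L1 m -> L1 m.
Hypothesis markovP : markov_operator P.
Hypothesis aP : induces (annealed_transition q f) P.
Hypothesis ucP : uniformly_constrictive P.
Variables c rho : R.
Hypotheses (c0 : 0 < c) (rho1 : rho < 1).
Hypothesis stationary_bound : forall nu : probability X R,
  stationary q f nu -> nu `<< m -> forall A, measurable A ->
  (nu A <= rho%:E + c%:E * m A)%E.

Lemma physical_measures : FPM q Q m f.
Proof.
have [r [mu [S max]]] := maximal_family_exists c0 rho1 stationary_bound.
have [[fam dis] _] := max.
have erg i : (i < r)%N -> ergodic (Q \x mu i)%E F.
  move=> ir; have [smu _ _ _] := fam i ir; apply: (skew_product_ergodic mf prodQ smu) => u.
  exact: (harmonic_constant mf max ir).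
exists r, (fun i : 'I_r => mu i); split.
- by move=> i; have [smu _ _ _] := fam i (ltn_ord i); split => //; exact: erg.
- by move=> i; have [] := fam i (ltn_ord i).
- move=> i j ij; have [_ mi mSi Si] := fam i (ltn_ord i).
  have [_ mj mSj Sj] := fam j (ltn_ord j).
  apply: (density_supp_disjoint mi mj mSi mSj Si Sj); apply: dis => //.
  by move=> /ord_inj /eqP; apply/negP.
move=> psi mpsi [M psiM]; pose g (z : W * X) := psi z.2.
have mg : measurable_fun [set: W * X] g by exact: measurableT_comp mpsi measurable_snd.
pose G : set (W * X) := \bigcup_(i in [set: 'I_r])
  [set z | time_average F g ^~ z @ \oo --> \int[mu i]_y psi y].
have mG : measurable G.
  apply: fin_bigcup_measurable; first exact: finite_finset.
  by move=> i _; apply: measurable_cvg_set => n; exact: measurable_time_average.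
have invG : F @^-1` G = G.
  have H z a : _ <-> _ := @time_average_shift R _ F g M (fun z => psiM z.2) a z.
  by apply/seteqP; split => z [i _ Hi]; exists i => //; apply/H.
have hu := invariant_harmonic mf prodQ mG invG; have [mu' u01 _] := hu.
have ui i : (i < r)%N -> {ae mu i, forall x, fine (slice Q G x) = 1}.
  move=> ir; apply: eq_mean_ae => //; last first.
    by apply/aeW => x; case/andP: (u01 x).
  have := Birkhoff (erg i ir) mg (fun z => psiM z.2).
  rewrite (Rintegral_snd _ mpsi psiM) => Bir.
  have <- : ((Q \x mu i) G = 1)%E.
    apply: (@prob1_ae _ _ _ (Q \x mu i)%E G mG).
    by apply: filterS Bir => z Hz; exists (Ordinal ir).
  rewrite integral_slice//; apply: eq_integral => x _.
  by rewrite fineK// slice_fin_num.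
have um := maximal_family_absorbs mf markovP aP ucP max hu ui.
have secG w : (m (xsection G w) \is a fin_num)%E.
  by apply: fin_num_measure; exact: measurable_xsection.
(* By Tonelli the sections of [G] at fixed [w] have measure 1 in the mean, hence for almost every
   [w]. *)
have G1 : (1%:E = \int[Q]_w (fine (m (xsection G w)))%:E)%E.
  transitivity ((Q \x m) G)%E; last first.
    by apply: eq_integral => w _; rewrite fineK.
  rewrite integral_slice//; transitivity (\int[m]_x (cst 1%E x))%E.
    by rewrite integral_cst//= probability_setT mule1.
  apply: ae_eq_integral => //; first exact: measurable_slice.
  by apply: filterS um => x Hx _; rewrite -[RHS]fineK ?slice_fin_num// Hx.
have v01 w : 0 <= fine (m (xsection G w)) <= 1.
  rewrite fine_ge0 ?measure_ge0//= -lee_fin fineK//.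
  by apply: probability_le1; exact: measurable_xsection.
have mv : measurable_fun [set: W] (fun w => fine (m (xsection G w))).
  by apply: measurableT_comp => //; exact: measurable_fun_xsection.
apply: filterS (eq_mean_ae mv v01 G1 (aeW _ (fun w => proj2 (andP (v01 w))))) => w mw.
transitivity (m (xsection G w)); last by rewrite -(fineK (secG w)) mw.
congr (m _); apply/seteqP; split => x; rewrite /xsection /=.
  by move=> [i _ bi]; rewrite inE; exists i => //; rewrite /= -basinE.
by rewrite inE => -[i _ bi]; exists i => //; rewrite basinE.
Qed.

End physical_measures.

Theorem theorem6p4 (R : realType) (X : ptopologicalType)
    (m : probability (Borel X) R) (P : L1 m -> L1 m)
    (k : R.-pker Borel X ~> Borel X) (n0 : nat) (p : Borel X -> Borel X -> R)
    (polishX : is_polish R X)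
    (markovP : markov_operator P)
    (inducesP : induces (fun x A => k x A) P)
    (n0_ge1 : (1 <= n0)%N)
    (p_ge0 : forall x y, 0 <= p x y)
    (p_meas : forall x, measurable_fun [set: Borel X] (p x))
    (p_density : forall x (A : set (Borel X)), measurable A ->
       kernel_iter k n0 x A = (\int[m]_(y in A) (p x y)%:E)%E)
    (p_bound : lower_bound_condition m p \/ upper_bound_condition m p) :
  uniformly_constrictive P /\
  (forall (d : measure_display) (T : measurableType d) (q : probability T R)
     (Q : probability (sequence_space T) R) (f : T * Borel X -> Borel X),
     is_product_probability q Q ->
     measurable_fun [set: T * Borel X] f ->
     induces (annealed_transition q f) P ->
     FPM q Q m f).
Proof.
have [ucP [c [rho [c0 _ rho1 bound]]]] :=
  constrictive_invariant_bound polishX markovP inducesP p_ge0 p_meas p_density p_bound.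
split=> // d T q Q f prodQ mf aP.
apply: (physical_measures mf prodQ markovP aP ucP c0 rho1) => nu snu num A mA.
have [h [h0 h1 nuE _]] := dominated_density num.
rewrite nuE//; apply: bound => //; first by rewrite h1.
exact/(invariant_density_stationary mf aP h0 nuE).
Qed.
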